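(* $F_\hbar[[U_3^+]]:=U_\hbar(\mathfrak{so}_3)^{\Lsh}$ is the topological, $\hbar$-adically complete, unital $\Bbbk[[\hbar]]$-algebra with generators $$k_{1,2}:=q^{-2}(q-q^{-1})K_{1,2},\qquad k_{2,3}:=q^{-1}(q-q^{-1})K_{2,3},\qquad k_{1,3}:=q^{-2}(q-q^{-1})K_{1,3}$$ and relations $$k_{1,2}k_{2,3}=q\,k_{2,3}k_{1,2}-q(q-q^{-1})k_{1,3},$$ $$k_{2,3}k_{1,3}=q\,k_{1,3}k_{2,3}-(q-q^{-1})k_{1,2},$$ $$k_{1,3}k_{1,2}=q\,k_{1,2}k_{1,3}-(q-q^{-1})k_{2,3},$$ with the right coideal structure given by $$\Delta(k_{1,2})=1\otimes k_{1,2}+k_{1,2}\otimes t_1^{-1},\qquad \Delta(k_{2,3})=1\otimes k_{2,3}+k_{2,3}\otimes t_2^{-1},$$ $$\Delta(k_{1,3})=1\otimes k_{1,3}+k_{1,3}\otimes t_1^{-1}t_2^{-1}+(q-q^{-1})\,k_{1,2}\otimes f_2t_1^{-1}-q^{-1}(q-q^{-1})\,k_{2,3}\otimes t_1^{-1}t_2^{-1}e_1.$$ Moreover, $F_\hbar[[U_3^+]]:=U_\hbar(\mathfrak{so}_3)^{\Lsh}$ is a (topologically) free $\Bbbk[[\hbar]]$-module, a (topological) $\Bbbk[[\hbar]]$-basis being the set of ordered monomials $\mathbb B_3:=\{k_{1,2}^{\,a}k_{1,3}^{\,b}k_{2,3}^{\,c}: a,b,c\in\mathbb N\}$.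
   Context: $\Bbbk$ is a field of characteristic $0$; $q:=\exp(\hbar)\in\Bbbk[[\hbar]]$, $q^X:=\exp(\hbar X)$; $\hat\otimes$ is the $\hbar$-adically completed tensor product. $U_\hbar(\mathfrak{gl}_n)$ is the topological, $\hbar$-adically complete, associative unital $\Bbbk[[\hbar]]$-algebra with generators $f_i,\ell_j,e_i$ ($1\le i\le n-1$, $1\le j\le n$) and relations, with $t_i:=q^{\ell_i-\ell_{i+1}}$: $\ell_jf_i-f_i\ell_j=(\delta_{i+1,j}-\delta_{i,j})f_i$; $\ell_j\ell_k=\ell_k\ell_j$; $\ell_je_i-e_i\ell_j=(\delta_{i,j}-\delta_{i+1,j})e_i$; $e_kf_l-f_le_k=\delta_{k,l}\frac{t_k-t_k^{-1}}{q-q^{-1}}$; $e_ie_j=e_je_i$, $f_if_j=f_jf_i$ if $|i-j|>1$; $e_i^2e_j-(q+q^{-1})e_ie_je_i+e_je_i^2=0$ and $f_i^2f_j-(q+q^{-1})f_if_jf_i+f_jf_i^2=0$ if $|i-j|=1$. It is a topological Hopf algebra with $\Delta(f_i)=f_i\otimes t_i^{-1}+1\otimes f_i$, $\Delta(\ell_j)=\ell_j\otimes1+1\otimes\ell_j$, $\Delta(e_i)=e_i\otimes1+t_i\otimes e_i$, $\epsilon(f_i)=\epsilon(\ell_j)=\epsilon(e_i)=0$, $S(f_i)=-f_it_i$, $S(\ell_j)=-\ell_j$, $S(e_i)=-t_i^{-1}e_i$. $U_\hbar(\mathfrak{sl}_n)$ is the closed subalgebra (a Hopf subalgebra) generated by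 the $f_i$, $h_i:=\ell_i-\ell_{i+1}$, $e_i$. Set $[x,y]_a=xy-a\,yx$; $E_{i,i+1}=e_i$, $E_{i,j}=[E_{i,k},E_{k,j}]_q$, $F_{i+1,i}=f_i$, $F_{j,i}=[F_{j,k},F_{k,i}]_{q^{-1}}$ for $i<k<j$; $g_i:=q^{\ell_i}$. The $L$-operators are $L^+_{i,i}=g_i$, $L^-_{i,i}=g_i^{-1}$; $L^+_{i,j}=(q-q^{-1})g_iF_{j,i}$, $L^+_{j,i}=0$ for $i<j$; $L^-_{i,j}=-(q-q^{-1})E_{j,i}g_j^{-1}$, $L^-_{j,i}=0$ for $i>j$. For $i<j$ put $K_{i,j}=\sum_{k=i}^{j}q^{n-k}(q-q^{-1})^{-1}L^-_{k,i}L^+_{k,j}$, which belongs to $U_\hbar(\mathfrak{sl}_n)$, and let $U_\hbar(\mathfrak{so}_n)$ be the closed unital $\Bbbk[[\hbar]]$-subalgebra of $U_\hbar(\mathfrak{sl}_n)$ generated by the $K_{i,j}$, $i<j$; it is a right coideal of $U_\hbar(\mathfrak{sl}_n)$, i.e. $\Delta(U_\hbar(\mathfrak{so}_n))\subseteq U_\hbar(\mathfrak{so}_n)\hat\otimes U_\hbar(\mathfrak{sl}_n)$, quantizing $U(\mathfrak{so}_n)$. For $n=3$ explicitly: $K_{1,2}=q^2(f_1-q\,t_1^{-1}e_1)$, $K_{2,3}=q(f_2-q\,t_2^{-1}e_2)$, $K_{1,3}=q^2\big(F_{3,1}-(q-q^{-1})f_2t_1^{-1}e_1-t_1^{-1}t_2^{-1}E_{1,3}\big)$.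 Let $\delta_d=(\mathrm{id}-\epsilon)^{\otimes d}\circ\Delta^d$, with $\Delta^d$ the iterated coproduct with values in $d$-fold tensors ($\Delta^1=\mathrm{id}$). Then $$U_\hbar(\mathfrak{so}_3)^{\Lsh}=\{x\in U_\hbar(\mathfrak{so}_3):\delta_d(x)\in\hbar^d\,U_\hbar(\mathfrak{so}_3)\hat\otimes U_\hbar(\mathfrak{sl}_3)^{\hat\otimes(d-1)}\ \forall d\ge1\}.$$ $U_3^+$ denotes the space of $3\times3$ upper triangular unipotent (Stokes) matrices; the symbol $F_\hbar[[U_3^+]]$ is by definition $U_\hbar(\mathfrak{so}_3)^{\Lsh}$. Topological sense: infinite sums converge in the $\hbar$-adic topology of $U_\hbar(\mathfrak{sl}_3)$ (where each $k_{i,j}\in\hbar U_\hbar(\mathfrak{sl}_3)$), so ''topological basis'' means that every element is uniquely a convergent series $\sum_{a,b,c}\chi_{a,b,c}k_{1,2}^ak_{1,3}^bk_{2,3}^c$ with $\chi_{a,b,c}\in\Bbbk[[\hbar]]$; the presentation by generators and relations is understood in the same completed sense.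
   Formalization: In Δ(k_{1,3}) the printed coefficients of the last two terms are false for the given coproduct; the formal statement has q^{-1}(q-q^{-1}) k_{1,2}⊗f_2t_1^{-1} - (q-q^{-1}) k_{2,3}⊗t_1^{-1}t_2^{-1}e_1, i.e. the factor q^{-1} moved to the other term. *)

(* Defs.v *)
From HB Require Import structures.
From mathcomp Require Import all_boot all_order all_algebra.
From mathcomp Require Import boolp classical_sets.

Set Implicit Arguments.
Unset Strict Implicit.
Unset Printing Implicit Defensive.

Import GRing.Theory.
Local Open Scope ring_scope.
Local Open Scope classical_set_scope.

(* The ring k[[hbar]]: a power series is the sequence of its coefficients.   *)

Definition hser (k : fieldType) := nat -> k.

Section PowerSeries.
Variable k : fieldType.
Local Notation K := (hser k).
Implicit Types a b c : K.

HB.instance Definition _ := gen_eqMixin K.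
HB.instance Definition _ := gen_choiceMixin K.

Definition hser_zero : K := fun=> 0.
Definition hser_opp a : K := fun n => - a n.
Definition hser_add a b : K := fun n => a n + b n.

Fact hser_addA : associative hser_add.
Proof. by move=> a b c; apply/funext => n; apply: addrA. Qed.
Fact hser_addC : commutative hser_add.
Proof. by move=> a b; apply/funext => n; apply: addrC. Qed.
Fact hser_add0 : left_id hser_zero hser_add.
Proof. by move=> a; apply/funext => n; apply: add0r. Qed.
Fact hser_addN : left_inverse hser_zero hser_opp hser_add.
Proof. by move=> a; apply/funext => n; apply: addNr. Qed.

HB.instance Definition _ :=
  GRing.isZmodule.Build K hser_addA hser_addC hser_add0 hser_addN.

Definition hser_one : K := fun n => (n == 0%N)%:R.
Definition hser_mul a b : K := fun n => \sum_(i < n.+1) a i * b (n - i)%N.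

(* Coefficients of products can be computed on truncations, which reduces
   the ring axioms to those of {poly k}. *)
Let tr N a : {poly k} := \poly_(i < N.+1) a i.

Let tr_coef N a n : (n <= N)%N -> (tr N a)`_n = a n.
Proof. by move=> nN; rewrite coef_poly ltnS nN. Qed.

Let tr_mul N a b n : (n <= N)%N -> hser_mul a b n = (tr N a * tr N b)`_n.
Proof.
move=> nN; rewrite coefM; apply: eq_bigr => i _.
have iN : (i <= N)%N by apply: leq_trans nN; rewrite -ltnS.
by rewrite !tr_coef // (leq_trans (leq_subr _ _) nN).
Qed.

Fact hser_mulC : commutative hser_mul.
Proof. by move=> a b; apply/funext => n; rewrite !(@tr_mul n) // mulrC. Qed.

Fact hser_mulA : associative hser_mul.
Proof.
move=> a b c; apply/funext => n.
have le_ord (i : 'I_n.+1) : (i <= n)%N by rewrite -ltnS.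
rewrite (_ : hser_mul a _ n = (tr n a * (tr n b * tr n c))`_n).
  rewrite (_ : hser_mul _ c n = (tr n a * tr n b * tr n c)`_n) ?mulrA //.
  by rewrite coefM; apply: eq_bigr => i _; rewrite -tr_mul ?tr_coef ?leq_subr.
by rewrite coefM; apply: eq_bigr => i _; rewrite -tr_mul ?tr_coef ?leq_subr.
Qed.

Fact hser_mul1 : left_id hser_one hser_mul.
Proof.
move=> a; apply/funext => n; rewrite /hser_mul big_ord_recl /= subn0 mul1r.
by rewrite big1 ?addr0 // => i _; rewrite mul0r.
Qed.

Fact hser_mulDl : left_distributive hser_mul hser_add.
Proof.
move=> a b c; apply/funext => n; rewrite /hser_add /hser_mul -big_split /=.
by apply: eq_bigr => i _; rewrite mulrDl.
Qed.

Fact hser_oner_neq0 : hser_one != 0.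
Proof.
by apply/eqP => /(congr1 (fun a : K => a 0%N)) /eqP; rewrite /hser_one oner_eq0.
Qed.

HB.instance Definition _ := GRing.Zmodule_isComNzRing.Build K
  hser_mulA hser_mulC hser_mul1 hser_mulDl hser_oner_neq0.

Definition hC (x : k) : K := fun n => if n == 0%N then x else 0.
Definition hbar : K := fun n => (n == 1%N)%:R.

(* q^m = exp(m hbar) *)
Definition qp (m : int) : K := fun n => m%:~R ^+ n / n`!%:R.

(* (q - q^-1) / (2 hbar) = \sum_m hbar^(2m) / (2m+1)! *)
Definition sinhc : K := fun n => if odd n then 0 else (n.+1)`!%:R^-1.

Definition qq : K := qp 1 - qp (-1).

Lemma coef_hM (a b : K) n : (a * b) n = \sum_(i < n.+1) a i * b (n - i)%N.
Proof. by []. Qed.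

(* q - q^-1 = 2 * hbar * sinhc, so that sinhc is a unit when 2 is *)
Lemma qqE : qq = hC 2%:R * hbar * sinhc.
Proof.
have hbarM (a : K) m : (hbar * a) m = if m is m'.+1 then a m' else 0.
  rewrite coef_hM; case: m => [|m]; first by rewrite big_ord1 mul0r.
  rewrite big_ord_recl big_ord_recl /= mul0r add0r mul1r subSS subn0.
  by rewrite big1 ?addr0 // => i _; rewrite mul0r.
have hCM x (a : K) m : (hC x * a) m = x * a m.
  rewrite coef_hM big_ord_recl /= subn0.
  by rewrite big1 ?addr0 // => i _; rewrite mul0r.
apply/funext => n; rewrite -mulrA hCM hbarM.
rewrite (_ : qq n = qp 1 n - qp (-1) n) // /qp.
case: n => [|n]; first by rewrite !expr0 subrr mulr0.
rewrite /sinhc expr1n mulrN1z -mulrBl -[in (- 1) ^+ _]signr_odd /=.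
case: (odd n) => /=; first by rewrite expr0 subrr mul0r mulr0.
by rewrite expr1 opprK.
Qed.

End PowerSeries.

Arguments hbar {k}.
Arguments qp {k} m.
Arguments qq {k}.
Arguments sinhc {k}.

(* hbar-adic topology. All notions are relative to a subset S of the ambient *)
(* module V (in practice a submodule), whose neighbourhoods of 0 are the     *)
(* hbar^N S; the hbar-adic topology of V itself is the case S = setT.        *)

Section Adic.
Variables (k : fieldType) (V : lmodType (hser k)).
Implicit Types (S T : set V) (s : nat -> V).

Definition hcong S (N : nat) (x y : V) : Prop :=
  exists2 z, S z & x - y = hbar ^+ N *: z.

Definition hcvg S s (y : V) : Prop :=
  forall N, exists m, forall i, (m <= i)%N -> hcong S N (s i) y.

Definition hcauchy S s : Prop :=
  forall N, exists m, forall i j, (m <= i)%N -> (m <= j)%N ->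
    hcong S N (s i) (s j).

Definition hcomplete S : Prop :=
  (forall x, S x -> (forall N, hcong S N x 0) -> x = 0) /\
  (forall s, (forall i, S (s i)) -> hcauchy S s ->
     exists2 y, S y & hcvg S s y).

Definition hclosure S T : set V :=
  [set x | S x /\ forall N, exists2 y, T y & hcong S N x y].

Definition hlim s : V := xget 0 [set y | hcvg setT s y].

End Adic.

Section Algebras.
Variables (k : fieldType) (A : algType (hser k)).
Implicit Types (S X : set A) (x : A).

Definition is_subalg S : Prop :=
  [/\ S 1, forall x y, S x -> S y -> S (x + y),
      forall a x, S x -> S (a *: x) & forall x y, S x -> S y -> S (x * y)].

Definition gen_subalg X : set A :=
  [set x | forall S, is_subalg S -> X `<=` S -> S x].

(* q^x = exp(hbar x) *)
Definition qexp x : A :=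
  hlim (fun N => \sum_(m < N) (hC (m`!%:R^-1) * hbar ^+ m) *: x ^+ m).

(* (q^x - q^(-x)) / (2 hbar) = \sum_m hbar^(2m) x^(2m+1) / (2m+1)! *)
Definition qsinhc x : A :=
  hlim (fun N => \sum_(m < N)
    (hC ((m.*2.+1)`!%:R^-1) * hbar ^+ m.*2) *: x ^+ m.*2.+1).

Definition qcomm (a : hser k) (x y : A) : A := x * y - a *: (y * x).

End Algebras.

(* The completed tensor product M (x)^ N of k[[hbar]]-modules.               *)
(*                                                                           *)
(* An element is represented by r : nat -> seq (M * N), standing for         *)
(*     \sum_n hbar^n \sum_((x, y) <- r n) x (x) y.                           *)
(* Two representatives are identified when for every m they agree in         *)
(* (M (x) N) / hbar^m (M (x) N), that is, when every bilinear map with       *)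
(* values in a module killed by hbar^m takes the same value on both.         *)

Section CompletedTensor.
Variable k : fieldType.
Local Notation K := (hser k).

Record bilinear_map (M N W : lmodType K) (phi : M -> N -> W) : Prop := {
  bilinear_l : forall y, linear (phi^~ y);
  bilinear_r : forall x, linear (phi x)
}.

Section Module.
Variables M N : lmodType K.

Definition craw : Type := nat -> seq (M * N).
HB.instance Definition _ := gen_eqMixin craw.
HB.instance Definition _ := gen_choiceMixin craw.

Implicit Types r s : craw.

Definition ceval m (W : lmodType K) (phi : M -> N -> W) r : W :=
  \sum_(n < m) hbar ^+ n *: \sum_(p <- r n) phi p.1 p.2.

Definition ceq r s : Prop :=
  forall m (W : lmodType K) (phi : M -> N -> W), bilinear_map phi ->
    (forall w : W, hbar ^+ m *: w = 0) -> ceval m phi r = ceval m phi s.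

Definition ceqb r s : bool := `[< ceq r s >].

Fact ceqb_refl : reflexive ceqb.
Proof. by move=> r; apply/asboolP. Qed.
Fact ceqb_sym : symmetric ceqb.
Proof.
move=> r s; apply/idP/idP => /asboolP rs; apply/asboolP => m W phi b0 h;
  by rewrite (rs m W phi b0 h).
Qed.
Fact ceqb_trans : transitive ceqb.
Proof.
move=> s r t /asboolP rs /asboolP st; apply/asboolP => m W phi b0 h.
by rewrite (rs m W phi b0 h) (st m W phi b0 h).
Qed.

Canonical ceq_equiv := EquivRel ceqb ceqb_refl ceqb_sym ceqb_trans.

Definition ctens : Type := {eq_quot ceq_equiv}%qT.
HB.instance Definition _ := Choice.on ctens.
HB.instance Definition _ := EqQuotient.on ctens.

Definition cpi (r : craw) : ctens := (\pi_ctens r)%qT.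
Definition crepr (t : ctens) : craw := repr t.

Lemma creprK t : cpi (crepr t) = t.
Proof. exact: reprK. Qed.

Lemma cpiP r s : cpi r = cpi s <-> ceq r s.
Proof.
split=> [/eqmodP/asboolP//|rs]; exact/eqmodP/asboolP.
Qed.

Lemma crepr_cpi r : ceq (crepr (cpi r)) r.
Proof. by apply/cpiP; rewrite creprK. Qed.

Definition craw_add r s : craw := fun n => r n ++ s n.
Definition craw_scale (a : K) r : craw :=
  fun n => [seq (a *: p.1, p.2) | p <- r n].

Lemma ceval0 m (W : lmodType K) (phi : M -> N -> W) : ceval m phi (fun=> [::]) = 0.
Proof. by rewrite /ceval big1 // => n _; rewrite big_nil scaler0. Qed.

Lemma cevalD m (W : lmodType K) (phi : M -> N -> W) r s :
  ceval m phi (craw_add r s) = ceval m phi r + ceval m phi s.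
Proof.
rewrite /ceval -big_split /=; apply: eq_bigr => n _.
by rewrite big_cat /= scalerDr.
Qed.

Lemma bilinear_lZ (W : lmodType K) (phi : M -> N -> W) a x y :
  bilinear_map phi -> phi (a *: x) y = a *: phi x y.
Proof.
case=> L _; have := L y a x 0; rewrite !addr0 => ->.
suff -> : phi 0 y = 0 by rewrite addr0.
by have := L y (-1) 0 0; rewrite scaler0 addr0 scaleN1r addNr.
Qed.

Lemma cevalZ m (W : lmodType K) (phi : M -> N -> W) a r : bilinear_map phi ->
  ceval m phi (craw_scale a r) = a *: ceval m phi r.
Proof.
move=> B; rewrite /ceval scaler_sumr; apply: eq_bigr => n _.
rewrite big_map [RHS]scalerA [a * _]mulrC -[RHS]scalerA; congr (_ *: _).
by rewrite [RHS]scaler_sumr; apply: eq_bigr => p _; rewrite bilinear_lZ.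
Qed.

Definition ctens0 : ctens := cpi (fun=> [::]).
Definition ctens_add (t u : ctens) : ctens :=
  cpi (craw_add (crepr t) (crepr u)).
Definition ctens_scale (a : K) (t : ctens) : ctens :=
  cpi (craw_scale a (crepr t)).
Definition ctens_opp (t : ctens) : ctens := ctens_scale (-1) t.

Lemma ctens_addE r s : ctens_add (cpi r) (cpi s) = cpi (craw_add r s).
Proof.
apply/cpiP => m W phi B h.
by rewrite !cevalD (crepr_cpi r B h) (crepr_cpi s B h).
Qed.

Lemma ctens_scaleE a r : ctens_scale a (cpi r) = cpi (craw_scale a r).
Proof.
by apply/cpiP => m W phi B h; rewrite !cevalZ // (crepr_cpi r B h).
Qed.

Lemma ctensW (P : ctens -> Prop) : (forall r, P (cpi r)) -> forall t, P t.
Proof. by move=> Pr t; rewrite -(creprK t); apply: Pr. Qed.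

Fact ctens_addA : associative ctens_add.
Proof.
elim/ctensW=> r; elim/ctensW=> s; elim/ctensW=> t; rewrite !ctens_addE.
by apply/cpiP => m W phi B h; rewrite !cevalD addrA.
Qed.
Fact ctens_addC : commutative ctens_add.
Proof.
elim/ctensW=> r; elim/ctensW=> s; rewrite !ctens_addE.
by apply/cpiP => m W phi B h; rewrite !cevalD addrC.
Qed.
Fact ctens_add0 : left_id ctens0 ctens_add.
Proof.
elim/ctensW=> r; rewrite ctens_addE.
by apply/cpiP => m W phi B h; rewrite !cevalD ceval0 add0r.
Qed.
Fact ctens_addN : left_inverse ctens0 ctens_opp ctens_add.
Proof.
elim/ctensW=> r; rewrite /ctens_opp ctens_scaleE ctens_addE.
apply/cpiP => m W phi B h.
by rewrite !cevalD cevalZ // ceval0 scaleN1r addNr.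
Qed.

HB.instance Definition _ :=
  GRing.isZmodule.Build ctens ctens_addA ctens_addC ctens_add0 ctens_addN.

Lemma cpiD r s : cpi r + cpi s = cpi (craw_add r s).
Proof. exact: ctens_addE. Qed.

Fact ctens_scaleA a b t :
  ctens_scale a (ctens_scale b t) = ctens_scale (a * b) t.
Proof.
elim/ctensW: t => r; rewrite !ctens_scaleE.
by apply/cpiP => m W phi B h; rewrite !cevalZ // scalerA.
Qed.
Fact ctens_scale1 : left_id 1 ctens_scale.
Proof.
elim/ctensW=> r; rewrite !ctens_scaleE.
by apply/cpiP => m W phi B h; rewrite !cevalZ // scale1r.
Qed.
Fact ctens_scaleDr : right_distributive ctens_scale +%R.
Proof.
move=> a; elim/ctensW=> r; elim/ctensW=> s.
rewrite cpiD !ctens_scaleE cpiD.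
by apply/cpiP => m W phi B h; rewrite !(cevalZ, cevalD) // scalerDr.
Qed.
Fact ctens_scaleDl t : {morph ctens_scale^~ t : a b / a + b}.
Proof.
elim/ctensW: t => r a b; rewrite !ctens_scaleE cpiD.
by apply/cpiP => m W phi B h; rewrite !(cevalZ, cevalD) // scalerDl.
Qed.

HB.instance Definition _ := GRing.Zmodule_isLmodule.Build K ctens
  ctens_scaleA ctens_scale1 ctens_scaleDr ctens_scaleDl.

Definition pure (x : M) (y : N) : ctens :=
  cpi (fun n => if n is 0%N then [:: (x, y)] else [::]).

(* the image of S (x)^ T in M (x)^ N *)
Definition ctens_img (S : set M) (T : set N) : set ctens :=
  [set cpi r | r in [set r : craw |
     forall n p, p \in r n -> S p.1 /\ T p.2]].

Definition tens_span (S : set M) (T : set N) : set ctens :=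
  [set \sum_(p <- s) pure p.1 p.2 | s in [set s : seq (M * N) |
     forall p, p \in s -> S p.1 /\ T p.2]].

End Module.

(* f (x)^ g; meaningful for k[[hbar]]-linear f and g, see ctens_mapE *)
Definition ctens_map (M N M' N' : lmodType K) (f : M -> M') (g : N -> N')
    (t : ctens M N) : ctens M' N' :=
  cpi (fun n => [seq (f p.1, g p.2) | p <- crepr t n]).

(* the product of A (x)^ B: (x (x) y) (x' (x) y') = xx' (x) yy' *)
Definition craw_mul (A B : algType K) (r s : craw A B) : craw A B :=
  fun n => flatten [seq [seq (p.1 * p'.1, p.2 * p'.2)
                        | p <- r i, p' <- s (n - i)%N] | i <- iota 0 n.+1].

Definition ctens_mul (A B : algType K) (t u : ctens A B) : ctens A B :=
  cpi (craw_mul (crepr t) (crepr u)).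

End CompletedTensor.

Notation "x ⊗ y" := (pure x y) (at level 40, left associativity).

Lemma ctens_mapE (k : fieldType) (M N M' N' : lmodType (hser k))
    (f : {linear M -> M'}) (g : {linear N -> N'}) (r : craw M N) :
  ctens_map f g (cpi r) = cpi (fun n => [seq (f p.1, g p.2) | p <- r n]).
Proof.
apply/cpiP => m W phi B h.
have E s : ceval m phi (fun n => [seq (f p.1, g p.2) | p <- s n]) =
           ceval m (fun x y => phi (f x) (g y)) s.
  by apply: eq_bigr => n _; rewrite big_map.
rewrite !E; apply: crepr_cpi h; case: B => L R.
by split=> [y a u v|x a u v]; rewrite linearP ?L ?R.
Qed.

Lemma pure_mapE (k : fieldType) (M N M' N' : lmodType (hser k))
    (f : {linear M -> M'}) (g : {linear N -> N'}) x y :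
  ctens_map f g (x ⊗ y) = f x ⊗ g y.
Proof.
by rewrite ctens_mapE; congr cpi; apply/funext => -[].
Qed.

Section Mul.
Variables (k : fieldType) (A B : algType (hser k)).

Lemma ceval_mul m (W : lmodType (hser k)) (phi : A -> B -> W) (r s : craw A B) :
  (forall w : W, hbar ^+ m *: w = 0) ->
  ceval m phi (craw_mul r s) =
  ceval m (fun x y => ceval m (fun x' y' => phi (x * x') (y * y')) s) r.
Proof.
move=> h; pose g i j := \sum_(p <- r i) \sum_(p' <- s j)
                           phi (p.1 * p'.1) (p.2 * p'.2).
have -> : ceval m phi (craw_mul r s) =
    \sum_(0 <= n < m) \sum_(0 <= i < m | (i <= n)%N) hbar ^+ n *: g i (n - i)%N.
  rewrite /ceval big_mkord; apply: eq_bigr => n _.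
  rewrite -[RHS]scaler_sumr; congr (_ *: _).
  rewrite -(big_nat_widen 0 n.+1 m predT) // big_flatten big_map.
  rewrite /index_iota subn0; apply: eq_bigr => i _.
  by rewrite big_allpairs_dep.
rewrite (@exchange_big_dep_nat _ _ _ _ _ _ _ _ _ predT) //= /ceval big_mkord.
apply: eq_bigr => i _.
have hz n w : (m <= n)%N -> hbar ^+ n *: (w : W) = 0.
  by move=> mn; rewrite -(subnK mn) exprD -scalerA h scaler0.
rewrite -(big_nat_widenl i 0 m predT (fun n => hbar ^+ n *: g i (n - i)%N)) //.
rewrite -{1}(add0n i) big_addn.
rewrite exchange_big /= scaler_sumr.
rewrite -(big_mkord predT (fun j => hbar ^+ i *: \sum_(p <- r i)
   hbar ^+ j *: \sum_(p' <- s j) phi (p.1 * p'.1) (p.2 * p'.2))).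
rewrite [RHS](big_cat_nat (n := (m - i)%N)) ?leq_subr //=.
rewrite [X in _ + X]big_nat [X in _ + X]big1 ?addr0; last first.
  move=> j /andP[mj _]; rewrite -scaler_sumr scalerA -exprD hz //.
  by rewrite -leq_subLR.
apply: eq_bigr => j _.
by rewrite addnK -scaler_sumr scalerA -exprD addnC.
Qed.

Lemma bilinear_mull (W : lmodType (hser k)) (phi : A -> B -> W) x y :
  bilinear_map phi -> bilinear_map (fun x' y' => phi (x * x') (y * y')).
Proof.
by case=> L R; split=> [y' a u v|x' a u v]; rewrite mulrDr -scalerAr ?L ?R.
Qed.

Lemma bilinear_mulr m (W : lmodType (hser k)) (phi : A -> B -> W) s :
  bilinear_map phi -> bilinear_map
   (fun x y => ceval m (fun x' y' => phi (x * x') (y * y')) s).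
Proof.
case=> L R; split=> [y|x] a u v; rewrite /ceval /= scaler_sumr -big_split /=;
  apply: eq_bigr => n _; rewrite scalerA mulrC -scalerA -scalerDr;
  congr (_ *: _); rewrite scaler_sumr -big_split /=;
  by apply: eq_bigr => p _; rewrite mulrDl -scalerAl ?L ?R.
Qed.

Lemma ctens_mulE (r s : craw A B) :
  ctens_mul (cpi r) (cpi s) = cpi (craw_mul r s).
Proof.
apply/cpiP => m W phi b0 h; rewrite !ceval_mul //.
rewrite (crepr_cpi r (bilinear_mulr m _ b0) h); apply: eq_bigr => n _.
congr (_ *: _); apply: eq_bigr => p _.
exact: crepr_cpi (bilinear_mull _ _ b0) h.
Qed.

Lemma pure_mulE (x x' : A) (y y' : B) :
  ctens_mul (x ⊗ y) (x' ⊗ y') = (x * x') ⊗ (y * y').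
Proof.
rewrite ctens_mulE; apply/cpiP => -[|m] W phi b0 h.
  by rewrite /ceval !big_ord0.
have E (psi : A -> B -> W) u v :
    ceval m.+1 psi (fun n => if n is 0%N then [:: (u, v)] else [::]) = psi u v.
  rewrite /ceval big_ord_recl /=. rewrite big_cons [X in _ *: (_ + X)]big_nil expr0 scale1r addr0.
  by rewrite big1 ?addr0 // => i _; rewrite big_nil scaler0.
by rewrite ceval_mul // !E.
Qed.

End Mul.

(* Index shift: [tpow U d] is the (d+1)-fold completed tensor power, and     *)
(* likewise for the other families below.                                    *)

Section TensorPowers.
Variables (k : fieldType) (U : algType (hser k)).
Local Notation K := (hser k).

Fixpoint tpow (d : nat) : lmodType K :=
  if d is d'.+1 then ctens (tpow d') U else U.

(* S (x)^ T (x)^ ... (x)^ T, with d factors T *)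
Fixpoint tpow_img (S T : set U) (d : nat) : set (tpow d) :=
  match d return set (tpow d) with
  | 0%N => S
  | d'.+1 => ctens_img (@tpow_img S T d') T
  end.

Fixpoint tpow_map (g : U -> U) (d : nat) : tpow d -> tpow d :=
  match d return tpow d -> tpow d with
  | 0%N => g
  | d'.+1 => ctens_map (@tpow_map g d') g
  end.

Variables (Delta : U -> ctens U U) (eps : U -> K).

Fixpoint iter_Delta (d : nat) : U -> tpow d :=
  match d return U -> tpow d with
  | 0%N => idfun
  | d'.+1 => fun x => ctens_map (iter_Delta d') idfun (Delta x)
  end.

(* delta_(d+1) = (id - eps)^(tensor d+1) o Delta^(d+1) *)
Definition delta (d : nat) (x : U) : tpow d :=
  tpow_map (fun y => y - (eps y)%:A) (iter_Delta d x).

End TensorPowers.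

Arguments tpow_img {k U} S T d _.

(* U_hbar(gl_n) for n = m + 1: the simple root generators are indexed by     *)
(* i : 'I_m, standing for the pair of indices (i, i+1), and the Cartan       *)
(* generators l by 'I_m.+1.                                                  *)

Section QuantumGL.
Variables (k : fieldType) (m : nat).
Local Notation K := (hser k).

Definition lo (i : 'I_m) : 'I_m.+1 := widen_ord (leqnSn m) i.
Definition hi (i : 'I_m) : 'I_m.+1 := lift ord0 i.

Section Elements.
Variables (A : algType K) (f : 'I_m -> A) (l : 'I_m.+1 -> A) (e : 'I_m -> A).

Definition cartan (i : 'I_m) : A := l (lo i) - l (hi i).
Definition tq (i : 'I_m) : A := qexp (cartan i).
Definition tqV (i : 'I_m) : A := qexp (- cartan i).

(* In [Uh_ef] the right-hand side (t - t^-1) / (q - q^-1) is the quotient of *)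
(* the power series (q^h - q^-h) / (2 hbar) in h = cartan i by the unit      *)
(* (q - q^-1) / (2 hbar) of k[[hbar]]. Clearing q - q^-1 itself, which is    *)
(* not a unit, would define an algebra with hbar-torsion.                    *)
Record Uh_relations : Prop := {
  Uh_lf : forall j i, l j * f i - f i * l j =
            ((hi i == j)%:R - (lo i == j)%:R) *: f i;
  Uh_ll : forall i j, l i * l j = l j * l i;
  Uh_le : forall j i, l j * e i - e i * l j =
            ((lo i == j)%:R - (hi i == j)%:R) *: e i;
  Uh_ef : forall i j, sinhc *: (e i * f j - f j * e i) =
            (i == j)%:R *: qsinhc (cartan i);
  Uh_ee : forall i j : 'I_m, (i.+1 < j)%N || (j.+1 < i)%N ->
            e i * e j = e j * e i;
  Uh_ff : forall i j : 'I_m, (i.+1 < j)%N || (j.+1 < i)%N ->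
            f i * f j = f j * f i;
  Uh_serre_e : forall i j : 'I_m, (i.+1 == j)%N || (j.+1 == i)%N ->
    e i ^+ 2 * e j - (qp 1 + qp (-1)) *: (e i * e j * e i) + e j * e i ^+ 2 = 0;
  Uh_serre_f : forall i j : 'I_m, (i.+1 == j)%N || (j.+1 == i)%N ->
    f i ^+ 2 * f j - (qp 1 + qp (-1)) *: (f i * f j * f i) + f j * f i ^+ 2 = 0
}.

(* the closed subalgebra U_hbar(sl_n) of U_hbar(gl_n) *)
Definition Uh_sl : set A :=
  hclosure setT (gen_subalg
    [set x | exists i, [\/ x = f i, x = cartan i | x = e i]]).

End Elements.

(* U is the hbar-adically complete algebra with generators f, l, e and the   *)
(* relations above.                                                          *)
Definition is_Uh_gl (U : algType K)
    (f : 'I_m -> U) (l : 'I_m.+1 -> U) (e : 'I_m -> U) : Prop :=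
  [/\ hcomplete [set: U],
      Uh_relations f l e &
      forall (B : algType K) (f' : 'I_m -> B) (l' : 'I_m.+1 -> B)
             (e' : 'I_m -> B),
        hcomplete [set: B] -> Uh_relations f' l' e' ->
        let lifts (phi : {lrmorphism U -> B}) :=
          [/\ forall i, phi (f i) = f' i, forall j, phi (l j) = l' j
            & forall i, phi (e i) = e' i] in
        exists2 phi, lifts phi & forall psi, lifts psi -> psi =1 phi].

(* Delta need not be assumed continuous: k[[hbar]]-linear maps are.          *)
Record is_Uh_bialgebra (U : algType K)
    (f : 'I_m -> U) (l : 'I_m.+1 -> U) (e : 'I_m -> U)
    (Delta : {linear U -> ctens U U}) (eps : {lrmorphism U -> K^o}) : Prop := {
  Delta1 : Delta 1 = 1 ⊗ 1;
  DeltaM : forall x y, Delta (x * y) = ctens_mul (Delta x) (Delta y);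
  Delta_f : forall i, Delta (f i) = f i ⊗ tqV l i + 1 ⊗ f i;
  Delta_l : forall j, Delta (l j) = l j ⊗ 1 + 1 ⊗ l j;
  Delta_e : forall i, Delta (e i) = e i ⊗ 1 + tq l i ⊗ e i;
  eps_f : forall i, eps (f i) = 0;
  eps_l : forall j, eps (l j) = 0;
  eps_e : forall i, eps (e i) = 0
}.

End QuantumGL.


Section QuantumSO3.
Variables (k : fieldType) (U : algType (hser k)).
Variables (f : 'I_2 -> U) (l : 'I_3 -> U) (e : 'I_2 -> U).

Let i1 : 'I_2 := ord0.
Let i2 : 'I_2 := ord_max.

Definition f1 : U := f i1.
Definition f2 : U := f i2.
Definition e1 : U := e i1.
Definition e2 : U := e i2.
Definition t1V : U := tqV l i1.
Definition t2V : U := tqV l i2.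
Definition E13 : U := qcomm (qp 1) e1 e2.
Definition F31 : U := qcomm (qp (-1)) f2 f1.

Definition K12 : U := qp 2 *: (f1 - qp 1 *: (t1V * e1)).
Definition K23 : U := qp 1 *: (f2 - qp 1 *: (t2V * e2)).
Definition K13 : U :=
  qp 2 *: (F31 - qq *: (f2 * t1V * e1) - t1V * t2V * E13).

Definition Uh_so3 : set U :=
  hclosure (Uh_sl f l e) (gen_subalg [set K12; K13; K23]).

Variables (Delta : U -> ctens U U) (eps : U -> hser k).

Definition so3_Lsh : set U :=
  [set x | Uh_so3 x /\ forall d,
     exists2 y, tpow_img Uh_so3 (Uh_sl f l e) d y &
                delta Delta eps d x = hbar ^+ d.+1 *: y].

Definition k12 : U := (qp (-2) * qq) *: K12.
Definition k23 : U := (qp (-1) * qq) *: K23.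
Definition k13 : U := (qp (-2) * qq) *: K13.

End QuantumSO3.

(* Presentations in the completed sense. The free object on I is the algebra *)
(* k[[hbar]]<<I>> of noncommutative power series, with no decay condition on *)
(* the coefficients, and with the topology of coefficientwise convergence    *)
(* (equivalently, the (hbar, I)-adic one).                                   *)

Section Presentations.
Variables (k : fieldType) (I : finType).
Local Notation K := (hser k).

Definition ncser : Type := seq I -> K.

Definition word (v : seq I) : ncser := fun w => (w == v)%:R.

Definition ncser_mul (a b : ncser) : ncser :=
  fun w => \sum_(i < (size w).+1) a (take i w) * b (drop i w).

Inductive nc_ideal (R : set ncser) : ncser -> Prop :=
| nc_ideal0 : nc_ideal R (fun=> 0)
| nc_idealD a b : nc_ideal R a -> nc_ideal R b ->
    nc_ideal R (fun w => a w + b w)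
| nc_ideal_gen a r b : R r -> nc_ideal R (ncser_mul (ncser_mul a r) b).

Definition nc_closure (S : set ncser) : set ncser :=
  [set c | forall N, exists2 a, S a &
     forall w, (size w < N)%N -> exists z, c w - a w = hbar ^+ N * z].

Variable U : algType K.

(* y = \sum_w c_w x_w, for the hbar-adic topology of S *)
Definition nc_value (S : set U) (x : I -> U) (c : ncser) (y : U) : Prop :=
  hcvg S (fun N => \sum_(n < N) \sum_(w : n.-tuple I)
                     c w *: \prod_(i <- w) x i) y.

(* A is the completed algebra with generators x and relators R: evaluation   *)
(* at x is defined on all of k[[hbar]]<<I>>, its image is A and its kernel   *)
(* is the closed two-sided ideal generated by R.                             *)
Definition presented (S A : set U) (x : I -> U) (R : set ncser) : Prop :=
  [/\ forall i, A (x i),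
      forall c, exists2 y, A y & nc_value S x c y,
      forall y, A y -> exists c, nc_value S x c y &
      forall c, nc_value S x c 0 <-> nc_closure (nc_ideal R) c].

End Presentations.

Section Stokes3.
Variable k : fieldType.
Local Notation K := (hser k).
Local Notation g12 := (@Ordinal 3 0 isT).
Local Notation g23 := (@Ordinal 3 1 isT).
Local Notation g13 := (@Ordinal 3 2 isT).

Definition stokes_gen (U : Type) (x12 x23 x13 : U) (i : 'I_3) : U :=
  nth x12 [:: x12; x23; x13] i.

Definition stokes_relators : set (ncser k 'I_3) :=
  [set (fun w => word k [:: g12; g23] w
          - (qp 1 * word k [:: g23; g12] w - qp 1 * qq * word k [:: g13] w));
       (fun w => word k [:: g23; g13] w
          - (qp 1 * word k [:: g13; g23] w - qq * word k [:: g12] w));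
       (fun w => word k [:: g13; g12] w
          - (qp 1 * word k [:: g12; g13] w - qq * word k [:: g23] w))].

(* y = \sum_(a,b,c) chi_(a,b,c) x12^a x13^b x23^c, for the hbar-adic         *)
(* topology of S *)
Definition monomial_series (U : algType K) (S : set U) (x12 x13 x23 : U)
    (chi : nat -> nat -> nat -> K) (y : U) : Prop :=
  hcvg S (fun N => \sum_(a < N) \sum_(b < N) \sum_(c < N)
                     chi a b c *: (x12 ^+ a * x13 ^+ b * x23 ^+ c)) y.

Definition topological_basis (U : algType K) (S A : set U) (x12 x13 x23 : U) :
    Prop :=
  (forall chi, exists2 y, A y & monomial_series S x12 x13 x23 chi y) /\
  (forall y, A y -> exists! chi, monomial_series S x12 x13 x23 chi y).

End Stokes3.

(* Main.v *)
Require Import Defs.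
From HB Require Import structures.
From mathcomp Require Import all_boot all_order all_algebra.
From mathcomp Require Import boolp classical_sets functions.
From mathcomp Require Import ring zify.

Set Implicit Arguments.
Unset Strict Implicit.
Unset Printing Implicit Defensive.

Import GRing.Theory.
Local Open Scope ring_scope.
Local Open Scope classical_set_scope.

(** Write kap_ij for the generators of U_hbar(so_3) up to powers of q, so that
    k_ij = (q - q^-1) kap_ij, and q - q^-1 is hbar times a unit. The theorem
    says that the divided algebra consists exactly of the convergent series in
    the ordered monomials k_12^a k_13^b k_23^c, the coefficients being unique and
    arbitrary; everything else follows from this description.

    The k_ij lie in the divided algebra. Up to a scalar kap_13 is the
    q-commutator of kap_23 and kap_12, and the other two relations are the
    inhomogeneous Serre relation [kap_serre] of a quantum symmetric pair. The
    coproducts of the k_ij only involve, in the left leg, 1 and the k_ij, and, in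
    the right leg, elements y such that y - eps(y) is divisible by hbar. Applying
    id - eps to each leg of the d-fold coproduct of a polynomial in the k_ij
    hence produces hbar^d ([stokes_alg_Lsh]). A series in the ordered monomials
    is such a polynomial modulo hbar^d times an element of U_hbar(so_3), so that
    it lies in the divided algebra as well ([series_Lsh]).

    Conversely, no PBW theorem for U_hbar(gl_3) is needed: the three-dimensional
    representation provides enough linear forms. Its three matrix coefficients
    below the diagonal vanish at 1 and are dual to the kap_ij modulo hbar. Let
    Psi_a be their convolution product along an ordered word with exponents
    a = (a_1, a_2, a_3), |a| = n letters in all. If x lies in the divided algebra
    then hbar^n divides Psi_a(x), because the factors vanish at 1
    ([Lsh_conv_word]). Applied to monomials in the k_ij, this shows that Psi_a
    takes a monomial in m < n letters kap_ij to a multiple of hbar^(n - m)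
    ([conv_word_short]). For m = n, as the kap_ij are primitive modulo hbar,
    Psi_a takes the ordered monomial kap^b modulo hbar to a product of
    factorials, nonzero in characteristic 0, if a = b, and to 0 otherwise
    ([conv_word_leading]). By triangularity the divisibility of the Psi_a(x) bounds the coefficients of
    x = \sum_b c_b kap^b: hbar^|b| divides c_b, so that x is a series in the k^b
    ([coefficient_bound], [Lsh_series]). The same bound gives the uniqueness of
    coefficients ([series_uniq]).

    For the presentation, words in free letters are straightened modulo the
    relators at the cost of one factor q - q^-1 per lost letter
    ([word_straightening]). Hence the words of a noncommutative power series
    contribute to the coefficient of a given ordered monomial at increasing
    orders in hbar: all series can be evaluated, and the uniqueness of
    coefficients identifies the kernel with the closure of the ideal
    ([stokes_presented]). *)

(** * Divisibility by powers of hbar, units and exponentials *)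

Section PowerSeries.
Variable k : fieldType.
Local Notation K := (hser k).
Implicit Types a b u : K.

Lemma hcoef_sum (I : Type) (r : seq I) (P : pred I) (F : I -> K) n :
  (\sum_(i <- r | P i) F i) n = \sum_(i <- r | P i) F i n.
Proof. by elim/big_rec2: _ => // i x y _ <-. Qed.

Lemma hcoef0M a b : (a * b) 0%N = a 0%N * b 0%N.
Proof. by rewrite coef_hM big_ord1. Qed.

Lemma hcoef0X a n : (a ^+ n) 0%N = a 0%N ^+ n.
Proof. by elim: n => // n IH; rewrite !exprS hcoef0M IH. Qed.

Lemma coef_hCM (x : k) a n : (hC x * a) n = x * a n.
Proof.
rewrite coef_hM big_ord_recl /= subn0 big1 ?addr0 // => i _.
by rewrite mul0r.
Qed.

Lemma hC1 : hC 1 = 1 :> K.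
Proof. by apply/funext => -[]. Qed.

Lemma hC0 : hC 0 = 0 :> K.
Proof. by apply/funext => -[]. Qed.

Lemma hCD (x y : k) : hC (x + y) = hC x + hC y :> K.
Proof. by apply/funext => -[|i] //; apply/esym/addr0. Qed.

Lemma hCM (x y : k) : hC (x * y) = hC x * hC y :> K.
Proof. by apply/funext => -[|i]; rewrite coef_hCM // mulr0. Qed.

Lemma hCnat n : hC n%:R = n%:R :> K.
Proof. by elim: n => [|n IH]; rewrite ?hC0 // !mulrS hCD IH hC1. Qed.

Lemma hCint (z : int) : hC z%:~R = z%:~R :> K.
Proof.
case: z => n; first exact: hCnat.
rewrite NegzE !mulrNz -[n.+1%:~R]/(n.+1%:R) -[(n.+1%:~R : K)]/(n.+1%:R).
by apply/eqP; rewrite -addr_eq0 -hCnat -hCD addNr hC0.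
Qed.

Lemma coef_hbarM a n : (hbar * a) n = if n is n'.+1 then a n' else 0.
Proof.
rewrite coef_hM; case: n => [|n]; first by rewrite big_ord1 mul0r.
rewrite 2!big_ord_recl /= mul0r add0r mul1r subSS subn0.
by rewrite big1 ?addr0 // => i _; rewrite mul0r.
Qed.

Lemma coef_hbarXM N a n :
  (hbar ^+ N * a) n = if (n < N)%N then 0 else a (n - N)%N.
Proof.
elim: N n => [|N IH] n; first by rewrite expr0 mul1r subn0.
by rewrite exprS -mulrA coef_hbarM; case: n => // n; rewrite IH.
Qed.

(** Divisibility by hbar^N, read off on coefficients so that it is stable
    under finite sums without choosing quotients. *)
Definition hdvd N a : Prop := forall i, (i < N)%N -> a i = 0.

Lemma hdvdP N a : hdvd N a <-> exists z, a = hbar ^+ N * z.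
Proof.
split=> [aN|[z ->] i iN]; last by rewrite coef_hbarXM iN.
exists (fun n => a (n + N)%N); apply/funext => n; rewrite coef_hbarXM.
by case: ltnP => [/aN//|Nn]; rewrite subnK.
Qed.

Lemma hdvdD N a b : hdvd N a -> hdvd N b -> hdvd N (a + b).
Proof.
by move=> aN bN i iN; rewrite -[LHS]/(a i + b i) aN ?bN ?addr0.
Qed.

Lemma hdvdN N a : hdvd N a -> hdvd N (- a).
Proof. by move=> aN i iN; rewrite -[LHS]/(- a i) aN ?oppr0. Qed.

Lemma hdvdB N a b : hdvd N a -> hdvd N b -> hdvd N (a - b).
Proof. by move=> aN bN; apply/hdvdD/hdvdN. Qed.

Lemma hdvd_sum (I : eqType) (r : seq I) (P : pred I) (F : I -> K) N :
  (forall i, i \in r -> P i -> hdvd N (F i)) ->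
  hdvd N (\sum_(i <- r | P i) F i).
Proof.
move=> FN; rewrite big_seq_cond; elim/big_ind: _ => [//|a b|i /andP[]].
  exact: hdvdD.
exact: FN.
Qed.

Lemma hdvd_le M N a : (M <= N)%N -> hdvd N a -> hdvd M a.
Proof. by move=> MN aN i iM; apply/aN/leq_trans/MN. Qed.

Lemma hdvdM M N a b : hdvd M a -> hdvd N b -> hdvd (M + N) (a * b).
Proof.
move=> /hdvdP[y ->] /hdvdP[z ->]; apply/hdvdP; exists (y * z).
by rewrite exprD; ring.
Qed.

Lemma hdvdMl N a b : hdvd N b -> hdvd N (a * b).
Proof. by apply: (@hdvdM 0). Qed.

Lemma hdvdMr N a b : hdvd N a -> hdvd N (a * b).
Proof. by rewrite mulrC; apply: hdvdMl. Qed.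

Lemma hdvd_hbarX N a : hdvd N (hbar ^+ N * a).
Proof. by apply/hdvdP; exists a. Qed.

Lemma hdvd_cancel M N a : hdvd (M + N) (hbar ^+ M * a) -> hdvd N a.
Proof.
move=> aMN i iN; have := aMN (M + i)%N.
by rewrite ltn_add2l coef_hbarXM [(_ < M)%N]ltnNge leq_addr addKn; apply.
Qed.

Lemma hdvd_eq0 a : (forall N, hdvd N a) -> a = 0.
Proof. by move=> aN; apply/funext => n; apply: (aN n.+1). Qed.

Lemma hbarX_inj N a b : hbar ^+ N * a = hbar ^+ N * b -> a = b.
Proof.
move=> ab; apply/funext => n.
have /(congr1 (fun c : K => c (n + N)%N)) := ab.
by rewrite !coef_hbarXM ltnNge leq_addl /= addnK.
Qed.

Lemma hdvd1 a : hdvd 1 a <-> a 0%N = 0.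
Proof. by split=> [|a0 [|//] _]; first exact. Qed.

(** Uniformly Cauchy families of power series converge uniformly. *)
Lemma hser_family_limit (I : Type) (s : nat -> I -> K) :
  (forall N, exists m, forall i j, (m <= i)%N -> (m <= j)%N ->
     forall x, hdvd N (s i x - s j x)) ->
  exists y : I -> K, forall N, exists m, forall i, (m <= i)%N ->
     forall x, hdvd N (s i x - y x).
Proof.
move=> /choice[r Hr]; exists (fun x n => s (r n.+1) x n) => N.
exists (r N) => i Ni x j jN; rewrite -[LHS]/(s i x j - s (r j.+1) x j).
pose M := maxn i (r j.+1).
have := Hr N i M Ni (leq_trans Ni (leq_maxl _ _)) x j jN.
have := Hr j.+1 M (r j.+1) (leq_maxr _ _) (leqnn _) x j (ltnSn j).
rewrite -[LHS]/(s M x j - s (r j.+1) x j) => E1.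
rewrite -[LHS]/(s i x j - s M x j) => E2.
by rewrite -[s i x j](subrK (s M x j)) E2 add0r.
Qed.

(** Multiplying by a series with nonzero constant coefficient does not raise
    the order at hbar = 0: compare the lowest coefficients. *)
Lemma hdvd_unit N u a : u 0%N != 0 -> hdvd N (u * a) -> hdvd N a.
Proof.
move=> u0 uaN i; elim/ltn_ind: i => i IH iN.
have := uaN i iN; rewrite coef_hM big_ord_recl subn0 big1 ?addr0 => [|j _].
  by move/eqP; rewrite mulf_eq0 (negPf u0) => /eqP.
by rewrite /= /bump leq0n IH ?mulr0 //; have := ltn_ord j; lia.
Qed.

Lemma hser_unit u : u 0%N != 0 -> exists b, b * u = 1.
Proof.
move=> u0; suff [b bu]: exists b : K, forall n,
    (b n) * u 0%N + \sum_(i < n) b i * u (n - i)%N = (n == 0%N)%:R.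
  exists b; apply/funext => n; rewrite coef_hM big_ord_recr /= subnn addrC.
  exact: bu.
(* [pre n] lists the first n coefficients of the inverse, each being determined
   by the preceding ones *)
pose step n (s : seq k) :=
  ((n == 0%N)%:R - \sum_(i < n) s`_i * u (n - i)%N) / u 0%N.
pose pre := fix pre n := if n is n'.+1 then rcons (pre n') (step n' (pre n'))
                         else [::].
have szp n : size (pre n) = n by elim: n => //= n IH; rewrite size_rcons IH.
have nthp i n : (i < n)%N -> (pre n)`_i = step i (pre i).
  elim: n => // n IH; rewrite ltnS leq_eqVlt => /predU1P[->|lt_in] /=.
    by rewrite nth_rcons szp ltnn eqxx.
  by rewrite nth_rcons szp lt_in IH.
exists (fun n => step n (pre n)) => n.
rewrite (eq_bigr (fun i : 'I_n => (pre n)`_i * u (n - i)%N)) => [|i _].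
  by rewrite /step divfK ?subrK.
by rewrite nthp.
Qed.

Section CharacteristicZero.
Hypothesis k_char0 : [pchar k] =i pred0.

Lemma natk_neq0 n : (0 < n)%N -> n%:R != 0 :> k.
Proof. by rewrite lt0n (proj1 (pcharf0P k)). Qed.

Lemma factk_neq0 n : n`!%:R != 0 :> k.
Proof. by rewrite natk_neq0 ?fact_gt0. Qed.

Lemma binfE n i : (i <= n)%N ->
  'C(n, i)%:R / n`!%:R = i`!%:R^-1 / (n - i)`!%:R :> k.
Proof.
move=> le_in; rewrite -(bin_fact le_in) !natrM.
have := factk_neq0 i; have := factk_neq0 (n - i).
have : 'C(n, i)%:R != 0 :> k by rewrite natk_neq0 ?bin_gt0.
by move: ('C(n, i)%:R : k) (i`!%:R : k) ((n - i)`!%:R : k) => x y z *;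
  field; apply/and3P.
Qed.

Lemma coef0_qp m : (qp m : K) 0%N = 1.
Proof. by rewrite /qp expr0 fact0 divr1. Qed.

Lemma qp0 : qp 0 = 1 :> K.
Proof.
apply/funext => -[|n]; first by rewrite coef0_qp.
by rewrite /qp mulr0z expr0n mul0r.
Qed.

Lemma qpD m n : qp m * qp n = qp (m + n) :> K.
Proof.
apply/funext => j; rewrite coef_hM /qp rmorphD /= exprDn mulr_suml.
rewrite [RHS](reindex_inj rev_ord_inj) /=.
apply: eq_bigr => i _; have le_ij : (i <= j)%N by rewrite -ltnS.
rewrite /= subSS subKn // bin_sub // -[_ *+ 'C(_, _)]mulr_natl [RHS]mulrAC binfE //.
by rewrite mulrACA mulrC.
Qed.

Lemma qpVr m : qp m * qp (- m) = 1 :> K.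
Proof. by rewrite qpD subrr qp0. Qed.

Lemma sinhc0 : (sinhc : K) 0%N = 1.
Proof. by rewrite /sinhc /= invr1. Qed.

(** The power series (q^m - 1) / hbar. *)
Definition qp1 (m : int) : K := fun n => m%:~R ^+ n.+1 / n.+1`!%:R.

Lemma qp1E m : qp m = 1 + hbar * qp1 m.
Proof.
apply/funext => n; rewrite -[RHS]/((1 : K) n + (hbar * qp1 m) n) coef_hbarM.
by case: n => [|n]; rewrite /qp ?add0r // expr0 fact0 divr1 addr0.
Qed.

Lemma qp1_sinhc : qp1 1 - qp1 (-1) = hC 2%:R * sinhc.
Proof.
apply: (@hbarX_inj 1); rewrite expr1 mulrCA mulrA -qqE /qq !qp1E; ring.
Qed.

(** The unit (q - q^-1) / hbar. *)
Definition qqu : K := hC 2%:R * sinhc.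

Lemma qq_hbar : qq = hbar * qqu.
Proof. by rewrite qqE /qqu; ring. Qed.

Lemma qqu0 : qqu 0%N != 0.
Proof. by rewrite /qqu hcoef0M sinhc0 mulr1 natk_neq0. Qed.

Lemma qqu_invertible : exists v, v * qqu = 1.
Proof. exact/hser_unit/qqu0. Qed.

End CharacteristicZero.
End PowerSeries.

(** * Convergent sums in hbar-adic modules *)

Section LinearFunctions.
Variables (R : pzRingType) (V W : lmodType R) (f : V -> W).
Hypothesis Lf : linear f.

Lemma lin0 : f 0 = 0.
Proof. by have := Lf (-1) 0 0; rewrite scaler0 addr0 scaleN1r addNr. Qed.

Lemma linD x y : f (x + y) = f x + f y.
Proof. by have := Lf 1 x y; rewrite !scale1r. Qed.

Lemma linZ a x : f (a *: x) = a *: f x.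
Proof. by have := Lf a x 0; rewrite lin0 !addr0. Qed.

Lemma linB x y : f (x - y) = f x - f y.
Proof. by rewrite linD -scaleN1r linZ scaleN1r. Qed.

Lemma lin_sum (I : Type) (r : seq I) P F :
  f (\sum_(i <- r | P i) F i) = \sum_(i <- r | P i) f (F i).
Proof. by elim/big_rec2: _ => [|i u v _ <-]; rewrite ?lin0 ?linD. Qed.

End LinearFunctions.

Section Congruence.
Variable k : fieldType.
Local Notation K := (hser k).

Definition submod (V : lmodType K) (S : set V) : Prop :=
  [/\ S 0, forall x y, S x -> S y -> S (x + y) & forall a x, S x -> S (a *: x)].

Lemma submodT (V : lmodType K) : submod [set: V]. Proof. by []. Qed.

Section Module.
Variables (V : lmodType K) (S : set V).
Hypothesis S_sub : submod S.
Implicit Types (x y z : V) (s : nat -> V) (M N : nat).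

Lemma submodN x : S x -> S (- x).
Proof. by case: S_sub => _ _ SZ Sx; rewrite -scaleN1r; apply: SZ. Qed.

Lemma submodB x y : S x -> S y -> S (x - y).
Proof. by case: (S_sub) => _ SD _ Sx /submodN; apply: SD. Qed.

Lemma submod_sum (I : eqType) (r : seq I) (P : pred I) (F : I -> V) :
  (forall i, i \in r -> P i -> S (F i)) -> S (\sum_(i <- r | P i) F i).
Proof.
case: S_sub => S0 SD _ SF; rewrite big_seq_cond.
by elim/big_ind: _ => // i /andP[]; apply: SF.
Qed.

Lemma hcong_refl N x : hcong S N x x.
Proof.
by case: S_sub => S0 _ _; exists 0; rewrite ?subrr ?scaler0.
Qed.

Lemma hcong_sym N x y : hcong S N x y -> hcong S N y x.
Proof.
by case=> z Sz E; exists (- z); [apply: submodN | rewrite scalerN -E opprB].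
Qed.

Lemma hcong_trans N y x z : hcong S N x y -> hcong S N y z -> hcong S N x z.
Proof.
case: S_sub => _ SD _ [u Su Eu] [v Sv Ev]; exists (u + v); first exact: SD.
by rewrite scalerDr -Eu -Ev addrA subrK.
Qed.

Lemma hcongD N x x' y y' :
  hcong S N x y -> hcong S N x' y' -> hcong S N (x + x') (y + y').
Proof.
case: S_sub => _ SD _ [u Su Eu] [v Sv Ev]; exists (u + v); first exact: SD.
by rewrite scalerDr -Eu -Ev opprD addrACA.
Qed.

Lemma hcongZ N a x y : hcong S N x y -> hcong S N (a *: x) (a *: y).
Proof.
case: S_sub => _ _ SZ [u Su Eu]; exists (a *: u); first exact: SZ.
by rewrite scalerA mulrC -scalerA -Eu scalerBr.
Qed.

Lemma hcongB N x x' y y' :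
  hcong S N x y -> hcong S N x' y' -> hcong S N (x - x') (y - y').
Proof.
by move=> E E'; apply: hcongD => //; rewrite -!scaleN1r; apply: hcongZ.
Qed.

Lemma hcong_sum (I : eqType) (r : seq I) (P : pred I) (F G : I -> V) N :
  (forall i, i \in r -> P i -> hcong S N (F i) (G i)) ->
  hcong S N (\sum_(i <- r | P i) F i) (\sum_(i <- r | P i) G i).
Proof.
move=> FG; rewrite [X in hcong _ _ X]big_seq_cond [X in hcong _ _ _ X]big_seq_cond.
elim/big_ind2: _ => [|x x' y y'|i /andP[]]; [exact: hcong_refl| |exact: FG].
exact: hcongD.
Qed.

Lemma hcong_le M N x y : (M <= N)%N -> hcong S N x y -> hcong S M x y.
Proof.
case: S_sub => _ _ SZ MN [z Sz E]; exists (hbar ^+ (N - M) *: z).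
  exact: SZ.
by rewrite scalerA -exprD subnKC.
Qed.

Lemma hcong_hdvd N a z : hdvd N a -> S z -> hcong S N (a *: z) 0.
Proof.
case: S_sub => _ _ SZ /hdvdP[b ->] Sz; exists (b *: z); first exact: SZ.
by rewrite subr0 scalerA.
Qed.

Lemma hcong_hbar N z : S z -> hcong S N (hbar ^+ N *: z) 0.
Proof. by exists z; rewrite ?subr0. Qed.

(** The series \sum_i hbar^i s_i converges to y in the hbar-adic topology of S.
    In this form, convergence is inherited by linear maps and determines y as
    soon as the module is separated, which is how exponentials are computed. *)
Definition hsums s y : Prop :=
  forall N, hcong S N y (\sum_(i < N) hbar ^+ i *: s i).

Lemma hsums_eq s s' y : s =1 s' -> hsums s y -> hsums s' y.
Proof.
move=> ss' H N; rewrite (eq_bigr (fun i : 'I_N => hbar ^+ i *: s i)) // => i _.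
by rewrite ss'.
Qed.

Lemma hsumsD s s' y y' :
  hsums s y -> hsums s' y' -> hsums (fun n => s n + s' n) (y + y').
Proof.
move=> H H' N; rewrite (eq_bigr _ (fun i _ => scalerDr _ _ _)) big_split.
exact: hcongD.
Qed.

Lemma hsumsZ a s y : hsums s y -> hsums (fun n => a *: s n) (a *: y).
Proof.
move=> H N; have := hcongZ a (H N); rewrite scaler_sumr.
rewrite (eq_bigr (fun i : 'I_N => hbar ^+ i *: (a *: s i))) // => i _.
by rewrite !scalerA mulrC.
Qed.

Lemma hsums_hbar s y : hsums s y ->
  hsums (fun n => if n is n'.+1 then s n' else 0) (hbar *: y).
Proof.
move=> H [|N]; first by rewrite big_ord0; case: S_sub (H 0%N) => _ _ SZ [z Sz];
  rewrite big_ord0 subr0 scale1r => ->; exists (hbar *: z);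
  [apply: SZ | rewrite subr0 scale1r].
rewrite big_ord_recl /= scaler0 add0r.
rewrite (eq_bigr (fun i : 'I_N => hbar *: (hbar ^+ i *: s i))) => [|i _]; last first.
  by rewrite scalerA -exprS.
rewrite -scaler_sumr; have [z Sz E] := H N; exists z => //.
by rewrite -scalerBr E scalerA -exprS.
Qed.

Lemma partial_sum_cong s N M : (forall i, S (s i)) -> (N <= M)%N ->
  hcong S N (\sum_(i < M) hbar ^+ i *: s i) (\sum_(i < N) hbar ^+ i *: s i).
Proof.
move=> Ss /subnKC <-; elim: (M - N)%N => [|d IH].
  by rewrite addn0; apply: hcong_refl.
rewrite addnS big_ord_recr /= -[X in hcong _ _ _ X]addr0; apply: hcongD => //.
by apply: hcong_hdvd => //; apply/(hdvd_le (leq_addr d N))/hdvdP; exists 1; rewrite mulr1.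
Qed.

End Module.

Definition hseparated (V : lmodType K) : Prop :=
  forall x : V, (forall N, hcong setT N x 0) -> x = 0.

Lemma hseparated_eq (V : lmodType K) (x y : V) : hseparated V ->
  (forall N, hcong setT N x y) -> x = y.
Proof.
move=> sep xy; apply/eqP; rewrite -subr_eq0; apply/eqP/sep => N.
by rewrite -(subrr y); apply: hcongB => //; apply: hcong_refl.
Qed.

Lemma hsums_uniq (V : lmodType K) (s : nat -> V) y y' : hseparated V ->
  hsums setT s y -> hsums setT s y' -> y = y'.
Proof.
move=> sep H H'; apply: hseparated_eq => // N.
by apply: hcong_trans (H N) _ => //; apply: hcong_sym.
Qed.

Lemma hcong_setT (V : lmodType K) (S : set V) N x y :
  hcong S N x y -> hcong setT N x y.
Proof. by case=> z _; exists z. Qed.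

Lemma hcong_linear (V W : lmodType K) (f : V -> W) N x y : linear f ->
  hcong setT N x y -> hcong setT N (f x) (f y).
Proof.
move=> Lf [z _ E]; exists (f z) => //.
by rewrite -(linB Lf) E (linZ Lf).
Qed.

Lemma hsums_linear (V W : lmodType K) (f : V -> W) s y : linear f ->
  hsums setT s y -> hsums setT (f \o s) (f y).
Proof.
move=> Lf H N; have := hcong_linear Lf (H N); rewrite (lin_sum Lf).
by under eq_bigr do rewrite (linZ Lf).
Qed.

Lemma hsums_scalar (V : lmodType K) (c : nat -> k) (v : V) :
  hsums setT (fun n => hC (c n) *: v) ((c : K) *: v).
Proof.
move=> N; rewrite (eq_bigr _ (fun i _ => scalerA _ _ _)) -scaler_suml.
exists (((fun n => c (n + N)%N) : K) *: v) => //.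
rewrite -scalerBl scalerA; congr (_ *: _); apply/funext => n.
rewrite -[LHS]/(c n - (\sum_(i < N) hbar ^+ i * hC (c i)) n) hcoef_sum.
rewrite (eq_bigr (fun i : 'I_N => if i == n :> nat then c i else 0)); last first.
  move=> i _; rewrite coef_hbarXM /hC; case: ltngtP => // [|->]; last by rewrite subnn eqxx.
  by rewrite -subn_gt0; case: subn.
rewrite coef_hbarXM -big_mkcond; case: ltnP => [nN|Nn].
  by rewrite (big_pred1 (Ordinal nN)) ?subrr // => i; rewrite /= -val_eqE.
rewrite big1 ?subr0 ?subnK // => i /eqP E.
by move: Nn; rewrite -E leqNgt ltn_ord.
Qed.

Section Bilinear.
Variables (V W X : lmodType K) (B : V -> W -> X).
Hypothesis B_bil : bilinear_map B.

Let L y := bilinear_l B_bil y.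
Let R x := bilinear_r B_bil x.

(** Truncated Cauchy product, by splitting off the first term of the first
    series. *)
Lemma partial_Cauchy (a : nat -> V) (b : nat -> W) N :
  hcong setT N
    (B (\sum_(i < N) hbar ^+ i *: a i) (\sum_(j < N) hbar ^+ j *: b j))
    (\sum_(n < N) hbar ^+ n *: \sum_(i < n.+1) B (a i) (b (n - i)%N)).
Proof.
elim: N a => [|N IH] a; first by exists (B 0 0); rewrite ?big_ord0 ?subr0 ?scale1r.
rewrite big_ord_recl /= expr0 scale1r (linD (L _)).
under [X in hcong _ _ _ X]eq_bigr do rewrite big_ord_recl subn0 scalerDr.
rewrite big_split /=; apply: hcongD => //.
  rewrite (lin_sum (R _)); under [X in hcong _ _ X]eq_bigr do rewrite (linZ (R _)).
  exact: hcong_refl.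
rewrite [X in hcong _ _ _ X]big_ord_recl [X in _ *: X]big_ord0 scaler0 add0r.
under [X in B X]eq_bigr do rewrite /= /bump leq0n exprS -scalerA.
rewrite -scaler_sumr bilinear_lZ // big_ord_recr /= (linD (R _)) scalerDr.
under [X in hcong _ _ _ X]eq_bigr do rewrite /= /bump leq0n exprS -scalerA.
rewrite -scaler_sumr -[X in hcong _ _ _ X]addr0; apply: hcongD => //; last first.
  by rewrite (linZ (R _)) scalerA -exprS; apply: hcong_hbar.
have [z _ E] := IH (fun i => a i.+1); exists z => //.
by rewrite exprS -scalerA -E scalerBr.
Qed.

Lemma hsums_Cauchy a b x y : hsums setT a x -> hsums setT b y ->
  hsums setT (fun n => \sum_(i < n.+1) B (a i) (b (n - i)%N)) (B x y).
Proof.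
move=> ax b_y N.
apply: hcong_trans (hcong_linear (L y) (ax N)) _ => //.
apply: hcong_trans (hcong_linear (R _) (b_y N)) _ => //.
exact: partial_Cauchy.
Qed.

End Bilinear.

End Congruence.

Section Complete.
Variables (k : fieldType) (V : lmodType (hser k)).
Hypothesis V_complete : hcomplete [set: V].

Lemma complete_separated : hseparated V.
Proof. by move=> x; case: V_complete => sep _; apply: sep. Qed.

Lemma hsums_exists (s : nat -> V) : exists y, hsums setT s y.
Proof.
have [_ /(_ (fun N => \sum_(i < N) hbar ^+ i *: s i))[//||y _ sy]] := V_complete.
  move=> N; exists N => i j Ni Nj.
  apply: (@hcong_trans _ _ setT _ _ (\sum_(i < N) hbar ^+ i *: s i)) => //.
    exact: partial_sum_cong.
  by apply: hcong_sym => //; apply: partial_sum_cong.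
exists y => N; have [m /(_ (maxn m N) (leq_maxl _ _))] := sy N.
move/(hcong_sym (@submodT _ V))/hcong_trans; apply => //.
by apply: partial_sum_cong => //; apply: leq_maxr.
Qed.

Lemma hsums_tail (s : nat -> V) y M : hsums setT s y ->
  exists2 y', hsums setT (fun i => s (M + i)%N) y' &
              y = \sum_(i < M) hbar ^+ i *: s i + hbar ^+ M *: y'.
Proof.
move=> sy; have [y' sy'] := hsums_exists (fun i => s (M + i)%N).
exists y' => //; apply: hsums_uniq complete_separated sy _ => N.
apply: (@hcong_trans _ _ setT _ _ (\sum_(i < M + N) hbar ^+ i *: s i)) => //.
  rewrite big_split_ord /=; apply: hcongD => //; first exact: hcong_refl.
  under eq_bigr do rewrite exprD -scalerA.
  by rewrite -scaler_sumr; apply: hcongZ.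
by apply: partial_sum_cong => //; apply: leq_addl.
Qed.

Lemma hlimE (s : nat -> V) y : hcvg setT s y -> hlim s = y.
Proof.
rewrite /hlim => s_y; case: xgetP => [z _ s_z|/(_ y)//].
apply: (hseparated_eq complete_separated) => N.
have [m /(_ _ (leq_maxl m _)) zm] := s_z N.
have [n /(_ _ (leq_maxr _ n)) yn] := s_y N.
exact: hcong_trans (hcong_sym _ (zm n)) (yn m).
Qed.

(** A closed submodule contains the sums of its sequences, and the remainders
    too, so that its own topology makes them converge. *)
Lemma hsums_closed (S : set V) s y : submod S ->
  (forall x, (forall N, exists2 z, S z & hcong setT N x z) -> S x) ->
  (forall i, S (s i)) -> hsums setT s y -> S y /\ hsums S s y.
Proof.
move=> S_sub S_cl Ss sy.
have limS s' y' : (forall i, S (s' i)) -> hsums setT s' y' -> S y'.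
  move=> Ss' sy'; apply: S_cl => N; exists (\sum_(i < N) hbar ^+ i *: s' i) => //.
  by apply: submod_sum => // i _ _; case: S_sub => _ _; apply.
split=> [|N]; first exact: limS sy.
have [y' sy' ->] := hsums_tail N sy; exists y'; last by rewrite addrAC subrr add0r.
by apply: limS sy' => i; apply: Ss.
Qed.

End Complete.

(** * Exponentials in complete algebras *)

Section Exponential.
Variables (k : fieldType) (k_char0 : [pchar k] =i pred0).
Variables (A : algType (hser k)).
Hypothesis A_complete : hcomplete [set: A].
Implicit Types (x y z : A).
Local Notation K := (hser k).

Let A_sep := complete_separated A_complete.

Lemma mul_bilinear : bilinear_map (fun x y : A => x * y).
Proof.
by split=> [y|x] a u v; [rewrite mulrDl -scalerAl | rewrite mulrDr -scalerAr].
Qed.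

Lemma mull_linear x : linear (fun y : A => x * y).
Proof. by case: mul_bilinear => _; apply. Qed.

Lemma mulr_linear y : linear (fun x : A => x * y).
Proof. by case: mul_bilinear => + _; apply. Qed.

Lemma qexp_sums x : hsums setT (fun n => hC (n`!%:R^-1) *: x ^+ n) (qexp x).
Proof.
have [y xy] := hsums_exists A_complete (fun n => hC (n`!%:R^-1) *: x ^+ n).
suff -> : qexp x = y by []; apply: hlimE => // N; exists N => i Ni.
under eq_bigr do rewrite mulrC -scalerA.
apply: hcong_sym => //; exact: hcong_le (xy i).
Qed.

Definition sinhc_term x n : A :=
  if odd n then 0 else hC (n.+1`!%:R^-1) *: x ^+ n.+1.

Lemma qsinhc_sums x : hsums setT (sinhc_term x) (qsinhc x).
Proof.
have [y xy] := hsums_exists A_complete (sinhc_term x).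
suff -> : qsinhc x = y by []; apply: hlimE => // N; exists N => i Ni.
suff -> : \sum_(m < i) (hC (m.*2.+1`!%:R^-1) * hbar ^+ m.*2) *: x ^+ m.*2.+1
    = \sum_(n < i.*2) hbar ^+ n *: sinhc_term x n.
  apply: hcong_sym => //; apply: hcong_le (xy _) => //; lia.
elim: i {Ni} => [|i IH]; first by rewrite !big_ord0.
rewrite doubleS !big_ord_recr /= -IH /sinhc_term /= odd_double /= scaler0 addr0.
by rewrite scalerA mulrC.
Qed.

(** [qexp1 x] is (exp(hbar x) - 1) / hbar. Working with it instead of the
    exponential avoids divisions by hbar, which could lose information if the
    algebra had hbar-torsion. *)
Definition qexp1 x : A :=
  xget 0 [set y | hsums setT (fun n => hC (n.+1`!%:R^-1) *: x ^+ n.+1) y].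

Lemma qexp1_sums x :
  hsums setT (fun n => hC (n.+1`!%:R^-1) *: x ^+ n.+1) (qexp1 x).
Proof.
rewrite /qexp1; case: xgetP => [y _ //|no].
have [y /no []] := hsums_exists A_complete
  (fun n => hC (n.+1`!%:R^-1) *: x ^+ n.+1).
Qed.

Lemma qexpE x : qexp x = 1 + hbar *: qexp1 x.
Proof.
have := hsumsD (@submodT _ A) (hsums_scalar (1 : K) (1 : A))
  (hsums_hbar (@submodT _ A) (qexp1_sums x)).
rewrite scale1r => H; apply: hsums_uniq A_sep (qexp_sums x) _.
apply: hsums_eq H => -[|n]; first by rewrite fact0 expr0 invr1 addr0.
by rewrite [(1 : K) _]/= hC0 scale0r add0r.
Qed.

(** This is e^(x+y) - 1 = (e^x - 1) + e^x (e^y - 1), divided by hbar. *)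
Lemma qexp1D x y : GRing.comm x y ->
  qexp1 (x + y) = qexp1 x + qexp x * qexp1 y.
Proof.
move=> cxy; apply: hsums_uniq A_sep (qexp1_sums (x + y)) _.
have := hsumsD (@submodT _ A) (qexp1_sums x)
  (hsums_Cauchy mul_bilinear (qexp_sums x) (qexp1_sums y)).
apply: hsums_eq => n.
rewrite (exprDn_comm _ cxy) scaler_sumr [RHS]big_ord_recl.
rewrite subn0 expr0 bin0 mulr1 mulr1n; congr (_ + _).
rewrite (reindex_inj rev_ord_inj) /=; apply: eq_bigr => i _.
have le_in : (i <= n)%N by rewrite -ltnS.
rewrite subSS subKn // /bump leq0n add1n.
rewrite -scalerAl -scalerAr scalerA -hCM -scaler_nat scalerA.
by rewrite -hCnat -hCM [in RHS]mulrC binfE // subSS mulrC.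
Qed.

Lemma qexpD x y : GRing.comm x y -> qexp (x + y) = qexp x * qexp y.
Proof.
move=> cxy; rewrite qexpE qexp1D // [qexp y]qexpE mulrDr mulr1 scalerDr.
by rewrite addrA -qexpE -scalerAr.
Qed.

Lemma qexp0 : qexp 0 = 1 :> A.
Proof.
apply: hsums_uniq A_sep (qexp_sums 0) _.
have := hsums_scalar (1 : K) (1 : A); rewrite scale1r.
apply: hsums_eq => n; rewrite expr0n.
case: n => [|n]; first by rewrite fact0 invr1 /= hC1.
by rewrite scaler0 -[(1 : K) _]/0 hC0 scale0r.
Qed.

Lemma qexpN x : qexp x * qexp (- x) = 1.
Proof. by rewrite -qexpD ?subrr ?qexp0 //; apply: commrN. Qed.

Lemma qsinhcE x : hC 2%:R *: qsinhc x = qexp1 x - qexp1 (- x).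
Proof.
have := hsumsD (@submodT _ A) (qexp1_sums x)
  (hsumsZ (@submodT _ A) (-1) (qexp1_sums (- x))).
rewrite scaleN1r => H.
apply: hsums_uniq A_sep (hsumsZ (@submodT _ A) _ (qsinhc_sums x)) _.
apply: hsums_eq H => n; rewrite /sinhc_term exprNn -signr_odd /=.
case: (odd n) => /=; first by rewrite expr0 mul1r scaler0 scaleN1r subrr.
by rewrite expr1 mulN1r scalerN scaleN1r opprK hCD hC1 scalerDl scale1r.
Qed.

Lemma qexpB x : qexp x - qexp (- x) = (hC 2%:R * hbar) *: qsinhc x.
Proof.
rewrite !qexpE opprD addrACA subrr add0r -scalerBr -qsinhcE scalerA.
by rewrite mulrC.
Qed.

Lemma qexp1_int (m : int) : qexp1 m%:~R = qp1 k m *: 1.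
Proof.
apply: hsums_uniq A_sep (qexp1_sums _) _.
apply: hsums_eq (hsums_scalar (qp1 k m) (1 : A)) => n.
rewrite /qp1 -!rmorphXn /= mulrC hCM -scalerA; congr (_ *: _).
by rewrite hCint scaler_int.
Qed.

Lemma qexp_int_shift x (m : int) : qexp (x + m%:~R) = qp m *: qexp x.
Proof.
rewrite qexpD; last exact: commr_int.
by rewrite [qexp _%:~R]qexpE qexp1_int scalerA qp1E scalerDl scale1r mulrDr mulr1
  -scalerAr mulr1.
Qed.

Lemma qsinhc_int_shift x (m : int) :
  hC 2%:R *: qsinhc (x + m%:~R) =
  hC 2%:R *: qsinhc x + qp1 k m *: qexp x - qp1 k (- m) *: qexp (- x).
Proof.
rewrite !qsinhcE opprD -mulrNz !qexp1D; try exact: commr_int.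
by rewrite !qexp1_int -!scalerAr !mulr1 opprD addrACA addrA.
Qed.

(** sinh(hbar(x + 1)) = q sinh(hbar x) + sinh(hbar) exp(- hbar x), divided by
    hbar; likewise for x - 1. *)
Lemma qsinhcD1 x : qsinhc (x + 1) = qp 1 *: qsinhc x + sinhc *: qexp (- x).
Proof.
have [c c2] : exists c : K, c * hC 2%:R = 1.
  by apply/hser_unit; apply: natk_neq0.
have inj2 (y z : A) : hC 2%:R *: y = hC 2%:R *: z -> y = z.
  by move/(congr1 ( *:%R c)); rewrite !scalerA c2 !scale1r.
apply: inj2; rewrite (qsinhc_int_shift x 1) scalerDr scalerA.
have /(canRL (subrK _)) -> := qexpB x.
rewrite scalerDr !scalerA -addrA -addrA addrA -scalerDl -scalerBl qp1_sinhc.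
by congr (_ *: _ + _); rewrite qp1E; ring.
Qed.

Lemma qsinhcB1 x : qsinhc (x - 1) = qp 1 *: qsinhc x - sinhc *: qexp x.
Proof.
have oddS y : qsinhc (- y) = - qsinhc y.
  apply: hsums_uniq A_sep (qsinhc_sums _) _; rewrite -[- qsinhc y]scaleN1r.
  apply: hsums_eq (hsumsZ (@submodT _ A) (-1) (qsinhc_sums y)) => n.
  rewrite /sinhc_term exprNn -signr_odd /=; case: (odd n); rewrite /= ?scaler0 //.
  by rewrite expr1 mulN1r scalerN scaleN1r.
rewrite -[x - 1]opprK oddS opprB addrC qsinhcD1 oddS opprK opprD scalerN.
by rewrite opprK.
Qed.

Section Intertwining.
Variables (y x x' : A).
Hypothesis yx : y * x = x' * y.

Lemma expr_intertwine n : y * x ^+ n = x' ^+ n * y.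
Proof.
elim: n => [|n IH]; first by rewrite mulr1 mul1r.
by rewrite exprS mulrA yx -mulrA IH mulrA -exprS.
Qed.

Lemma hsums_intertwine (c : nat -> K) (d : nat -> nat) z z' :
  hsums setT (fun n => c n *: x ^+ d n) z ->
  hsums setT (fun n => c n *: x' ^+ d n) z' -> y * z = z' * y.
Proof.
move=> xz xz'; have /= := hsums_linear (mull_linear y) xz.
move/(hsums_uniq A_sep); apply; have := hsums_linear (mulr_linear y) xz'.
by apply: hsums_eq => n /=; rewrite -scalerAl -scalerAr expr_intertwine.
Qed.

Lemma qexp_intertwine : y * qexp x = qexp x' * y.
Proof. exact: hsums_intertwine (qexp_sums x) (qexp_sums x'). Qed.

Lemma qsinhc_intertwine : y * qsinhc x = qsinhc x' * y.
Proof.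
have E z : hsums setT (fun n => (if odd n then 0 else hC n.+1`!%:R^-1) *: z ^+ n.+1)
    (qsinhc z).
  apply: hsums_eq (qsinhc_sums z) => n; rewrite /sinhc_term.
  by case: odd; rewrite ?scale0r.
exact: hsums_intertwine (E x) (E x').
Qed.

End Intertwining.

Section ClosedSubalgebra.
Variable S : set A.
Hypothesis S_alg : is_subalg S.

Lemma subalg_submod : submod S.
Proof.
by case: S_alg => S1 SD SZ _; split=> //; rewrite -(scale0r 1); apply: SZ.
Qed.

Lemma subalgX x n : S x -> S (x ^+ n).
Proof.
case: S_alg => S1 _ _ SM Sx; elim: n => [|n IH] //.
by rewrite exprS; apply: SM.
Qed.

Hypothesis S_cl : forall x, (forall N, exists2 z, S z & hcong setT N x z) -> S x.

Lemma qexp1_closed x : S x -> S (qexp1 x).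
Proof.
move=> Sx; apply: (proj1 (hsums_closed A_complete subalg_submod S_cl _ (qexp1_sums x))) => i.
by case: S_alg => _ _ SZ _; apply/SZ/subalgX.
Qed.

End ClosedSubalgebra.

End Exponential.

(** * Completed tensor products *)

Section TensorTests.
Variables (k : fieldType) (M N : lmodType (hser k)).
Local Notation K := (hser k).
Implicit Types (t u : ctens M N) (r : craw M N).

Section OneTest.
Variables (m : nat) (W : lmodType K) (phi : M -> N -> W).
Hypotheses (phi_bil : bilinear_map phi) (W_tors : forall w : W, hbar ^+ m *: w = 0).

(** The elements of the completed tensor product are told apart by these
    linear maps to torsion modules; all identities between completed tensors
    are checked on them. *)
Definition cev t : W := ceval m phi (crepr t).

Lemma cev_cpi r : cev (cpi r) = ceval m phi r.
Proof. exact: crepr_cpi. Qed.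

Lemma cev_linear : linear cev.
Proof.
move=> a; elim/ctensW=> r; elim/ctensW=> s.
rewrite -[a *: cpi r]/(ctens_scale a _) ctens_scaleE cpiD !cev_cpi.
by rewrite cevalD cevalZ.
Qed.

Lemma torsion_ge n (w : W) : (m <= n)%N -> hbar ^+ n *: w = 0.
Proof. by move=> mn; rewrite -(subnK mn) exprD -scalerA W_tors scaler0. Qed.

Lemma cev_pure x y : cev (x ⊗ y) = phi x y.
Proof.
rewrite cev_cpi; case: m W_tors => [W0|m' _].
  by rewrite -[LHS]scale1r -[RHS]scale1r -(expr0 hbar) !W0.
rewrite /ceval big_ord_recl /= big_seq1 expr0 scale1r.
by rewrite big1 ?addr0 // => i _; rewrite big_nil scaler0.
Qed.

Lemma ceval_widen n r : (m <= n)%N -> ceval n phi r = ceval m phi r.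
Proof.
move=> /subnKC <-; rewrite /ceval big_split_ord /=.
by rewrite [X in _ + X]big1 ?addr0 // => i _; rewrite torsion_ge ?leq_addr.
Qed.

End OneTest.

Lemma ctens_ext t u :
  (forall m (W : lmodType K) (phi : M -> N -> W), bilinear_map phi ->
    (forall w : W, hbar ^+ m *: w = 0) -> cev m phi t = cev m phi u) -> t = u.
Proof. by move=> E; rewrite -(creprK t) -(creprK u); apply/cpiP => m W phi; apply: E. Qed.

Lemma ctens_separated : hseparated (ctens M N).
Proof.
move=> t t0; apply: ctens_ext => m W phi B h.
have [z _] := t0 m; rewrite subr0 => ->.
by have L := cev_linear B h; rewrite (linZ L) h (lin0 L).
Qed.

Lemma pure_bilinear : bilinear_map (@pure k M N).
Proof.
split=> [y|x] a u v; apply: ctens_ext => m W phi B h;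
  rewrite (cev_linear B h) !(cev_pure B h); by case: B => L R; rewrite ?L ?R.
Qed.

Lemma cpi_sums r : hsums setT (fun n => \sum_(p <- r n) p.1 ⊗ p.2) (cpi r).
Proof.
move=> n; exists (cpi (fun i => r (n + i)%N)) => //.
apply/eqP; rewrite subr_eq addrC; apply/eqP/ctens_ext => m W phi B h.
have L := cev_linear B h; rewrite (linD L) (linZ L) (lin_sum L).
rewrite !(cev_cpi B h) -(ceval_widen phi h _ (leq_addl n m)) /ceval.
rewrite big_split_ord /=; congr (_ + _).
  apply: eq_bigr => i _; rewrite (linZ L) (lin_sum L).
  by congr (_ *: _); apply: eq_bigr => p _; rewrite /= (cev_pure B h).
rewrite scaler_sumr; apply: eq_bigr => i _.
by rewrite exprD -scalerA.
Qed.

End TensorTests.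

Section TensorMaps.
Variables (k : fieldType).
Local Notation K := (hser k).

Lemma ctens_map_cpi (M N M' N' : lmodType K) (f : M -> M') (g : N -> N') r :
  linear f -> linear g ->
  ctens_map f g (cpi r) = cpi (fun n => [seq (f p.1, g p.2) | p <- r n]).
Proof.
move=> Lf Lg.
pose f' : {linear M -> M'} := HB.pack f (GRing.isLinear.Build _ _ _ _ _ Lf).
pose g' : {linear N -> N'} := HB.pack g (GRing.isLinear.Build _ _ _ _ _ Lg).
exact: (ctens_mapE f' g').
Qed.

Lemma ctens_map_linear (M N M' N' : lmodType K) (f : M -> M') (g : N -> N') :
  linear f -> linear g -> linear (ctens_map f g).
Proof.
move=> Lf Lg a; elim/ctensW=> r; elim/ctensW=> s.
rewrite -[a *: cpi r]/(ctens_scale a _) ctens_scaleE cpiD !ctens_map_cpi //.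
rewrite -[a *: cpi _]/(ctens_scale a _) ctens_scaleE cpiD; congr cpi.
apply/funext => n; rewrite /craw_add /craw_scale map_cat -!map_comp; congr (_ ++ _).
by apply: eq_map => p /=; rewrite (linZ Lf).
Qed.

Lemma ctens_map_pure (M N M' N' : lmodType K) (f : M -> M') (g : N -> N') x y :
  linear f -> linear g -> ctens_map f g (x ⊗ y) = f x ⊗ g y.
Proof.
move=> Lf Lg; rewrite /pure ctens_map_cpi //; congr cpi.
by apply/funext => -[].
Qed.

Lemma ctens_mul_bilinear (A B : algType K) : bilinear_map (@ctens_mul k A B).
Proof.
split=> [t|t] a u v; move: t u v;
  elim/ctensW=> r; elim/ctensW=> s; elim/ctensW=> t;
  rewrite -[a *: cpi _]/(ctens_scale a _) ctens_scaleE cpiD !ctens_mulE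
    -[a *: cpi _]/(ctens_scale a _) ctens_scaleE cpiD;
  apply/cpiP => m W phi b0 h; rewrite [RHS]cevalD [in RHS]cevalZ // !ceval_mul //.
  by rewrite cevalD cevalZ //; apply: bilinear_mulr.
have E x y : ceval m (fun x' y' => phi (x * x') (y * y'))
                   (craw_add (craw_scale a s) t)
    = a *: ceval m (fun x' y' => phi (x * x') (y * y')) s
      + ceval m (fun x' y' => phi (x * x') (y * y')) t.
  by rewrite cevalD cevalZ //; apply: bilinear_mull.
rewrite [LHS]/ceval; under eq_bigr do under eq_bigr do rewrite E.
rewrite [in RHS]/ceval scaler_sumr -big_split; apply: eq_bigr => i _ /=.
rewrite scalerA mulrC -scalerA -scalerDr; congr (_ *: _).
by rewrite scaler_sumr -big_split.
Qed.

End TensorMaps.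

(** * Product functionals on completed tensor products *)

Section Truncation.
Variables (k : fieldType) (m : nat).
Local Notation K := (hser k).

(** The module k[[hbar]] / hbar^m. *)
Definition htrunc : Type := {ffun 'I_m -> k}.
HB.instance Definition _ := GRing.Zmodule.on htrunc.

Definition trunc (a : K) : htrunc := [ffun i : 'I_m => a i].
Definition untrunc (w : htrunc) : K :=
  fun n => if insub n is Some i then w i else 0.

Lemma untruncK w : trunc (untrunc w) = w.
Proof. by apply/ffunP => i; rewrite ffunE /untrunc valK. Qed.

Lemma truncP a b : trunc a = trunc b <-> hdvd m (a - b).
Proof.
split=> [/ffunP E i im|E].
  have := E (Ordinal im); rewrite !ffunE -[(a - b) i]/(a i - b i) /= => ->.
  by rewrite subrr.
apply/ffunP => i; rewrite !ffunE; apply/eqP; rewrite -subr_eq0.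
by apply/eqP/(E i (ltn_ord i)).
Qed.

Lemma truncM a b : trunc (a * untrunc (trunc b)) = trunc (a * b).
Proof.
apply/truncP; rewrite -mulrBr; apply: hdvdMl; apply/truncP.
exact: untruncK.
Qed.

Lemma truncD a b : trunc (a + b) = trunc a + trunc b.
Proof. by apply/ffunP => i; rewrite !ffunE. Qed.

Definition trunc_scale (a : K) (w : htrunc) : htrunc := trunc (a * untrunc w).

Fact trunc_scaleA a b w :
  trunc_scale a (trunc_scale b w) = trunc_scale (a * b) w.
Proof. by rewrite /trunc_scale truncM mulrA. Qed.
Fact trunc_scale1 : left_id 1 trunc_scale.
Proof. by move=> w; rewrite /trunc_scale mul1r untruncK. Qed.
Fact trunc_scaleDr : right_distributive trunc_scale +%R.
Proof.
move=> a v w; rewrite -{1}(untruncK v) -{1}(untruncK w) -truncD.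
by rewrite /trunc_scale truncM mulrDr truncD.
Qed.
Fact trunc_scaleDl w : {morph trunc_scale^~ w : a b / a + b}.
Proof. by move=> a b; rewrite /trunc_scale mulrDl truncD. Qed.

HB.instance Definition _ := GRing.Zmodule_isLmodule.Build K htrunc
  trunc_scaleA trunc_scale1 trunc_scaleDr trunc_scaleDl.

Lemma trunc_linear : linear (trunc : K^o -> htrunc).
Proof.
by move=> a b c; rewrite truncD -[a *: trunc b]/(trunc (a * _)) truncM.
Qed.

Lemma htrunc_torsion (w : htrunc) : hbar ^+ m *: w = 0.
Proof.
apply/ffunP => i; rewrite ffunE [RHS]ffunE.
by rewrite coef_hbarXM ltn_ord.
Qed.

End Truncation.

Section ProductFunctionals.
Variables (k : fieldType) (M N : lmodType (hser k)).
Local Notation K := (hser k).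
Variables (F : M -> K^o) (phi : N -> K^o).
Hypotheses (LF : linear F) (Lphi : linear phi).

Let prod x y : K^o := F x * phi y.

Let prod_bilinear : bilinear_map prod.
Proof.
split=> [y|x] a u v; rewrite /prod ?LF ?Lphi.
  by rewrite mulrDl -[_ *: (_ * _)]/(_ * (_ * _)) mulrA.
by rewrite mulrDr -[_ *: (_ * _)]/(_ * (_ * _)) mulrCA.
Qed.

(** F (x) phi. Its n-th coefficient only depends on tensors modulo
    hbar^(n+1). *)
Definition cfun (t : ctens M N) : K^o := fun n => ceval n.+1 prod (crepr t) n.

Let trunc_bilinear m : bilinear_map (fun x y => trunc m (prod x y)).
Proof.
by case: prod_bilinear => L R; split=> [y|x] a u v;
  rewrite ?L ?R; apply: trunc_linear.
Qed.

Let trunc_ceval m n r : trunc m (ceval n prod r) = ceval n (fun x y => trunc m (prod x y)) r.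
Proof.
have L := @trunc_linear k m; rewrite (lin_sum L); apply: eq_bigr => i _.
by rewrite (linZ L) (lin_sum L).
Qed.

Let coef_ceval m n r : (n < m)%N -> ceval m prod r n = cfun (cpi r) n.
Proof.
move=> nm.
have h := @htrunc_torsion k n.+1.
have E1 := crepr_cpi r (trunc_bilinear n.+1) h.
have E2 := ceval_widen (fun x y => trunc n.+1 (prod x y)) h r nm.
move: E1 E2; rewrite -!trunc_ceval => E1 E2.
have lt_nn := ltnSn n.
have C (a b : K) : trunc n.+1 a = trunc n.+1 b -> a n = b n.
  by move=> /ffunP/(_ (Ordinal lt_nn)); rewrite !ffunE.
by rewrite (C _ _ E2) /cfun -/prod (C _ _ E1).
Qed.

Lemma cfun_linear : linear cfun.
Proof.
move=> a; elim/ctensW=> r; elim/ctensW=> s.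
rewrite -[a *: cpi r]/(ctens_scale a _) ctens_scaleE cpiD.
apply/funext => n; rewrite -(@coef_ceval n.+1) // cevalD cevalZ //.
rewrite -[RHS]/((a * cfun (cpi r)) n + cfun (cpi s) n).
rewrite -(@coef_ceval n.+1 n s) // -[LHS]/((a * _) n + _); congr (_ + _).
rewrite !coef_hM; apply: eq_bigr => i _; congr (_ * _).
by rewrite (@coef_ceval n.+1) // ltnS leq_subr.
Qed.

Lemma cfun_pure x y : cfun (x ⊗ y) = F x * phi y.
Proof.
apply/funext => n; rewrite -(@coef_ceval n.+1) // /ceval big_ord_recl /=.
rewrite big_seq1 expr0 scale1r big1 ?addr0 // => i _.
by rewrite big_nil scaler0.
Qed.

End ProductFunctionals.

Lemma cfun_map (k : fieldType) (M N M' N' : lmodType (hser k))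
    (F : M' -> (hser k)^o) (phi : N' -> (hser k)^o) (f : M -> M') (g : N -> N') t :
  linear F -> linear phi -> linear f -> linear g ->
  cfun F phi (ctens_map f g t) = cfun (F \o f) (phi \o g) t.
Proof.
move=> LF Lphi Lf Lg.
have LFf : linear (F \o f) by move=> a x y; rewrite /= Lf LF.
have Lpg : linear (phi \o g) by move=> a x y; rewrite /= Lg Lphi.
elim/ctensW: t => r; rewrite ctens_map_cpi //.
apply: (hsums_uniq _ (hsums_linear (cfun_linear LF Lphi) (cpi_sums _))).
  by move=> x x0; apply: hdvd_eq0 => n; have [z _] := x0 n;
    rewrite subr0 => ->; apply: hdvd_hbarX.
apply: hsums_eq (hsums_linear (cfun_linear LFf Lpg) (cpi_sums r)) => n /=.
rewrite (lin_sum (cfun_linear LFf Lpg)) (lin_sum (cfun_linear LF Lphi)) big_map.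
by apply: eq_bigr => p _ /=; rewrite !cfun_pure.
Qed.

Section BilinearRules.
Variable k : fieldType.
Local Notation K := (hser k).

Section Pure.
Variables M N : lmodType K.
Implicit Types (x : M) (y : N).

Let Ll y := bilinear_l (@pure_bilinear k M N) y.
Let Lr x := bilinear_r (@pure_bilinear k M N) x.

Lemma pureDl x x' y : (x + x') ⊗ y = x ⊗ y + x' ⊗ y.
Proof. exact: linD (Ll y) x x'. Qed.
Lemma pureDr x y y' : x ⊗ (y + y') = x ⊗ y + x ⊗ y'.
Proof. exact: linD (Lr x) y y'. Qed.
Lemma pureZl a x y : (a *: x) ⊗ y = a *: (x ⊗ y).
Proof. exact: linZ (Ll y) a x. Qed.
Lemma pureZr a x y : x ⊗ (a *: y) = a *: (x ⊗ y).
Proof. exact: linZ (Lr x) a y. Qed.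
Lemma pureNl x y : (- x) ⊗ y = - (x ⊗ y).
Proof. by rewrite -scaleN1r pureZl scaleN1r. Qed.
Lemma pureNr x y : x ⊗ (- y) = - (x ⊗ y).
Proof. by rewrite -scaleN1r pureZr scaleN1r. Qed.
End Pure.

Section Mul.
Variables A B : algType K.
Implicit Types t u : ctens A B.

Let Ll u := bilinear_l (@ctens_mul_bilinear k A B) u.
Let Lr t := bilinear_r (@ctens_mul_bilinear k A B) t.

Lemma ctens_mulDl t t' u : ctens_mul (t + t') u = ctens_mul t u + ctens_mul t' u.
Proof. exact: linD (Ll u) t t'. Qed.
Lemma ctens_mulDr t u u' : ctens_mul t (u + u') = ctens_mul t u + ctens_mul t u'.
Proof. exact: linD (Lr t) u u'. Qed.
Lemma ctens_mulZl a t u : ctens_mul (a *: t) u = a *: ctens_mul t u.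
Proof. exact: linZ (Ll u) a t. Qed.
Lemma ctens_mulZr a t u : ctens_mul t (a *: u) = a *: ctens_mul t u.
Proof. exact: linZ (Lr t) a u. Qed.
Lemma ctens_mul_suml (I : Type) (r : seq I) P F u :
  ctens_mul (\sum_(i <- r | P i) F i) u = \sum_(i <- r | P i) ctens_mul (F i) u.
Proof. exact: lin_sum (Ll u) _ _ _ _. Qed.
Lemma ctens_mul_sumr (I : Type) (r : seq I) P F t :
  ctens_mul t (\sum_(i <- r | P i) F i) = \sum_(i <- r | P i) ctens_mul t (F i).
Proof. exact: lin_sum (Lr t) _ _ _ _. Qed.
End Mul.
End BilinearRules.

(** * Linear identities in modules *)

(** Reflexive decision of identities between linear combinations: two
    combinations agree when, for each variable, the coefficients agree. *)
Section LinearCombinations.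
Variables (R : comPzRingType) (V : lmodType R).

Inductive lterm :=
  LVar of nat | LZero | LAdd of lterm & lterm | LOpp of lterm
| LScale of R & lterm.

Fixpoint leval (env : seq V) t : V :=
  match t with
  | LVar i => nth 0 env i
  | LZero => 0
  | LAdd t u => leval env t + leval env u
  | LOpp t => - leval env t
  | LScale a t => a *: leval env t
  end.

Fixpoint lcoef t (i : nat) : R :=
  match t with
  | LVar j => if Nat.eqb i j then 1 else 0
  | LZero => 0
  | LAdd t u => lcoef t i + lcoef u i
  | LOpp t => - lcoef t i
  | LScale a t => a * lcoef t i
  end.

Fixpoint lcheck n t u : Prop :=
  if n is n'.+1 then lcoef t n' = lcoef u n' /\ lcheck n' t u else True.

Lemma leval_coef env t :
  leval env t = \sum_(i < size env) lcoef t i *: nth 0 env i.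
Proof.
elim: t => [j||t IHt u IHu|t IH|a t IH] /=; last first.
- by rewrite IH scaler_sumr; apply: eq_bigr => i _; rewrite scalerA.
- by rewrite IH -sumrN; apply: eq_bigr => i _; rewrite scaleNr.
- by rewrite IHt IHu -big_split; apply: eq_bigr => i _; rewrite scalerDl.
- by rewrite big1 // => i _; rewrite scale0r.
have E (i : nat) : Nat.eqb i j = (i == j) by elim: i j => [|i IH] [|j] //=; apply: IH.
under eq_bigr do rewrite E (fun_if ( *:%R^~ _)) scale1r scale0r.
rewrite -big_mkcond; case: (ltnP j (size env)) => jn; last first.
  rewrite nth_default // big1 // => i /eqP ij.
  by move: (ltn_ord i); rewrite ij ltnNge jn.
by rewrite (big_pred1 (Ordinal jn)) // => i; rewrite /= -val_eqE.
Qed.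

Lemma lcheckP env t u : lcheck (size env) t u -> leval env t = leval env u.
Proof.
rewrite !leval_coef => H; apply: eq_bigr => i _; congr (_ *: _).
have C n : lcheck n t u -> forall j, (j < n)%N -> lcoef t j = lcoef u j.
  elim: n => // n IH [E C] j; rewrite ltnS leq_eqVlt => /predU1P[->//|].
  exact: IH.
exact: C H _ (ltn_ord i).
Qed.

End LinearCombinations.

(* up to conversion, as the same product may be formed in several structures *)
Ltac lsame x y := first [constr_eq x y | unify x y].

Ltac lenv_add env x :=
  match env with
  | [::] => constr:([:: x])
  | ?y :: _ => let _ := match goal with _ => lsame x y end in env
  | ?y :: ?env' => let env'' := lenv_add env' x in constr:(y :: env'')
  end.

Ltac lindex env x :=
  match env with
  | ?y :: _ => let _ := match goal with _ => lsame x y end in constr:(0%N)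
  | _ :: ?env' => let n := lindex env' x in constr:((S n))
  end.

Ltac lvars env t :=
  match t with
  | (?a + ?b)%R => let env' := lvars env a in lvars env' b
  | (- ?a)%R => lvars env a
  | (_ *: ?a)%R => lvars env a
  | (GRing.zero)%R => env
  | _ => lenv_add env t
  end.

Ltac lreify R env t :=
  match t with
  | (?a + ?b)%R => let a' := lreify R env a in let b' := lreify R env b in
                   constr:(@LAdd R a' b')
  | (- ?a)%R => let a' := lreify R env a in constr:(@LOpp R a')
  | (?c *: ?a)%R => let a' := lreify R env a in constr:(@LScale R c a')
  | (GRing.zero)%R => constr:(@LZero R)
  | _ => let n := lindex env t in constr:(@LVar R n)
  end.

Ltac lmod_goals R :=
  match goal with
  | |- ?x = ?y :> ?V =>
    let env := lvars (@nil V) x in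
    let env := lvars env y in
    let t := lreify R env x in
    let u := lreify R env y in
    apply: (@lcheckP R _ env t u); cbv [lcheck lcoef size Nat.eqb];
    repeat split
  end.

(** * The coideal generators and their relations *)

(** The relations of the nonstandard quantum so_3 come in two halves, each
    distinguishing one of the two adjacent nodes. Unprimed letters belong to the
    distinguished node, primed ones to the other, and s is the commutator of
    e and f. All hypotheses are read as rewriting rules that bring words to the
    order T', T, t, f', f, s, e', e, up to the Serre relations. *)
Section CoidealSerre.
Variables (K : comNzRingType) (U : algType K) (q qi : K).
Hypothesis qqi : q * qi = 1.
Variables (e f t T s e' f' T' : U).
Hypotheses (tT : T * t = 1) (TT' : T * T' = T' * T).
Hypotheses (eT : e * T = (q * q) *: (T * e)) (eT' : e * T' = qi *: (T' * e)).
Hypotheses (e'T : e' * T = qi *: (T * e')) (e't : e' * t = q *: (t * e')).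
Hypotheses (fT : f * T = (qi * qi) *: (T * f)) (fT' : f * T' = q *: (T' * f)).
Hypothesis (f'T : f' * T = q *: (T * f')).
Hypotheses (ef : e * f = f * e + s) (ef' : e * f' = f' * e) (e'f : e' * f = f * e').
Hypotheses (sf' : s * f' = q *: (f' * s) + f' * T).
Hypotheses (se' : s * e' = q *: (e' * s) - e' * t).
Hypothesis qs : (q - qi) *: s = t - T.
Hypothesis serre_e : e ^+ 2 * e' - (q + qi) *: (e * e' * e) + e' * e ^+ 2 = 0.
Hypothesis serre_f : f ^+ 2 * f' - (q + qi) *: (f * f' * f) + f' * f ^+ 2 = 0.

Let ext (a b c : U) : a * b = c -> forall x, x * a * b = x * c.
Proof. by move=> <- x; rewrite mulrA. Qed.

(* from T t = 1 and (q - qi) s = t - T, multiplied by f' on the left *)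
Let TTf' : T * T * f' = (qi * qi) *: f' - (1 - qi * qi) *: (T * f' * s).
Proof.
have TsT : (q - qi) *: (T * s) = 1 - T * T by rewrite scalerAr qs mulrBr tT.
have := congr1 ( *%R f') TsT; rewrite mulrBr mulr1 -scalerAr !mulrA f'T.
rewrite -!scalerAl -[T * f' * T]mulrA f'T -scalerAr mulrA => H.
have -> : T * T * f' = (qi * qi) *: (q *: (q *: (T * T * f'))).
  by lmod_goals K; ring: qqi.
have -> : q *: (q *: (T * T * f')) = f' - (q - qi) *: (q *: (T * f' * s)).
  by rewrite H opprB addrC subrK.
by lmod_goals K; ring: qqi.
Qed.

Let eee' : e * e * e' = (q + qi) *: (e * e' * e) - e' * e * e.
Proof.
apply/eqP; rewrite -subr_eq0 -[X in _ == X]serre_e expr2 !mulrA; apply/eqP.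
by lmod_goals K; ring: qqi.
Qed.

Let fff' : f * f * f' = (q + qi) *: (f * f' * f) - f' * f * f.
Proof.
apply/eqP; rewrite -subr_eq0 -[X in _ == X]serre_f expr2 !mulrA; apply/eqP.
by lmod_goals K; ring: qqi.
Qed.

Let ext3 (a b c d : U) : a * b * c = d -> forall x, x * a * b * c = x * d.
Proof. by move=> <- x; rewrite !mulrA. Qed.

(* restated in U, so that all products are formed in the same structure *)
Let scaleAl a (x y : U) : (a *: x) * y = a *: (x * y).
Proof. by rewrite scalerAl. Qed.
Let scaleAr a (x y : U) : x * (a *: y) = a *: (x * y).
Proof. by rewrite scalerAr. Qed.

Let linear_rules := (@mulrDl U, @mulrDr U, @mulNr U, @mulrN U, scaleAl, scaleAr,
  @mulrA U, @mulr1 U).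

Let T_rules := (TT', ext TT', eT, ext eT, eT', ext eT',
  e'T, ext e'T, fT, ext fT, fT', ext fT', f'T, ext f'T, e't, ext e't).

Let EF_rules := (tT, ext tT, ef, ext ef, ef', ext ef', e'f, ext e'f,
  sf', ext sf', se', ext se', TTf', eee', ext3 eee', fff', ext3 fff').

(** Expanding the left-hand side gives, besides terms that cancel by the Serre
    relations and the q-commutation rules, those where e and f are exchanged;
    their commutator s leaves - b' because of the shift of the Cartan part of s
    by f' and e'. *)
Lemma coideal_serre (b := f - q *: (T * e)) (b' := f' - q *: (T' * e')) :
  b * b * b' - (q + qi) *: (b * b' * b) + b' * b * b = - b'.
Proof.
rewrite /b /b' !linear_rules.
do 4!rewrite ?T_rules ?linear_rules.
do 5!rewrite ?EF_rules ?linear_rules ?T_rules.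
by lmod_goals K; ring: qqi.
Qed.

Lemma coideal_commutator (b := f - q *: (T * e)) (b' := f' - q *: (T' * e')) :
  b * b' = q *: (b' * b)
    - q *: ((f' * f - qi *: (f * f')) - (q - qi) *: (f' * T * e)
            - T * T' * (e * e' - q *: (e' * e))).
Proof.
rewrite /b /b' !linear_rules.
do 3!rewrite ?ef' ?e'f ?(ext ef') ?(ext e'f) ?T_rules ?linear_rules.
by lmod_goals K; ring: qqi.
Qed.
End CoidealSerre.

(** * Consequences of the defining relations *)

Section QuantumGroup.
Variables (k : fieldType) (k_char0 : [pchar k] =i pred0).
Local Notation K := (hser k).
Variables (U : algType K) (f : 'I_2 -> U) (l : 'I_3 -> U) (e : 'I_2 -> U).
Hypothesis U_complete : hcomplete [set: U].
Hypothesis rel : Uh_relations f l e.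

Local Notation h := (cartan l).
Local Notation t := (tq l).
Local Notation T := (tqV l).

Definition cartan_entry (i j : 'I_2) : int := if i == j then 2 else -1.
Local Notation cm := cartan_entry.

Lemma cartan_mat i j (R : pzRingType) :
  ((lo j == lo i)%:R - (hi j == lo i)%:R) -
  ((lo j == hi i)%:R - (hi j == hi i)%:R) = (cm i j)%:~R :> R.
Proof.
rewrite /cm; case: i => [[|[|//]] ?]; case: j => [[|[|//]] ?];
  by rewrite -?val_eqE /= ?subr0 ?sub0r ?opprK // mulr0n !subr0.
Qed.

Lemma cartan_e i j : h i * e j = e j * h i + (cm i j)%:~R * e j.
Proof.
have E a := canRL (subrK _) (Uh_le rel a j).
rewrite /cartan mulrBl mulrBr !E opprD addrACA -scalerBl addrC cartan_mat.
by congr (_ + _); rewrite scaler_int mulrzl.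
Qed.

Lemma cartan_f i j : h i * f j = f j * h i - (cm i j)%:~R * f j.
Proof.
have E a := canRL (subrK _) (Uh_lf rel a j).
rewrite /cartan mulrBl mulrBr !E opprD addrACA -scalerBl addrC; congr (_ + _).
rewrite mulrzl -scaler_int -scaleNr; congr (_ *: _).
by rewrite -cartan_mat; ring.
Qed.

Lemma cartanC i j : h i * h j = h j * h i.
Proof.
by apply: commrB; apply/commr_sym/commrB; apply: (Uh_ll rel).
Qed.

Lemma tqVC i j : T i * h j = h j * T i.
Proof.
by apply/esym/qexp_intertwine => //; rewrite mulrN mulNr cartanC.
Qed.

Lemma tqV_comm i j : T i * T j = T j * T i.
Proof. by apply: qexp_intertwine => //; rewrite mulrN mulNr tqVC. Qed.

Lemma tqVK i : T i * t i = 1.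
Proof. by rewrite /tq -[h i]opprK qexpN. Qed.

Lemma e_tq i j : e j * t i = qp (- cm i j) *: (t i * e j).
Proof.
rewrite scalerAl -qexp_int_shift //; apply: qexp_intertwine => //.
by rewrite mulrDl cartan_e mulrNz mulNr addrK.
Qed.

Lemma e_tqV i j : e j * T i = qp (cm i j) *: (T i * e j).
Proof.
rewrite scalerAl -qexp_int_shift //; apply: qexp_intertwine => //.
by rewrite mulrDl mulNr cartan_e mulrN opprD subrK.
Qed.

Lemma f_tqV i j : f j * T i = qp (- cm i j) *: (T i * f j).
Proof.
rewrite scalerAl -qexp_int_shift //; apply: qexp_intertwine => //.
by rewrite mulrDl mulNr cartan_f mulrN mulrNz mulNr opprB addrAC subrr sub0r.
Qed.

(** This is (t_i - t_i^-1) / (q - q^-1). *)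
Definition ef_comm i := e i * f i - f i * e i.
Local Notation s := ef_comm.

Lemma sinhc_ef i : sinhc *: s i = qsinhc (h i).
Proof. by rewrite (Uh_ef rel i i) eqxx scale1r. Qed.

Lemma sinhc_inj (x y : U) : sinhc *: x = sinhc *: y -> x = y.
Proof.
have [c c1] : exists c : K, c * sinhc = 1.
  by apply: hser_unit; rewrite sinhc0 oner_neq0.
by move/(congr1 ( *:%R c)); rewrite !scalerA c1 !scale1r.
Qed.

Lemma qq_ef i : qq *: s i = t i - T i.
Proof. by rewrite qqE -scalerA sinhc_ef qexpB. Qed.

Lemma e_fC i j : i != j -> e i * f j = f j * e i.
Proof.
move=> ij; apply/eqP; rewrite -subr_eq0; apply/eqP/sinhc_inj.
by rewrite (Uh_ef rel) (negPf ij) scale0r scaler0.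
Qed.

Section AdjacentNodes.
Variables i j : 'I_2.
Hypothesis ij : i != j.

Let cm_ij : cm i j = -1. Proof. by rewrite /cm (negPf ij). Qed.

(** Moving f_j or e_j across h_i shifts h_i by 1 or -1; the two rules are the
    addition formulas for sinh(hbar h_i) / sinh(hbar). *)
Lemma ef_comm_f : s i * f j = qp 1 *: (f j * s i) + f j * T i.
Proof.
apply: sinhc_inj; rewrite scalerAl sinhc_ef.
transitivity (f j * (qp 1 *: qsinhc (h i) + sinhc *: T i)); last first.
  by rewrite mulrDr -sinhc_ef -!scalerAr scalerDr !scalerA mulrC.
rewrite -qsinhcD1 //; apply/esym/qsinhc_intertwine => //.
by rewrite cartan_f cm_ij mulrDr mulr1 mulN1r opprK.
Qed.

Lemma ef_comm_e : s i * e j = qp 1 *: (e j * s i) - e j * t i.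
Proof.
apply: sinhc_inj; rewrite scalerAl sinhc_ef.
transitivity (e j * (qp 1 *: qsinhc (h i) - sinhc *: t i)); last first.
  by rewrite mulrBr -sinhc_ef -!scalerAr scalerBr !scalerA mulrC.
rewrite -qsinhcB1 //; apply/esym/qsinhc_intertwine => //.
by rewrite cartan_e cm_ij mulrBr mulr1 mulN1r.
Qed.

Let ji : j != i. Proof. by rewrite eq_sym. Qed.
Let adj : (i.+1 == j)%N || (j.+1 == i)%N.
Proof. by move: ij; case: (i) => [[|[|//]] ?]; case: (j) => [[|[|//]] ?]. Qed.
Let cm_ji : cm j i = -1. Proof. by rewrite /cm (negPf ji). Qed.
Let cm_ii i' : cm i' i' = 2. Proof. by rewrite /cm eqxx. Qed.
Let qp2 m : qp (m + m) = qp m * qp m :> K. Proof. by rewrite qpD. Qed.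

(** The standard generators of a quantum symmetric pair coideal. *)
Definition kap i := f i - qp 1 *: (T i * e i).

Lemma kap_serre :
  kap i * kap i * kap j - (qp 1 + qp (-1)) *: (kap i * kap j * kap i)
    + kap j * kap i * kap i = - kap j.
Proof.
apply: (@coideal_serre _ _ (qp 1) (qp (-1)) (qpVr k_char0 1) _ _ (t i) _ (s i)).
- exact: tqVK.
- exact: tqV_comm.
- by rewrite e_tqV cm_ii -qp2.
- by rewrite e_tqV cm_ji.
- by rewrite e_tqV cm_ij.
- by rewrite e_tq cm_ij.
- by rewrite f_tqV cm_ii -qp2.
- by rewrite f_tqV cm_ji.
- by rewrite f_tqV cm_ij.
- by rewrite addrC subrK.
- exact: e_fC.
- exact: e_fC.
- exact: ef_comm_f.
- exact: ef_comm_e.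
- exact: qq_ef.
- exact: (Uh_serre_e rel adj).
- exact: (Uh_serre_f rel adj).
Qed.

Lemma kap_commutator :
  kap i * kap j = qp 1 *: (kap j * kap i)
    - qp 1 *: ((f j * f i - qp (-1) *: (f i * f j)) - qq *: (f j * T i * e i)
               - T i * T j * (e i * e j - qp 1 *: (e j * e i))).
Proof.
apply: (@coideal_commutator _ _ (qp 1) (qp (-1)) (qpVr k_char0 1)).
- exact: tqV_comm.
- by rewrite e_tqV cm_ji.
- by rewrite e_tqV cm_ij.
- by rewrite f_tqV cm_ji.
- by rewrite f_tqV cm_ij.
- exact: e_fC.
- exact: e_fC.
Qed.

End AdjacentNodes.
End QuantumGroup.

(** * Coproducts of the generators *)

Section Coproduct.
Variables (k : fieldType) (k_char0 : [pchar k] =i pred0).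
Local Notation K := (hser k).
Variables (U : algType K) (f : 'I_2 -> U) (l : 'I_3 -> U) (e : 'I_2 -> U).
Hypothesis U_complete : hcomplete [set: U].
Hypothesis rel : Uh_relations f l e.
Variables (Delta : {linear U -> ctens U U}) (eps : {lrmorphism U -> K^o}).
Hypothesis bialg : is_Uh_bialgebra f l e Delta eps.

Local Notation h := (cartan l).
Local Notation T := (tqV l).
Local Notation kap := (kap f l e).

Let DeltaL : linear Delta. Proof. by move=> a x y; rewrite linearP. Qed.

(** Divided powers are used because their coproduct has no binomial
    coefficients. *)
Lemma Delta_divided_power (x : U) n : Delta x = x ⊗ 1 + 1 ⊗ x ->
  Delta (hC n`!%:R^-1 *: x ^+ n) =
  \sum_(i < n.+1) (hC i`!%:R^-1 *: x ^+ i) ⊗ (hC (n - i)`!%:R^-1 *: x ^+ (n - i)).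
Proof.
move=> Dx; pose y n := hC n`!%:R^-1 *: x ^+ n.
have n0 n' : hC n'.+1%:R^-1 * hC n'.+1%:R = 1 :> K.
  by rewrite -hCM mulVf ?hC1 // natk_neq0.
have yS n' : y n'.+1 = hC n'.+1%:R^-1 *: (x * y n').
  by rewrite /y exprS factS natrM invfM hCM -scalerA -scalerAr.
have xy n' : x * y n' = n'.+1%:R *: y n'.+1.
  by rewrite yS scalerA -hCnat mulrC n0 scale1r.
rewrite -/(y n); elim: n => [|n IH].
  by rewrite big_ord1 /y expr0 fact0 invr1 hC1 scale1r (Delta1 bialg).
rewrite yS linearZ /= (DeltaM bialg) Dx {}IH ctens_mulDl !ctens_mul_sumr.
rewrite -[RHS]scale1r -(n0 n) hCnat -scalerA; congr (_ *: _).
transitivity (\sum_(i < n.+2) i%:R *: (y i ⊗ y (n.+1 - i)%N)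
  + \sum_(i < n.+2) (n.+1 - i)%:R *: (y i ⊗ y (n.+1 - i)%N)).
  congr (_ + _).
    rewrite [RHS]big_ord_recl mulr0n scale0r add0r; apply: eq_bigr => i _.
    by rewrite pure_mulE mul1r -/(y i) xy pureZl.
  rewrite [RHS]big_ord_recr subnn mulr0n scale0r /= addr0; apply: eq_bigr => i _ /=.
  by rewrite pure_mulE mul1r -/(y (n - i)%N) xy pureZr -subSn // -ltnS.
rewrite -big_split scaler_sumr; apply: eq_bigr => i _ /=.
by rewrite -scalerDl -natrD subnKC // -ltnS.
Qed.

(** exp(hbar x) is grouplike for x primitive, by the Cauchy product formula for
    the bilinear map (x). *)
Lemma Delta_qexp (x : U) : Delta x = x ⊗ 1 + 1 ⊗ x ->
  Delta (qexp x) = qexp x ⊗ qexp x.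
Proof.
move=> Dx; have S := qexp_sums U_complete x.
apply: (hsums_uniq (@ctens_separated _ _ _) (hsums_linear DeltaL S)).
have := hsums_Cauchy (@pure_bilinear k U U) S S.
by apply: hsums_eq => n; rewrite /= Delta_divided_power.
Qed.

Lemma Delta_cartan i : Delta (h i) = h i ⊗ 1 + 1 ⊗ h i.
Proof.
rewrite /cartan linearB /= !(Delta_l bialg) pureDl pureDr pureNl pureNr.
by lmod_goals (hser k); ring.
Qed.

Lemma Delta_tqV i : Delta (T i) = T i ⊗ T i.
Proof.
apply: Delta_qexp; rewrite linearN /= Delta_cartan pureNl pureNr.
by lmod_goals (hser k); ring.
Qed.

Lemma Delta_kap i : Delta (kap i) = 1 ⊗ kap i + kap i ⊗ T i.
Proof.
rewrite /kap linearB linearZ /= (Delta_f bialg) (DeltaM bialg) Delta_tqV.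
rewrite (Delta_e bialg) ctens_mulDr !pure_mulE mulr1 tqVK //.
rewrite !(pureDl, pureDr, pureNl, pureNr, pureZl, pureZr).
by lmod_goals (hser k); ring.
Qed.

Section AdjacentNodes.
Variables i j : 'I_2.
Hypothesis ij : i != j.

Let qqi : qp 1 * qp (-1) = 1 :> K. Proof. exact: qpVr. Qed.
Let fT : f j * T i = qp 1 *: (T i * f j).
Proof. by rewrite (f_tqV k_char0 U_complete rel) /cartan_entry (negPf ij) opprK. Qed.
Let eT : e j * T i = qp (-1) *: (T i * e j).
Proof. by rewrite (e_tqV k_char0 U_complete rel) /cartan_entry (negPf ij). Qed.

Lemma kap_tqV : kap j * T i - qp (-1) *: (T i * kap j) =
  (qp (-1) * qq) *: (f j * T i).
Proof.
rewrite /kap mulrBl mulrBr -scalerAl -scalerAr -mulrA eT -scalerAr !mulrA fT.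
by rewrite [T j * T i](tqV_comm U_complete rel) /qq; lmod_goals (hser k); ring: qqi.
Qed.

Lemma tqV_kap : T i * kap j - qp (-1) *: (kap j * T i) =
  - (qq *: (T j * T i * e j)).
Proof.
rewrite /kap mulrBl mulrBr -scalerAl -scalerAr -[T j * e j * _]mulrA eT -scalerAr !mulrA fT.
by rewrite [T j * T i](tqV_comm U_complete rel) /qq; lmod_goals (hser k); ring: qqi.
Qed.
End AdjacentNodes.

Let i1 : 'I_2 := ord0.
Let i2 : 'I_2 := ord_max.

(** The generators K_12, K_23, K_13 without their powers of q; they generate
    the same subalgebra. *)
Definition kap12 := kap i1.
Definition kap23 := kap i2.
Definition kap13 := F31 f - qq *: (f2 f * t1V l * e1 e) - t1V l * t2V l * E13 e.

Let qqi : qp 1 * qp (-1) = 1 :> K. Proof. exact: qpVr. Qed.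

Lemma kap_rel12_23 : kap12 * kap23 = qp 1 *: (kap23 * kap12) - qp 1 *: kap13.
Proof. exact: (kap_commutator k_char0 U_complete rel (isT : i1 != i2)). Qed.

(** kap13 is a q-commutator, so that its relations and its coproduct follow from
    those of kap12 and kap23. *)
Lemma kap13E : kap13 = kap23 * kap12 - qp (-1) *: (kap12 * kap23).
Proof. by rewrite kap_rel12_23; lmod_goals (hser k); ring: qqi. Qed.

Lemma kap_rel23_13 : kap23 * kap13 = qp 1 *: (kap13 * kap23) - kap12.
Proof.
have := kap_serre k_char0 U_complete rel (isT : i2 != i1).
rewrite kap13E -/kap23 -/kap12; move: (kap12) (kap23) => a b H.
apply/eqP; rewrite -subr_eq0 opprB addrA; apply/eqP.
rewrite -[X in _ + X - _]opprK -H !(mulrBl, mulrBr) -!scalerAl -!scalerAr !mulrA.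
by lmod_goals (hser k); ring: qqi.
Qed.

Lemma kap_rel13_12 : kap13 * kap12 = qp 1 *: (kap12 * kap13) - kap23.
Proof.
have := kap_serre k_char0 U_complete rel (isT : i1 != i2).
rewrite kap13E -/kap23 -/kap12; move: (kap12) (kap23) => a b H.
apply/eqP; rewrite -subr_eq0 opprB addrA; apply/eqP.
rewrite -[X in _ + X - _]opprK -H !(mulrBl, mulrBr) -!scalerAl -!scalerAr !mulrA.
by lmod_goals (hser k); ring: qqi.
Qed.

Lemma Delta_kap13 : Delta kap13 = 1 ⊗ kap13 + kap13 ⊗ (t1V l * t2V l)
  + (qp (-1) * qq) *: (kap12 ⊗ (f2 f * t1V l))
  - qq *: (kap23 ⊗ (t1V l * t2V l * e1 e)).
Proof.
rewrite {1}kap13E linearB linearZ /= !(DeltaM bialg) !Delta_kap -/kap12 -/kap23.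
rewrite !(ctens_mulDl, ctens_mulDr) !pure_mulE !mul1r !mulr1.
rewrite -[(qp (-1) * qq) *: _]pureZr -(kap_tqV (isT : i1 != i2)).
have E : qq *: (t1V l * t2V l * e1 e) = - (T i2 * kap12 - qp (-1) *: (kap12 * T i2)).
  by rewrite (tqV_kap (isT : i2 != i1)) opprK.
rewrite -[qq *: (kap23 ⊗ _)]pureZr E.
rewrite kap13E !(pureDl, pureDr, pureNl, pureNr, pureZl, pureZr).
rewrite -/kap12 -/kap23 [T i2 * T i1](tqV_comm U_complete rel).
by lmod_goals (hser k); ring: qqi.
Qed.

Lemma k12E : k12 f l e = qq *: kap12.
Proof. by rewrite /k12 /K12 scalerA mulrAC qpD // addNr qp0 mul1r. Qed.
Lemma k23E : k23 f l e = qq *: kap23.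
Proof. by rewrite /k23 /K23 scalerA mulrAC qpD // addNr qp0 mul1r. Qed.
Lemma k13E : k13 f l e = qq *: kap13.
Proof. by rewrite /k13 /K13 scalerA mulrAC qpD // addNr qp0 mul1r. Qed.

Lemma k_rel12_23 : k12 f l e * k23 f l e =
  qp 1 *: (k23 f l e * k12 f l e) - (qp 1 * qq) *: k13 f l e.
Proof.
rewrite k12E k23E k13E -!scalerAl -!scalerAr kap_rel12_23.
by lmod_goals (hser k); ring.
Qed.

Lemma k_rel23_13 : k23 f l e * k13 f l e =
  qp 1 *: (k13 f l e * k23 f l e) - qq *: k12 f l e.
Proof.
rewrite k12E k23E k13E -!scalerAl -!scalerAr kap_rel23_13.
by lmod_goals (hser k); ring.
Qed.

Lemma k_rel13_12 : k13 f l e * k12 f l e =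
  qp 1 *: (k12 f l e * k13 f l e) - qq *: k23 f l e.
Proof.
rewrite k12E k23E k13E -!scalerAl -!scalerAr kap_rel13_12.
by lmod_goals (hser k); ring.
Qed.

Lemma Delta_k12 : Delta (k12 f l e) = 1 ⊗ k12 f l e + k12 f l e ⊗ t1V l.
Proof. by rewrite k12E linearZ /= Delta_kap scalerDr pureZl pureZr. Qed.

Lemma Delta_k23 : Delta (k23 f l e) = 1 ⊗ k23 f l e + k23 f l e ⊗ t2V l.
Proof. by rewrite k23E linearZ /= Delta_kap scalerDr pureZl pureZr. Qed.

Lemma Delta_k13 : Delta (k13 f l e) = 1 ⊗ k13 f l e + k13 f l e ⊗ (t1V l * t2V l)
  + (qp (-1) * qq) *: (k12 f l e ⊗ (f2 f * t1V l))
  - qq *: (k23 f l e ⊗ (t1V l * t2V l * e1 e)).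
Proof.
rewrite k12E k23E k13E linearZ /= Delta_kap13 !pureZl !pureZr.
by lmod_goals (hser k); ring.
Qed.

End Coproduct.

(** * Subalgebras, closures and tensor powers *)

Section Subalgebras.
Variables (k : fieldType) (A : algType (hser k)).
Implicit Types (S X : set A).

Lemma gen_subalg_subalg X : is_subalg (gen_subalg X).
Proof.
split=> [S [] //|x y gx gy S SA XS|a x gx S SA XS|x y gx gy S SA XS].
- by case: (SA) => _ SD _ _; exact: SD (gx S SA XS) (gy S SA XS).
- by case: (SA) => _ _ SZ _; exact: SZ (gx S SA XS).
- by case: (SA) => _ _ _ SM; exact: SM (gx S SA XS) (gy S SA XS).
Qed.

Lemma sub_gen_subalg X : X `<=` gen_subalg X.
Proof. by move=> x Xx S _; apply. Qed.

Lemma gen_subalg_min X S : is_subalg S -> X `<=` S -> gen_subalg X `<=` S.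
Proof. by move=> SA XS x; apply. Qed.

Lemma subalg_scalar S a : is_subalg S -> S (a%:A).
Proof. by case=> S1 _ SZ _; apply: SZ. Qed.

Lemma hclosure_subalg S : is_subalg S -> is_subalg (hclosure setT S).
Proof.
case=> S1 SD SZ SM; split.
- by split=> // N; exists 1 => //; apply: hcong_refl.
- move=> x y [_ Hx] [_ Hy]; split=> // N.
  have [x' Sx' xx'] := Hx N; have [y' Sy' yy'] := Hy N.
  by exists (x' + y'); [apply: SD | apply: hcongD].
- move=> a x [_ Hx]; split=> // N; have [x' Sx' xx'] := Hx N.
  by exists (a *: x'); [apply: SZ | apply: hcongZ].
- move=> x y [_ Hx] [_ Hy]; split=> // N.
  have [x' Sx' xx'] := Hx N; have [y' Sy' yy'] := Hy N.
  exists (x' * y'); first exact: SM.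
  apply: (@hcong_trans _ _ setT _ _ (x' * y)) => //.
    exact: (hcong_linear (@mulr_linear _ _ y)).
  exact: (hcong_linear (@mull_linear _ _ x')).
Qed.

Lemma hclosure_closed S x : (forall N, exists2 z, hclosure setT S z & hcong setT N x z) ->
  hclosure setT S x.
Proof.
move=> H; split=> // N; have [z [_ /(_ N)[y Sy zy]] xz] := H N.
by exists y => //; apply: hcong_trans xz zy.
Qed.

Lemma sub_hclosure S : S `<=` hclosure setT S.
Proof. by move=> x Sx; split=> // N; exists x => //; apply: hcong_refl. Qed.

Lemma hclosure_submod (T S : set A) :
  submod T -> submod S -> submod (hclosure T S).
Proof.
move=> T_sub; have [T0 TD TZ] := T_sub; case=> S0 SD SZ; split.
- by split=> // N; exists 0 => //; apply: hcong_refl.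
- move=> x y [Tx Hx] [Ty Hy]; split=> [|N]; first exact: TD.
  have [x' Sx' xx'] := Hx N; have [y' Sy' yy'] := Hy N.
  by exists (x' + y'); [apply: SD | apply: hcongD].
- move=> a x [Tx Hx]; split=> [|N]; first exact: TZ.
  have [x' Sx' xx'] := Hx N.
  by exists (a *: x'); [apply: SZ | apply: hcongZ].
Qed.

End Subalgebras.

Section TensorSpan.
Variables (k : fieldType).
Local Notation K := (hser k).

Lemma tens_span_pure (M N : lmodType K) (S : set M) (T : set N) x y :
  S x -> T y -> tens_span S T (x ⊗ y).
Proof.
move=> Sx Ty; exists [:: (x, y)]; last by rewrite big_seq1.
by move=> p; rewrite inE => /eqP ->.
Qed.

Lemma tens_span_submod (M N : lmodType K) (S : set M) (T : set N) :
  submod S -> submod (tens_span S T).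
Proof.
case=> _ _ SZ; split=> [|_ _ [r Sr <-] [s Ss <-]|a _ [r Sr <-]].
- by exists [::]; rewrite ?big_nil.
- exists (r ++ s); last by rewrite big_cat.
  by move=> p; rewrite mem_cat => /orP[/Sr|/Ss].
- exists [seq (a *: p.1, p.2) | p <- r].
    by move=> _ /mapP[p /Sr[? ?] ->] /=; split=> //; apply: SZ.
  by rewrite big_map scaler_sumr; apply: eq_bigr => p _; rewrite pureZl.
Qed.

Lemma tens_spanM (A B : algType K) (S : set A) (T : set B) t u :
  is_subalg S -> is_subalg T -> tens_span S T t -> tens_span S T u ->
  tens_span S T (ctens_mul t u).
Proof.
move=> S_alg T_alg [r Sr <-] [s Ss <-]; rewrite ctens_mul_suml.
have sub := tens_span_submod T (subalg_submod S_alg).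
apply: (submod_sum sub) => p pr _; rewrite ctens_mul_sumr.
apply: (submod_sum sub) => p' ps _; rewrite pure_mulE; apply: tens_span_pure.
  by case: S_alg => _ _ _; apply; [case: (Sr _ pr) | case: (Ss _ ps)].
by case: T_alg => _ _ _; apply; [case: (Sr _ pr) | case: (Ss _ ps)].
Qed.

(** The elements whose coproduct lies in the given span form a subalgebra. *)
Lemma coideal_gen (A : algType K) (Delta : {linear A -> ctens A A})
    (X S : set A) :
  Delta 1 = 1 ⊗ 1 -> (forall x y, Delta (x * y) = ctens_mul (Delta x) (Delta y)) ->
  is_subalg S -> (forall x, X x -> tens_span (gen_subalg X) S (Delta x)) ->
  forall x, gen_subalg X x -> tens_span (gen_subalg X) S (Delta x).
Proof.
move=> D1 DM S_alg HX; have G_alg := gen_subalg_subalg X.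
have sub := tens_span_submod S (subalg_submod G_alg).
apply: gen_subalg_min => //; split.
- by rewrite /= D1; apply: tens_span_pure; [case: G_alg | case: S_alg].
- by move=> x y Hx Hy /=; rewrite linearD; case: sub => _ SD _; apply: SD.
- by move=> a x Hx /=; rewrite linearZ; case: sub => _ _; apply.
- by move=> x y Hx Hy /=; rewrite DM; apply: tens_spanM.
Qed.

Lemma ctens_img_submod (M N : lmodType K) (S : set M) (T : set N) :
  submod S -> submod (ctens_img S T).
Proof.
case=> _ _ SZ; split=> [|_ _ [r Sr <-] [s Ss <-]|a _ [r Sr <-]].
- by exists (fun=> [::]).
- exists (craw_add r s); last by rewrite cpiD.
  by move=> n p; rewrite mem_cat => /orP[/Sr|/Ss].
- exists (craw_scale a r); last by rewrite -ctens_scaleE.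
  by move=> n _ /mapP[p /Sr[? ?] ->] /=; split=> //; apply: SZ.
Qed.

End TensorSpan.

Section TensorPowers.
Variables (k : fieldType) (U : algType (hser k)).
Implicit Types (S T X : set U) (g : U -> U).

Lemma tpow_img_submod S T d : submod S -> submod (tpow_img S T d).
Proof. by move=> S_sub; elim: d => //= d IH; apply: ctens_img_submod. Qed.

Lemma tpow_map_linear g d : linear g -> linear (@tpow_map _ U g d).
Proof. by move=> Lg; elim: d => //= d IH; apply: ctens_map_linear. Qed.

Lemma iter_Delta_linear (Delta : {linear U -> ctens U U}) d :
  linear (iter_Delta Delta d).
Proof.
elim: d => [|d IH] a x y //=.
by rewrite linearP; apply: ctens_map_linear.
Qed.

Lemma tpow_map_img g S S' T T' d t : linear g ->
  (forall x, S x -> S' (g x)) -> (forall x, T x -> T' (g x)) ->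
  tpow_img S T d t -> tpow_img S' T' d (tpow_map g t).
Proof.
move=> Lg gS gT; elim: d t => [|d IH] t //=; first exact: gS.
case=> r Hr <-; rewrite ctens_map_cpi //; last exact: tpow_map_linear.
exists (fun n => [seq (tpow_map g p.1, g p.2) | p <- r n]) => // n _ /mapP[p /Hr[? ?] ->].
by split; [apply: IH | apply: gT].
Qed.

(** Each of the d + 1 tensor legs contributes one factor hbar, which is why the
    divided algebra asks delta_d to be divisible by hbar^d. *)
Lemma tpow_map_hbar g S S' T T' d t : linear g ->
  (forall x, S x -> exists2 y, S' y & g x = hbar *: y) ->
  (forall x, T x -> exists2 y, T' y & g x = hbar *: y) ->
  tpow_img S T d t ->
  exists2 y, tpow_img S' T' d y & tpow_map g t = hbar ^+ d.+1 *: y.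
Proof.
move=> Lg gS gT; elim: d t => [|d IH] t /=.
  by move=> /gS; rewrite expr1.
case=> r Hr <-.
pose F1 x := xget 0 [set y | tpow_img S' T' d y /\ tpow_map g x = hbar ^+ d.+1 *: y].
pose F2 x := xget 0 [set y | T' y /\ g x = hbar *: y].
have H1 x : tpow_img S T d x ->
    tpow_img S' T' d (F1 x) /\ tpow_map g x = hbar ^+ d.+1 *: F1 x.
  by case/IH=> y Sy E; apply: (@xgetPex _ 0
    [set y | tpow_img S' T' d y /\ tpow_map g x = hbar ^+ d.+1 *: y]); exists y.
have H2 x : T x -> T' (F2 x) /\ g x = hbar *: F2 x.
  by case/gT=> y Ty E; apply: (@xgetPex _ 0 [set y | T' y /\ g x = hbar *: y]); exists y.
pose r' n := [seq (F1 p.1, F2 p.2) | p <- r n].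
exists (cpi r').
  exists r' => // n _ /mapP[p /Hr[p1 p2] ->] /=.
  by split; [apply: (proj1 (H1 _ p1)) | apply: (proj1 (H2 _ p2))].
rewrite ctens_map_cpi //; last exact: tpow_map_linear.
rewrite -[_ *: cpi _]/(ctens_scale _ _) ctens_scaleE; apply/cpiP => m W phi B _.
apply: eq_bigr => n _; congr (_ *: _); rewrite !big_map.
rewrite [LHS]big_seq [RHS]big_seq; apply: eq_bigr => p /Hr[p1 p2] /=.
rewrite (proj2 (H1 _ p1)) (proj2 (H2 _ p2)) !bilinear_lZ //.
by rewrite (linZ (bilinear_r B _)) scalerA -exprSr.
Qed.

Section Coideal.
Variables (Delta : {linear U -> ctens U U}) (X T : set U).
Hypothesis X_coideal : forall x, X x -> tens_span X T (Delta x).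

Lemma iter_Delta_img d x : X x -> tpow_img X T d (iter_Delta Delta d x).
Proof.
elim: d x => //= d IH x Xx; have [s Hs <-] := X_coideal Xx.
have Ld := iter_Delta_linear Delta d.
rewrite (lin_sum (ctens_map_linear Ld _)); last by move=> ? ? ?.
exists (fun n => if n is 0%N then [seq (iter_Delta Delta d p.1, p.2) | p <- s] else [::]).
  by case=> // p /mapP[p' /Hs[? ?] ->]; split=> //; apply: IH.
apply: (hsums_uniq (@ctens_separated _ _ _) (cpi_sums _)).
set y := (X in hsums _ _ X).
apply: hsums_eq (_ : hsums setT (fun n => if n is 0%N then y else 0) y) => [[|n]|[|N]].
- by rewrite big_map; apply: eq_bigr => p _ /=; rewrite ctens_map_pure.
- by rewrite big_nil.
- by exists y; rewrite // big_ord0 subr0 scale1r.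
- rewrite big_ord_recl big1 ?addr0 ?scale1r; first exact: hcong_refl.
  by move=> i _; rewrite scaler0.
Qed.

(** The coproduct of a convergent sum is represented by the sequence of the
    coproducts of its terms. *)
Lemma iter_Delta_sums_img d s z : (forall i, X (s i)) -> hsums setT s z ->
  tpow_img X T d.+1 (iter_Delta Delta d.+1 z).
Proof.
move=> Xs sz; have Ld := iter_Delta_linear Delta d.
have /choice[r Hr] : forall n, exists r : seq (U * U),
    (forall p, p \in r -> X p.1 /\ T p.2) /\ \sum_(p <- r) p.1 ⊗ p.2 = Delta (s n).
  by move=> n; have [r Hr E] := X_coideal (Xs n); exists r.
rewrite /=; have -> : Delta z = cpi r.
  have DL : linear Delta by move=> a x y; rewrite linearP.
  apply: (hsums_uniq (@ctens_separated _ _ _) (hsums_linear DL sz)).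
  by apply: hsums_eq (cpi_sums r) => n; case: (Hr n).
rewrite ctens_map_cpi //.
exists (fun n => [seq (iter_Delta Delta d p.1, p.2) | p <- r n]) => // n p.
by case/mapP=> p' /(proj1 (Hr n))[? ?] ->; split=> //; apply: iter_Delta_img.
Qed.

End Coideal.
End TensorPowers.

(** * Ordered monomials and straightening *)

Section Exponents.

Definition tri : Type := (nat * nat * nat)%type.
Definition deg (b : tri) : nat := b.1.1 + b.1.2 + b.2.

Definition cube N : seq tri :=
  allpairs pair (allpairs pair (iota 0 N) (iota 0 N)) (iota 0 N).
Definition simplex N : seq tri := [seq b <- cube N | (deg b < N)%N].

Lemma mem_cube N b : (b \in cube N) = [&& b.1.1 < N, b.1.2 < N & b.2 < N]%N.
Proof.
case: b => -[x y] z /=; apply/allpairsP/and3P => [[[p c] /=]|[x_lt y_lt z_lt]].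
  case=> /allpairsP[[a b] /= [a_in b_in ->]] c_in [-> -> ->].
  by move: a_in b_in c_in; rewrite !mem_iota.
exists ((x, y), z); split=> //=; last by rewrite mem_iota.
by apply/allpairsP; exists (x, y); rewrite !mem_iota.
Qed.

Lemma cube_uniq N : uniq (cube N).
Proof.
rewrite allpairs_uniq ?iota_uniq //; last by move=> [? ?] [? ?] _ _ [-> ->].
by rewrite allpairs_uniq ?iota_uniq // => -[? ?] [? ?] _ _ [-> ->].
Qed.

Lemma mem_simplex N b : (b \in simplex N) = (deg b < N)%N.
Proof.
rewrite mem_filter mem_cube; apply: andb_idr; rewrite /deg.
by case: b => -[x y] z /= lt; apply/and3P; split; lia.
Qed.

Lemma simplex_uniq N : uniq (simplex N).
Proof. exact/filter_uniq/cube_uniq. Qed.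

Lemma sum_cube (V : nmodType) (F : tri -> V) N :
  \sum_(b <- cube N) F b =
  \sum_(a < N) \sum_(b < N) \sum_(c < N) F (nat_of_ord a, nat_of_ord b, nat_of_ord c).
Proof.
rewrite -(big_mkord predT (fun a => \sum_(b < N) \sum_(c < N) F (a, nat_of_ord b, nat_of_ord c))).
rewrite big_allpairs big_allpairs /index_iota subn0; apply: eq_bigr => a _.
rewrite -(big_mkord predT (fun b => \sum_(c < N) F (a, b, nat_of_ord c))).
rewrite /index_iota subn0; apply: eq_bigr => b _.
by rewrite -(big_mkord predT (fun c => F (a, b, c))) /index_iota subn0.
Qed.

Lemma sum_simplex_widen (V : nmodType) (F : tri -> V) M N : (M <= N)%N ->
  \sum_(b <- simplex N | (deg b < M)%N) F b = \sum_(b <- simplex M) F b.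
Proof.
move=> MN; rewrite -big_filter; apply: perm_big; apply: uniq_perm.
- exact/filter_uniq/simplex_uniq.
- exact: simplex_uniq.
by move=> b; rewrite mem_filter !mem_simplex; case: ltnP => // /leq_trans ->.
Qed.

End Exponents.

(** Straightening of words in three letters. Letters act on a module by A
    (smallest), B and C (largest), and equality is only required modulo P.
    Exchanging two letters costs lower terms with a factor eta for each lost
    letter; this is what makes infinite sums of words converge to sums of
    ordered monomials. *)
Section Straightening.
Variables (R : comNzRingType) (Z : lmodType R) (q qi eta : R).
Variables (A B C : Z -> Z) (P : Z -> Prop) (v0 : Z).
Hypotheses (LA : linear A) (LB : linear B) (LC : linear C).
Hypotheses (P0 : P 0) (PD : forall x y, P x -> P y -> P (x + y)).
Hypothesis PZ : forall a x, P x -> P (a *: x).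
Hypotheses (PA : forall x, P x -> P (A x)) (PB : forall x, P x -> P (B x)).
Hypothesis PC : forall x, P x -> P (C x).
Hypothesis relCA : forall z, P (C (A z) - (qi *: A (C z) + eta *: B z)).
Hypothesis relCB : forall z, P (C (B z) - (q *: B (C z) - eta *: A z)).
Hypothesis relBA : forall z, P (B (A z) - (q *: A (B z) - eta *: C z)).

Definition ordered (b : tri) : Z := iter b.1.1 A (iter b.1.2 B (iter b.2 C v0)).

Inductive straight (n : nat) : Z -> Prop :=
| straight_rel z : P z -> straight n z
| straight_ordered b : (deg b <= n)%N ->
    straight n (eta ^+ (n - deg b) *: ordered b)
| straightD y z : straight n y -> straight n z -> straight n (y + z)
| straightZ a z : straight n z -> straight n (a *: z).

Lemma straight_eta n m z : (n <= m)%N -> straight n z ->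
  straight m (eta ^+ (m - n) *: z).
Proof.
move=> nm; elim=> {z} [z Pz|b bn|y z _ IHy _ IHz|a z _ IH].
- exact/straight_rel/PZ.
- rewrite scalerA -exprD (_ : m - n + (n - deg b) = m - deg b)%N; last by lia.
  by apply: straight_ordered; apply: leq_trans bn nm.
- by rewrite scalerDr; apply: straightD.
- by rewrite scalerA mulrC -scalerA; apply: straightZ.
Qed.

Lemma straight_etaS n z : straight n z -> straight n.+1 (eta *: z).
Proof. by move/(straight_eta (leqnSn n)); rewrite subSnn. Qed.

Lemma straight_cong n y z : P (z - y) -> straight n y -> straight n z.
Proof. by move=> Pzy ny; rewrite -(subrK y z); apply/straightD/ny/straight_rel. Qed.

Lemma straight_ordered_deg b : straight (deg b) (ordered b).
Proof. by have := straight_ordered (leqnn (deg b)); rewrite subnn scale1r. Qed.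

Lemma straight_linear n (X : Z -> Z) : linear X -> (forall x, P x -> P (X x)) ->
  (forall b, (deg b <= n)%N -> straight (deg b).+1 (X (ordered b))) ->
  forall z, straight n z -> straight n.+1 (X z).
Proof.
move=> LX PX HX z; elim=> {z} [z Pz|b bn|y z _ IHy _ IHz|a z _ IH].
- exact/straight_rel/PX.
- rewrite (linZ LX) -subSS; apply: straight_eta; [by []|exact: HX].
- by rewrite (linD LX); apply: straightD.
- by rewrite (linZ LX); apply: straightZ.
Qed.

(** Prefixing the smallest letter keeps monomials ordered; this is used on
    combinations obtained by moving B and C inwards. *)
Lemma straight_A n z : straight n z -> straight n.+1 (A z).
Proof.
apply: straight_linear => // -[[a b] c] _.
exact: (straight_ordered_deg (a.+1, b, c)).
Qed.

(** Induction on the degree: moving B or C across the first letter leaves a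
    shorter ordered monomial to be treated. *)
Lemma straight_BC n z : straight n z ->
  straight n.+1 (B z) /\ straight n.+1 (C z).
Proof.
elim/ltn_ind: n z => n IH; have SB z : straight n z -> straight n.+1 (B z).
  apply: straight_linear => // -[[a b] c]; case: a => [_|a lt_n].
    exact: (straight_ordered_deg (0%N, b.+1, c)).
  have y1 := straight_ordered_deg (a, b, c).
  have [By Cy] := IH _ lt_n _ y1.
  apply: straight_cong (relBA _) _; apply: straightD.
    exact/straightZ/straight_A.
  by rewrite -scaleN1r; apply/straightZ/straight_etaS.
have SBm m z : (m <= n)%N -> straight m z -> straight m.+1 (B z).
  rewrite leq_eqVlt => /predU1P[->|lt_n]; first exact: SB.
  by move=> mz; case: (IH _ lt_n _ mz).
move=> z nz; split; first exact: SB.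
apply: straight_linear nz => // -[[a b] c]; case: a => [|a] le_n; last first.
  have y1 := straight_ordered_deg (a, b, c).
  have [By Cy] := IH _ le_n _ y1.
  apply: straight_cong (relCA _) _; apply: straightD.
    exact/straightZ/straight_A.
  exact: straight_etaS.
case: b le_n => [_|b le_n]; first exact: (straight_ordered_deg (0%N, 0%N, c.+1)).
have y1 := straight_ordered_deg (0%N, b, c).
have [By Cy] := IH _ le_n _ y1.
apply: straight_cong (relCB _) _; apply: straightD.
  exact/straightZ/SBm.
by rewrite -scaleN1r; apply/straightZ/straight_etaS/straight_A.
Qed.

Lemma straight_sum n z : straight n z -> exists c : tri -> R,
  P (z - \sum_(b <- simplex n.+1) (c b * eta ^+ (n - deg b)) *: ordered b).
Proof.
elim=> {z} [z Pz|b bn|y z _ [c Hc] _ [d Hd]|a z _ [c Hc]].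
- exists (fun=> 0); rewrite big1 ?subr0 // => b _; by rewrite mul0r scale0r.
- exists (fun b' => (b' == b)%:R); rewrite (bigD1_seq b) ?simplex_uniq //=; last first.
    by rewrite mem_simplex ltnS.
  rewrite eqxx mul1r big1 ?addr0 ?subrr // => b' /negPf ->.
  by rewrite mul0r scale0r.
- exists (fun b => c b + d b); under eq_bigr do rewrite mulrDl scalerDl.
  by rewrite big_split opprD addrACA; apply: PD.
- exists (fun b => a * c b); under eq_bigr do rewrite -mulrA -scalerA.
  by rewrite -scaler_sumr -scalerBr; apply: PZ.
Qed.

(* the numbering of letters is that of stokes_gen *)
Definition act_letter (i : 'I_3) : Z -> Z := nth C [:: A; C; B] i.

Lemma straight_word w : straight (size w) (foldr act_letter v0 w).
Proof.
elim: w => [|i w IH]; first exact: (straight_ordered_deg (0%N, 0%N, 0%N)).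
have [SB SC] := straight_BC IH; have SA := straight_A IH.
by case: i => [[|[|[|//]]] ?].
Qed.

End Straightening.

(** * The coideal subalgebra and its divided generators *)

Section CoidealSubalgebra.
Variables (k : fieldType) (k_char0 : [pchar k] =i pred0).
Local Notation K := (hser k).
Variables (U : algType K) (f : 'I_2 -> U) (l : 'I_3 -> U) (e : 'I_2 -> U).
Hypothesis U_complete : hcomplete [set: U].
Hypothesis rel : Uh_relations f l e.
Variables (Delta : {linear U -> ctens U U}) (eps : {lrmorphism U -> K^o}).
Hypothesis bialg : is_Uh_bialgebra f l e Delta eps.

Local Notation h := (cartan l).
Local Notation T := (tqV l).
Local Notation kap := (kap f l e).
Local Notation kap12 := (kap12 f l e).
Local Notation kap23 := (kap23 f l e).
Local Notation kap13 := (kap13 f l e).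
Local Notation k12 := (k12 f l e).
Local Notation k23 := (k23 f l e).
Local Notation k13 := (k13 f l e).
Local Notation SL := (Uh_sl f l e).
Local Notation R := (Uh_so3 f l e).
Local Notation Lsh := (so3_Lsh f l e Delta eps).

Definition so3_alg : set U := gen_subalg [set K12 f l e; K13 f l e; K23 f l e].
Definition stokes_alg : set U := gen_subalg [set k12; k13; k23].
Local Notation G := so3_alg.
Local Notation Gk := stokes_alg.

Lemma SL_alg : is_subalg SL.
Proof. exact/hclosure_subalg/gen_subalg_subalg. Qed.

Lemma SL_submod : submod SL. Proof. exact/subalg_submod/SL_alg. Qed.

Lemma SL_sums s y : (forall i, SL (s i)) -> hsums setT s y -> SL y /\ hsums SL s y.
Proof.
apply: hsums_closed => //; [exact: SL_submod|exact: hclosure_closed].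
Qed.

Lemma SL_gen x i : [\/ x = f i, x = h i | x = e i] -> SL x.
Proof. by move=> Hx; apply: sub_hclosure; apply: sub_gen_subalg; exists i. Qed.

Let SLD x y : SL x -> SL y -> SL (x + y). Proof. by case: SL_submod => _ D _; apply: D. Qed.
Let SLZ a x : SL x -> SL (a *: x). Proof. by case: SL_submod => _ _ Z; apply: Z. Qed.
Let SLB x y : SL x -> SL y -> SL (x - y). Proof. exact: submodB SL_submod x y. Qed.
Let SLM x y : SL x -> SL y -> SL (x * y). Proof. by case: SL_alg => _ _ _ M; apply: M. Qed.
Let SL1 : SL 1. Proof. by case: SL_alg. Qed.

Lemma SL_f i : SL (f i). Proof. by apply: (@SL_gen _ i); constructor. Qed.
Lemma SL_e i : SL (e i). Proof. by apply: (@SL_gen _ i); constructor. Qed.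

Let SL_Nh i : SL (- h i).
Proof. by apply: submodN SL_submod _ _; apply: (@SL_gen _ i); constructor. Qed.

Lemma SL_qexp1 i : SL (qexp1 (- h i)).
Proof. exact: (qexp1_closed U_complete SL_alg (@hclosure_closed _ _ _) (SL_Nh i)). Qed.

Lemma SL_T i : SL (T i).
Proof. by rewrite /tqV qexpE //; apply: (SLD SL1); apply: SLZ; apply: SL_qexp1. Qed.

Lemma SL_kap i : SL (kap i).
Proof. exact/(SLB (SL_f i))/SLZ/(SLM (SL_T i))/SL_e. Qed.

Lemma SL_kap13 : SL kap13.
Proof.
rewrite (kap13E k_char0 U_complete rel).
by apply: (SLB); [|apply: (SLZ)]; apply: (SLM); apply: SL_kap.
Qed.

Lemma K12E : K12 f l e = qp 2 *: kap12. Proof. by []. Qed.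
Lemma K23E : K23 f l e = qp 1 *: kap23. Proof. by []. Qed.
Lemma K13E : K13 f l e = qp 2 *: kap13. Proof. by []. Qed.

Lemma G_alg : is_subalg G. Proof. exact: gen_subalg_subalg. Qed.
Lemma G_submod : submod G. Proof. exact/subalg_submod/G_alg. Qed.

Lemma so3_alg_kap : [/\ G kap12, G kap23 & G kap13].
Proof.
have scaleV m (x : U) : x = qp (- m) *: (qp m *: x).
  by rewrite scalerA mulrC qpVr // scale1r.
have GZ a x : G x -> G (a *: x) by case: G_alg => _ _ + _; apply.
split; [rewrite (scaleV 2 kap12)|rewrite (scaleV 1 kap23)|rewrite (scaleV 2 kap13)];
  apply: GZ; apply: sub_gen_subalg; [left; left|right|left; right]; exact: erefl.
Qed.

Lemma so3_alg_SL : G `<=` SL.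
Proof.
apply: gen_subalg_min; first exact: SL_alg.
by move=> _ [[->|->]|->]; [rewrite K12E|rewrite K13E|rewrite K23E];
  apply: (SLZ); [apply: SL_kap|apply: SL_kap13|apply: SL_kap].
Qed.

Lemma so3_alg_sub : G `<=` R.
Proof.
move=> x Gx; split=> [|N]; first exact: so3_alg_SL.
by exists x => //; apply: hcong_refl SL_submod _ _.
Qed.

Lemma R_submod : submod R.
Proof. exact: hclosure_submod SL_submod G_submod. Qed.

Lemma R_sums s y : (forall i, G (s i)) -> hsums setT s y -> R y.
Proof.
move=> Gs sy; have [SLy SLsy] := SL_sums (fun i => so3_alg_SL (Gs i)) sy.
split=> // N; exists (\sum_(i < N) hbar ^+ i *: s i) => //.
by apply: (submod_sum G_submod) => i _ _; case: G_submod => _ _; apply.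
Qed.

Definition counit_compl (x : U) : U := x - (eps x)%:A.
Local Notation g := counit_compl.

Lemma counit_compl_linear : linear g.
Proof.
move=> a x y; rewrite /g linearP /= scalerDl -scalerA scalerBr opprD addrACA.
by [].
Qed.

(** On these elements id - eps gains a factor hbar. They form a subalgebra, by
    xy - eps(xy) = (x - eps(x)) y + eps(x) (y - eps(y)). *)
Definition hbar_small (S : set U) : set U :=
  [set x | S x /\ exists2 y, S y & g x = hbar *: y].

Lemma hbar_small_alg S : is_subalg S -> is_subalg (hbar_small S).
Proof.
move=> S_alg; have [S1 SD SZ SM] := S_alg; split.
- split=> //; exists 0; first by case: (subalg_submod S_alg).
  by rewrite /g rmorph1 scale1r subrr scaler0.
- move=> x y [Sx [x' Sx' Ex]] [Sy [y' Sy' Ey]]; split; first exact: SD.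
  exists (x' + y'); first exact: SD.
  by rewrite (linD counit_compl_linear) Ex Ey scalerDr.
- move=> a x [Sx [x' Sx' Ex]]; split; first exact: SZ.
  exists (a *: x'); first exact: SZ.
  by rewrite (linZ counit_compl_linear) Ex !scalerA mulrC.
move=> x y [Sx [x' Sx' Ex]] [Sy [y' Sy' Ey]]; split; first exact: SM.
exists (x' * y + eps x *: y'); first by apply: SD; [apply: SM | apply: SZ].
rewrite scalerDr scalerA mulrC -scalerA -Ey scalerAl -Ex /g rmorphM /=.
rewrite mulrBl scalerBr -scalerAl mul1r scalerA.
by rewrite addrA subrK.
Qed.

Lemma hbar_smallZ S x : is_subalg S -> S x -> hbar_small S (hbar *: x).
Proof.
move=> S_alg Sx; have [S1 _ SZ _] := S_alg; split; first exact: SZ.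
exists (g x); last by rewrite (linZ counit_compl_linear).
by apply: submodB => //; [exact: subalg_submod | apply: SZ].
Qed.

Lemma hbar_small_qq S x : is_subalg S -> S x -> hbar_small S (qq *: x).
Proof.
move=> S_alg Sx; rewrite qq_hbar -scalerA; apply: hbar_smallZ => //.
by case: S_alg => _ _ + _; apply.
Qed.

Lemma hbar_small_T i : hbar_small SL (T i).
Proof.
rewrite /tqV qexpE //; have [S1 SD _ _] := hbar_small_alg SL_alg.
by apply: SD => //; apply: hbar_smallZ SL_alg _; apply: SL_qexp1.
Qed.

Lemma so3_coideal x : G x -> tens_span G SL (Delta x).
Proof.
apply: coideal_gen; [exact: (Delta1 bialg)|exact: (DeltaM bialg)|exact: SL_alg|].
have [G12 G23 G13] := so3_alg_kap; have [G1 _ _ _] := G_alg.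
have [_ tD tZ] := tens_span_submod SL G_submod.
move=> _ [[->|->]|->]; [rewrite K12E|rewrite K13E|rewrite K23E];
  rewrite linearZ /=; apply: (tZ).
- rewrite (Delta_kap k_char0 U_complete bialg).
  by apply: (tD); apply: tens_span_pure => //; [apply: SL_kap | apply: SL_T].
- rewrite (Delta_kap13 k_char0 U_complete rel bialg) -scaleNr.
  apply: (tD); last apply: (tZ); first (apply: (tD); last apply: (tZ)); first apply: (tD).
  + by apply: tens_span_pure => //; apply: SL_kap13.
  + by apply: tens_span_pure => //; apply: (SLM); apply: SL_T.
  + by apply: tens_span_pure => //; apply: (SLM); [apply: SL_f | apply: SL_T].
  + apply: tens_span_pure => //; apply: (SLM); last exact: SL_e.
    by apply: (SLM); apply: SL_T.
- rewrite (Delta_kap k_char0 U_complete bialg).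
  by apply: (tD); apply: tens_span_pure => //; [apply: SL_kap | apply: SL_T].
Qed.

(** In each coproduct below, the right-hand factors are 1 modulo hbar or multiples
    of hbar. *)
Lemma stokes_coideal x : Gk x -> tens_span Gk (hbar_small SL) (Delta x).
Proof.
have S_alg := hbar_small_alg SL_alg; have [S1 SD SZ SM] := S_alg.
apply: coideal_gen; [exact: (Delta1 bialg)|exact: (DeltaM bialg)|exact: S_alg|].
have Gk_alg : is_subalg Gk := gen_subalg_subalg _.
have [G1 _ _ _] := Gk_alg.
have [_ tD tZ] := tens_span_submod (hbar_small SL) (subalg_submod Gk_alg).
have kE := (k12E k_char0 f l e, k23E k_char0 f l e, k13E k_char0 f l e).
have G12 : Gk k12 by apply: sub_gen_subalg; left; left.
have G13 : Gk k13 by apply: sub_gen_subalg; left; right.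
have G23 : Gk k23 by apply: sub_gen_subalg; right.
have small12 : hbar_small SL k12 by rewrite kE; apply: hbar_small_qq SL_alg _; apply: SL_kap.
have small23 : hbar_small SL k23 by rewrite kE; apply: hbar_small_qq SL_alg _; apply: SL_kap.
have small13 : hbar_small SL k13 by rewrite kE; apply: hbar_small_qq SL_alg SL_kap13.
have [sT1 sT2] : hbar_small SL (t1V l) /\ hbar_small SL (t2V l).
  by split; apply: hbar_small_T.
move=> _ [[->|->]|->].
- rewrite (Delta_k12 k_char0 U_complete bialg).
  by apply: (tD); apply: tens_span_pure.
- rewrite (Delta_k13 k_char0 U_complete rel bialg) -scaleNr -!pureZr.
  apply: (tD); first (apply: (tD); first apply: (tD)); apply: tens_span_pure => //.
  + exact: SM.
  + rewrite mulrC -scalerA; apply: hbar_small_qq SL_alg _.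
    by apply: (SLZ); apply: (SLM); [apply: SL_f | apply: SL_T].
  + rewrite scaleNr -scalerN; apply: hbar_small_qq SL_alg _.
    apply: submodN SL_submod _ _; apply: (SLM); last exact: SL_e.
    by apply: (SLM); apply: SL_T.
- rewrite (Delta_k23 k_char0 U_complete bialg).
  by apply: (tD); apply: tens_span_pure.
Qed.

Lemma stokes_small x : Gk x -> hbar_small G x.
Proof.
have [G12 G23 G13] := so3_alg_kap.
apply: (gen_subalg_min (hbar_small_alg G_alg)) => {}x [[->|->]|->].
- by rewrite (k12E k_char0); apply: hbar_small_qq G_alg _.
- by rewrite (k13E k_char0); apply: hbar_small_qq G_alg _.
- by rewrite (k23E k_char0); apply: hbar_small_qq G_alg _.
Qed.

(** The subalgebra generated by the k_ij lies in the divided algebra: its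
    iterated coproducts only involve elements that agree with their counits
    modulo hbar. *)
Lemma stokes_alg_Lsh : Gk `<=` Lsh.
Proof.
move=> x Gkx; split=> [|d]; first by apply/so3_alg_sub; case: (stokes_small Gkx).
apply: (@tpow_map_hbar _ _ _ Gk R (hbar_small SL)); first exact: counit_compl_linear.
- by move=> y /stokes_small[_ [z /so3_alg_sub Rz E]]; exists z.
- by move=> y [_ [z SLz E]]; exists z.
- exact: (iter_Delta_img stokes_coideal).
Qed.

Lemma counit_compl_R x : R x -> R (g x).
Proof.
move=> Rx; apply: (submodB R_submod) => //.
by apply: so3_alg_sub; apply: subalg_scalar G_alg.
Qed.

Lemma counit_compl_SL x : SL x -> SL (g x).
Proof. by move=> SLx; apply: SLB => //; apply/SLZ. Qed.

Lemma delta_sums_img d s z : (forall i, G (s i)) -> hsums setT s z ->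
  tpow_img R SL d (delta Delta eps d z).
Proof.
move=> Gs sz; have Rz := R_sums Gs sz.
case: d => [|d]; first exact: counit_compl_R.
apply: (@tpow_map_img _ _ _ G R SL SL _ _ counit_compl_linear).
- by move=> x /so3_alg_sub; apply: counit_compl_R.
- exact: counit_compl_SL.
- exact: (iter_Delta_sums_img so3_coideal d Gs sz).
Qed.

Lemma delta_linear d : linear (delta Delta eps d).
Proof.
move=> a x y; rewrite /delta (iter_Delta_linear Delta d).
exact: (tpow_map_linear counit_compl_linear).
Qed.

Lemma Lsh_submod : submod Lsh.
Proof.
have [R0 RD RZ] := R_submod; have iR := tpow_img_submod SL _ R_submod.
split.
- split=> // d; have [i0 _ _] := iR d; exists 0 => //.
  by rewrite (lin0 (delta_linear d)) scaler0.
- move=> x y [Rx Hx] [Ry Hy]; split=> [|d]; first exact: RD.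
  have [x' Ix Ex] := Hx d; have [y' Iy Ey] := Hy d; have [_ iD _] := iR d.
  by exists (x' + y'); [apply: iD | rewrite (linD (delta_linear d)) Ex Ey scalerDr].
- move=> a x [Rx Hx]; split=> [|d]; first exact: RZ.
  have [x' Ix Ex] := Hx d; have [_ _ iZ] := iR d.
  by exists (a *: x'); [apply: iZ | rewrite (linZ (delta_linear d)) Ex !scalerA mulrC].
Qed.

(** A series whose terms of order less than N come from the k_ij, for every N,
    lies in the divided algebra, because delta_d only has to be controlled
    modulo hbar^d. *)
Lemma Lsh_approx x : (forall N, exists y s z,
    [/\ Gk y, forall i, G (s i), hsums setT s z & x = y + hbar ^+ N *: z]) ->
  Lsh x.
Proof.
move=> H; have [_ LD _] := Lsh_submod; have [_ RD RZ] := R_submod; split=> [|d].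
  have [y [s [z [/stokes_alg_Lsh[Ry _] Gs /(R_sums Gs) Rz ->]]]] := H 0%N.
  by apply: RD => //; apply: RZ.
have [y [s [z [/stokes_alg_Lsh[_ /(_ d)[y' iy Ey]] Gs sz ->]]]] := H d.+1.
exists (y' + delta Delta eps d z).
  have [_ iD _] := tpow_img_submod SL d R_submod.
  exact: iD iy (delta_sums_img d Gs sz).
by rewrite (linD (delta_linear d)) (linZ (delta_linear d)) Ey scalerDr.
Qed.

End CoidealSubalgebra.

(** * The vector representation *)

Section MatrixModules.
Variables (k : fieldType) (m n : nat).
Local Notation K := (hser k).
Implicit Types X Y : 'M[K]_(m, n).

Lemma hcong_mx N X Y :
  hcong setT N X Y <-> forall a b, hdvd N (X a b - Y a b).
Proof.
split=> [[Z _ E] a b|H].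
  by have := congr1 (fun M : 'M_(m, n) => M a b) E; rewrite !mxE => ->; apply: hdvd_hbarX.
exists (\matrix_(a, b) ((fun i => (X a b - Y a b) (i + N)%N) : K)) => //.
apply/matrixP => a b; rewrite !mxE; apply/funext => i; rewrite coef_hbarXM.
by case: ltnP => [/H //|Ni]; rewrite subnK.
Qed.

Lemma matrix_complete : hcomplete [set: 'M[K]_(m, n)].
Proof.
split=> [X _ X0|s _ s_cauchy].
  apply/matrixP => a b; rewrite mxE; apply: hdvd_eq0 => N.
  by have /hcong_mx/(_ a b) := X0 N; rewrite mxE subr0.
have [|y Hy] := @hser_family_limit k _ (fun i (ab : 'I_m * 'I_n) => s i ab.1 ab.2).
  move=> N; have [r Hr] := s_cauchy N; exists r => i j ri rj ab.
  by have /hcong_mx := Hr i j ri rj; apply.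
exists (\matrix_(a, b) y (a, b)) => // N; have [r Hr] := Hy N.
exists r => i ri; apply/hcong_mx => a b; rewrite mxE.
exact: (Hr i ri (a, b)).
Qed.

End MatrixModules.

Section VectorRepresentation.
Variables (k : fieldType) (k_char0 : [pchar k] =i pred0).
Local Notation K := (hser k).
Local Notation M3 := 'M[K]_3.

(** The three-dimensional representation, in which h_i, e_i, f_i act as in the
    classical case. *)
Definition vec_f (i : 'I_2) : M3 := delta_mx (hi i) (lo i).
Definition vec_l (j : 'I_3) : M3 := delta_mx j j.
Definition vec_e (i : 'I_2) : M3 := delta_mx (lo i) (hi i).

Let dM (a b c d : 'I_3) : delta_mx a b * delta_mx c d = delta_mx a d *+ (b == c) :> M3.
Proof. exact: mul_delta_mx_cond. Qed.

(** A Cartan generator h has eigenvalues 1, -1, 0, so that h^3 = h and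
    sinh(hbar h) = sinh(hbar) h. *)
Lemma vec_cube i (h := vec_l (lo i) - vec_l (hi i)) n : h ^+ n.*2.+1 = h.
Proof.
have ne : (lo i == hi i) = false by rewrite -val_eqE /= /bump /= ltn_eqF.
have h3 : h * h * h = h.
  have -> : h * h = vec_l (lo i) + vec_l (hi i).
    rewrite /h /vec_l !(mulrBl, mulrBr) !dM [hi i == _]eq_sym ne !eqxx.
    by rewrite !mulr0n !mulr1n subr0 sub0r opprK.
  rewrite /h /vec_l mulrDl !mulrBr !dM [hi i == _]eq_sym ne !eqxx.
  by rewrite !mulr0n !mulr1n subr0 sub0r.
elim: n => [|n IH]; first by rewrite expr1.
by rewrite doubleS !exprSr -exprSr IH h3.
Qed.

Lemma vec_relations : Uh_relations vec_f vec_l vec_e.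
Proof.
have nadj (i j : 'I_2) : (i.+1 < j)%N || (j.+1 < i)%N -> False.
  by case: i => [[|[|//]] ?]; case: j => [[|[|//]] ?].
have M_complete := matrix_complete k 3 3.
split.
- move=> j i; rewrite /vec_l /vec_f !dM scalerBl !scaler_nat eq_sym.
  by case: eqP => [->|_]; case: eqP => [->|_]; rewrite ?mulr0n.
- move=> i j; rewrite /vec_l !dM eq_sym.
  by case: eqP => [->|_]; rewrite ?mulr0n.
- move=> j i; rewrite /vec_l /vec_e !dM scalerBl !scaler_nat eq_sym.
  by case: eqP => [->|_]; case: eqP => [->|_]; rewrite ?mulr0n.
- move=> i j; have [<-|ij] := eqVneq i j; last first.
    rewrite scale0r /vec_e /vec_f !dM; move: ij.
    by case: i => [[|[|//]] ?]; case: j => [[|[|//]] ?] //= _;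
      rewrite -?val_eqE /= !mulr0n subr0 scaler0.
  rewrite scale1r /vec_e /vec_f !dM !eqxx !mulr1n.
  apply: (hsums_uniq (complete_separated M_complete) _ (qsinhc_sums M_complete _)).
  apply: hsums_eq (hsums_scalar (sinhc : K) _) => n; rewrite /sinhc_term /sinhc.
  case: ifP => on; first by rewrite hC0 scale0r.
  by rewrite -[n]odd_double_half on add0n vec_cube.
- by move=> i j /nadj.
- by move=> i j /nadj.
- move=> i j _; rewrite expr2 /vec_e !dM.
  by case: i => [[|[|//]] ?]; case: j => [[|[|//]] ?];
    rewrite -?val_eqE /= !mulr0n ?mulr1n ?mul0r ?mulr0 ?dM -?val_eqE /= ?mulr0n ?scaler0 ?subr0 ?addr0.
- move=> i j _; rewrite expr2 /vec_f !dM.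
  by case: i => [[|[|//]] ?]; case: j => [[|[|//]] ?];
    rewrite -?val_eqE /= !mulr0n ?mulr1n ?mul0r ?mulr0 ?dM -?val_eqE /= ?mulr0n ?scaler0 ?subr0 ?addr0.
Qed.

End VectorRepresentation.

(** * Words in the generators and their pairing with matrix coefficients *)

Section Unshuffle.

Fixpoint extract (T : Type) (w : seq T) : seq (T * seq T) :=
  if w is i :: w' then (i, w') :: [seq (p.1, i :: p.2) | p <- extract w'] else [::].

Lemma extract_perm (T : eqType) (w : seq T) p :
  p \in extract w -> perm_eq (p.1 :: p.2) w.
Proof.
elim: w p => //= i w IH p; rewrite inE => /predU1P[-> //|/mapP[p' /IH Hp ->]] /=.
by have /= -> := perm_catCA [:: p'.1] [:: i] p'.2; rewrite perm_cons.
Qed.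

Lemma count_extract (T : eqType) (i : T) w :
  count (fun p => p.1 == i) (extract w) = count_mem i w.
Proof. by elim: w => //= j w <-; rewrite count_map; congr (_ + _)%N; apply: eq_count. Qed.

End Unshuffle.

Section Pairing.
Variables (k : fieldType) (k_char0 : [pchar k] =i pred0).
Local Notation K := (hser k).
Variables (U : algType K) (f : 'I_2 -> U) (l : 'I_3 -> U) (e : 'I_2 -> U).
Hypothesis U_complete : hcomplete [set: U].
Hypothesis rel : Uh_relations f l e.
Variables (Delta : {linear U -> ctens U U}) (eps : {lrmorphism U -> K^o}).
Hypothesis bialg : is_Uh_bialgebra f l e Delta eps.
Variable rho : {lrmorphism U -> 'M[K]_3}.
Hypotheses (rho_f : forall i, rho (f i) = vec_f k i).
Hypotheses (rho_e : forall i, rho (e i) = vec_e k i).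

Local Notation T := (tqV l).
Local Notation letter := 'I_3.

Definition kap_letter (i : letter) : U :=
  stokes_gen (kap12 f l e) (kap23 f l e) (kap13 f l e) i.
Definition kap_word (w : seq letter) : U := \prod_(i <- w) kap_letter i.

Let o0 : 'I_3 := @Ordinal 3 0 isT.
Let o1 : 'I_3 := @Ordinal 3 1 isT.
Let o2 : 'I_3 := @Ordinal 3 2 isT.

(** The matrix coefficients dual to the generators modulo hbar. *)
Definition coef_row (i : letter) : 'I_3 := nth o2 [:: o1; o2; o2] i.
Definition coef_col (i : letter) : 'I_3 := nth o0 [:: o0; o1; o0] i.
Definition mcoef (i : letter) (x : U) : K^o := rho x (coef_row i) (coef_col i).

Lemma mcoef_linear i : linear (mcoef i).
Proof. by move=> a x y; rewrite /mcoef linearP !mxE. Qed.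

Lemma mcoef1 i : mcoef i 1 = 0.
Proof.
rewrite /mcoef rmorph1 mxE; suff -> : (coef_row i == coef_col i) = false by [].
by case: i => [[|[|[|//]]] ?].
Qed.

Let mulmx_delta (X : 'M[K]_3) a b r c :
  (X * delta_mx a b) r c = if c == b then X r a else 0.
Proof.
rewrite -[X * _]/(X *m _) mxE (bigD1 a) //= mxE eqxx /= big1 ?addr0.
  by case: (c == b); rewrite ?mulr1 ?mulr0.
by move=> j /negPf ja; rewrite mxE ja mulr0.
Qed.

Let rho_T i r c : r != c -> rho (T i) r c 0%N = 0.
Proof.
move=> /negPf rc; rewrite /tqV qexpE // linearD linearZ rmorph1 /=.
by rewrite 3!mxE rc add0r hcoef0M mul0r.
Qed.

Lemma mcoef_kap i j : mcoef i (kap_letter j) 0%N = (i == j)%:R.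
Proof.
have E0 (a b : K) : (a - b) 0%N = a 0%N - b 0%N by [].
have lin a (x y : U) r c : rho (x - a *: y) r c = rho x r c - a * rho y r c.
  by rewrite linearB linearZ /= 3!mxE.
have kapE n r c : rho (kap f l e n) r c 0%N =
    vec_f k n r c 0%N - (if c == hi n then rho (T n) r (lo n) 0%N else 0)  :> k.
  rewrite /kap lin E0 rho_f rmorphM /= rho_e mulmx_delta hcoef0M coef0_qp mul1r.
  by case: (c == _).
have dM (a b c d : 'I_3) : delta_mx a b * delta_mx c d = delta_mx a d *+ (b == c) :> 'M[K]_3.
  exact: mul_delta_mx_cond.
have kap13E r c : (c == o2) = false -> rho (kap13 f l e) r c 0%N =
    (delta_mx o2 o0 : 'M[K]_3) r c 0%N.
  move=> c2; have F : rho (F31 f) = delta_mx o2 o0.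
    rewrite /F31 /qcomm linearB linearZ /= !rmorphM /= !rho_f /vec_f !dM.
    by rewrite mulr0n scaler0 subr0 mulr1n; congr delta_mx; apply/val_inj.
  have E : rho (E13 e) = delta_mx o0 o2.
    rewrite /E13 /qcomm linearB linearZ /= !rmorphM /= !rho_e /vec_e !dM.
    by rewrite mulr0n scaler0 subr0 mulr1n; congr delta_mx; apply/val_inj.
  have -> : kap13 f l e = F31 f - qq *: (f2 f * t1V l * e1 e)
      - 1 *: (t1V l * t2V l * E13 e) by rewrite scale1r.
  rewrite 2!lin F 2!E0 !hcoef0M [rho (_ * E13 e)]rmorphM /= E mulmx_delta c2.
  by rewrite [qq 0%N]E0 !coef0_qp subrr mul0r mulr0 !subr0.
case: j => [[|[|[|//]]] ?]; rewrite /mcoef /kap_letter /stokes_gen /=.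
- by rewrite /kap12 kapE; case: i => [[|[|[|//]]] ?]; rewrite /= ?rho_T // !mxE /= subr0.
- by rewrite /kap23 kapE; case: i => [[|[|[|//]]] ?]; rewrite /= ?rho_T // !mxE /= subr0.
- by case: i => [[|[|[|//]]] ?]; rewrite kap13E // mxE.
Qed.

(** The convolution product of the matrix coefficients along a word. *)
Fixpoint conv_word (u : seq letter) : U -> K^o :=
  match u with
  | [::] => eps
  | i :: u' => if u' is [::] then mcoef i
               else fun x => cfun (conv_word u') (mcoef i) (Delta x)
  end.

Lemma conv_word_linear u : linear (conv_word u).
Proof.
elim: u => [|i [|j u] IH] a x y; [exact: linearP|exact: mcoef_linear|].
rewrite [LHS]/= linearP; exact: (cfun_linear IH (@mcoef_linear i)).
Qed.

(** The same convolution product as a functional on tensor powers; it is used on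
    words of length d + 1, so that the default letter is never met. *)
Fixpoint tens_word d (u : seq letter) : tpow U d -> K^o :=
  match d return tpow U d -> K^o with
  | 0%N => mcoef (head o0 u)
  | d'.+1 => cfun (@tens_word d' (behead u)) (mcoef (head o0 u))
  end.

Lemma tens_word_linear d u : linear (@tens_word d u).
Proof.
elim: d u => [|d IH] u; first exact: mcoef_linear.
exact: (cfun_linear (IH _) (@mcoef_linear _)).
Qed.

Lemma tens_word_iter d u x : size u = d.+1 ->
  tens_word u (iter_Delta Delta d x) = conv_word u x.
Proof.
elim: d u x => [|d IH] [//|i [|j u]] x //= su.
have Ld := iter_Delta_linear Delta d.
rewrite cfun_map //; [|exact: tens_word_linear|exact: mcoef_linear].
congr (cfun _ _ _); apply/funext => y /=; apply: IH.
by case: su => <-.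
Qed.

Lemma tens_word_map d u (t : tpow U d) :
  tens_word u (tpow_map (counit_compl eps) t) = tens_word u t.
Proof.
have Lg := @counit_compl_linear _ _ eps.
have E i : mcoef i \o counit_compl eps = mcoef i.
  apply/funext => x; rewrite /= /counit_compl (linB (@mcoef_linear i)).
  by rewrite (linZ (@mcoef_linear i)) mcoef1 scaler0 subr0.
elim: d u t => [|d IH] u t; first exact: (congr1 (fun F => F t) (E _)).
rewrite /= cfun_map //; last 3 first.
- exact: tens_word_linear.
- exact: mcoef_linear.
- exact: tpow_map_linear.
by rewrite E; congr (cfun _ _ _); apply/funext => y /=; apply: IH.
Qed.

(** Membership in the divided algebra is used through these numerical
    conditions only. *)
Lemma Lsh_conv_word x u : so3_Lsh f l e Delta eps x -> hdvd (size u) (conv_word u x).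
Proof.
case: u => [//|i u] [_ /(_ (size u))[y _ E]].
rewrite -(@tens_word_iter (size u)) // -tens_word_map -[tpow_map _ _]/(delta Delta eps _ x).
by rewrite E (linZ (@tens_word_linear _ _)); apply: hdvd_hbarX.
Qed.

Lemma stokes_letter i : stokes_alg f l e (qq *: kap_letter i).
Proof.
case: i => [[|[|[|//]]] ?]; apply: sub_gen_subalg; rewrite /kap_letter /stokes_gen /=.
- by rewrite -(k12E k_char0); left; left.
- by rewrite -(k23E k_char0); right.
- by rewrite -(k13E k_char0); left; right.
Qed.

Lemma stokes_word w : stokes_alg f l e (qq ^+ size w *: kap_word w).
Proof.
have [S1 _ SZ SM] : is_subalg (stokes_alg f l e) by apply: gen_subalg_subalg.
elim: w => [|i w IH]; first by rewrite /kap_word big_nil scale1r.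
rewrite /kap_word big_cons exprS -scalerA -/(kap_word w) scalerAr scalerAl.
by apply: SM; first exact: stokes_letter.
Qed.

(** The word in the k_ij lies in the divided algebra, and each of its letters
    accounts for one factor q - q^-1. *)
Lemma conv_word_short u w : (size w <= size u)%N ->
  hdvd (size u - size w) (conv_word u (kap_word w)).
Proof.
move=> wu; have := stokes_word w.
move=> /(stokes_alg_Lsh k_char0 U_complete rel bialg)/(@Lsh_conv_word _ u).
rewrite (linZ (conv_word_linear u)) qq_hbar exprMn mulrC -scalerA -[X in hdvd X _](subnKC wu).
move=> H; apply: (@hdvd_cancel _ (size w)).
by apply: hdvd_unit H; rewrite hcoef0X expf_neq0 ?qqu0.
Qed.

(** Sums of tensors of type word (x) anything, where the word has lost at least
    two of n letters, and of multiples of hbar: invisible to leading order. *)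
Definition negligible (n : nat) (t : ctens U U) : Prop :=
  exists s t', (forall p, p \in s -> (size p.1 + 2 <= n)%N) /\
    t = \sum_(p <- s) kap_word p.1 ⊗ p.2 + hbar *: t'.

Lemma negligible_hbar n t : negligible n (hbar *: t).
Proof. by exists [::], t; rewrite big_nil add0r. Qed.

Lemma negligible_pure n u y : (size u + 2 <= n)%N -> negligible n (kap_word u ⊗ y).
Proof.
move=> un; exists [:: (u, y)], 0; rewrite big_seq1 scaler0 addr0; split=> // p.
by rewrite inE => /eqP ->.
Qed.

Lemma negligibleD n t t' : negligible n t -> negligible n t' -> negligible n (t + t').
Proof.
move=> [r [a [Hr ->]]] [s [b [Hs ->]]]; exists (r ++ s), (a + b); split.
  by move=> p; rewrite mem_cat => /orP[/Hr|/Hs].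
by rewrite big_cat scalerDr addrACA.
Qed.

Lemma negligible_sum n (I : eqType) (r : seq I) (F : I -> ctens U U) :
  (forall i, i \in r -> negligible n (F i)) -> negligible n (\sum_(i <- r) F i).
Proof.
move=> HF; rewrite big_seq; apply: big_ind => //; last exact: negligibleD.
by rewrite -(scaler0 _ hbar); apply: negligible_hbar.
Qed.

Lemma Delta_letter i : exists t,
  Delta (kap_letter i) = kap_letter i ⊗ 1 + 1 ⊗ kap_letter i + hbar *: t.
Proof.
have T1 j : exists x, T j = 1 + hbar *: x.
  by exists (qexp1 (- cartan l j)); rewrite /tqV qexpE.
have simple j : exists t, Delta (kap f l e j) =
    kap f l e j ⊗ 1 + 1 ⊗ kap f l e j + hbar *: t.
  have [x E] := T1 j; exists (kap f l e j ⊗ x).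
  rewrite (Delta_kap k_char0 U_complete bialg) E [X in _ + X]pureDr pureZr.
  by rewrite addrA [1 ⊗ _ + _]addrC.
case: i => [[|[|[|//]]] ?]; rewrite /kap_letter /stokes_gen /=; try exact: simple.
have [x E1] := T1 ord0; have [y E2] := T1 ord_max.
exists (kap13 f l e ⊗ (y + x + hbar *: (x * y))
  + (qp (-1) * qqu k) *: (kap12 f l e ⊗ (f2 f * t1V l))
  - qqu k *: (kap23 f l e ⊗ (t1V l * t2V l * e1 e))).
rewrite (Delta_kap13 k_char0 U_complete rel bialg) qq_hbar.
have E : t1V l * t2V l = 1 + hbar *: (y + x + hbar *: (x * y)).
  rewrite /t1V /t2V E1 E2 mulrDl mul1r mulrDr mulr1 -scalerAl -scalerAr.
  by lmod_goals (hser k); ring.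
have -> : kap13 f l e ⊗ (t1V l * t2V l) =
    kap13 f l e ⊗ 1 + hbar *: (kap13 f l e ⊗ (y + x + hbar *: (x * y))).
  by rewrite E [LHS]pureDr pureZr.
by lmod_goals (hser k); ring.
Qed.

(** Modulo hbar the generators are primitive, so the coproduct of a word is the
    sum over all ways of distributing its letters between the two legs. *)
Lemma Delta_word w : negligible (size w)
  (Delta (kap_word w) - kap_word w ⊗ 1
   - \sum_(p <- extract w) kap_word p.2 ⊗ kap_letter p.1).
Proof.
elim: w => [|i w IH].
  rewrite /kap_word !big_nil (Delta1 bialg) subrr subr0 -(scaler0 _ hbar).
  exact: negligible_hbar.
have consE v : kap_word (i :: v) = kap_letter i * kap_word v by rewrite /kap_word big_cons.
rewrite consE (DeltaM bialg); have [t ->] := Delta_letter i.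
set D := Delta _ in IH *; set r := \sum_(p <- _) _ in IH.
rewrite [D in ctens_mul _ D](_ : D = kap_word w ⊗ 1 + r + (D - kap_word w ⊗ 1 - r)); last first.
  by lmod_goals (hser k); ring.
move: (D - _ - r) IH => J IH.
rewrite /= big_cons big_map /=.
have Er : \sum_(p <- extract w) kap_word (i :: p.2) ⊗ kap_letter p.1 =
    ctens_mul (kap_letter i ⊗ 1) r.
  rewrite /r ctens_mul_sumr; apply: eq_bigr => p _.
  by rewrite pure_mulE mul1r consE.
rewrite Er !(ctens_mulDl, ctens_mulDr) !pure_mulE !mul1r !mulr1 !ctens_mulZl.
set X := (X in negligible _ X).
rewrite (_ : X = ctens_mul (1 ⊗ kap_letter i) r
   + (ctens_mul (kap_letter i ⊗ 1) J + ctens_mul (1 ⊗ kap_letter i) J)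
   + hbar *: (ctens_mul t (kap_word w ⊗ 1) + ctens_mul t r + ctens_mul t J)); last first.
  by rewrite /X; lmod_goals (hser k); ring.
apply: negligibleD; last exact: negligible_hbar.
apply: negligibleD.
  rewrite /r ctens_mul_sumr; apply: negligible_sum => p /extract_perm/perm_size /= E.
  by rewrite pure_mulE mul1r; apply: negligible_pure; rewrite -E addn2.
have [s [t' [Hs ->]]] := IH; rewrite !ctens_mulDr !ctens_mulZr !ctens_mul_sumr.
apply: negligibleD; apply: negligibleD; try exact: negligible_hbar;
  apply: negligible_sum => p /Hs le_n; rewrite pure_mulE ?mul1r -?consE;
  by apply: negligible_pure; rewrite //= leqW.
Qed.

(** The leading pairing of two words of the same length counts the ways of
    matching their letters: [matchings u] if u and w have the same letters. *)
Fixpoint matchings (u : seq letter) : nat :=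
  if u is i :: u' then count_mem i u * matchings u' else 1%N.

Lemma matchings_gt0 u : (0 < matchings u)%N.
Proof. by elim: u => //= i u IH; rewrite muln_gt0 IH eqxx. Qed.

(** The last coefficient vanishes at 1 and the other ones kill words that are too
    short modulo hbar, so that of the coproduct only the extraction of one letter
    remains; this gives a recursion on the length. *)
Lemma conv_word_leading u w : size u = size w ->
  conv_word u (kap_word w) 0%N = if perm_eq u w then (matchings u)%:R else 0.
Proof.
elim: u w => [|i u IH] w.
  by case: w => // _; rewrite /= /kap_word big_nil rmorph1.
case: u IH => [|j u'] IH su.
  case: w su => [|a [|b w]] //= _; rewrite /kap_word big_seq1 mcoef_kap eqxx muln1.
  suff -> : perm_eq [:: i] [:: a] = (i == a) by case: (i == a).
  by apply/idP/eqP => [/(perm_small_eq (isT : size [:: a] <= 1)%N)[]|->].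
rewrite [LHS]/=; set v := j :: u' in IH su *; rewrite -/(conv_word v).
set F := conv_word v; have LF : linear F := conv_word_linear v.
have LC := cfun_linear LF (@mcoef_linear i).
have [s [t [Hs]]] := Delta_word w.
rewrite -addrA -opprD => /(canRL (subrK _)) ->.
rewrite !(linD LC) (linZ LC) !(lin_sum LC) (cfun_pure LF (@mcoef_linear i)) mcoef1.
have c0D (a b : K) : (a + b) 0%N = a 0%N + b 0%N by [].
have c0h (a : K^o) : (hbar *: a) 0%N = 0 by rewrite [LHS]hcoef0M; apply: mul0r.
rewrite !c0D !hcoef_sum c0h hcoef0M [X in _ * X](_ : _ = 0 :> k) // mulr0 addr0 add0r.
rewrite [X in X + _]big1_seq ?add0r => [|p /= /Hs le_n]; last first.
  rewrite (cfun_pure LF (@mcoef_linear i)) hcoef0M.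
  suff -> : F (kap_word p.1) 0%N = 0 by rewrite mul0r.
  have lt_v : (size p.1 < size v)%N by move: le_n su => /=; lia.
  by apply: (conv_word_short (ltnW lt_v)); rewrite subn_gt0.
have E p : p \in extract w -> cfun F (mcoef i) (kap_word p.2 ⊗ kap_letter p.1) 0%N =
    if p.1 == i then (if perm_eq (i :: v) w then (matchings v)%:R else 0) else 0.
  move=> /extract_perm Hp; rewrite (cfun_pure LF (@mcoef_linear i)) hcoef0M mcoef_kap.
  rewrite eq_sym; have [pi|_] := eqVneq; last by rewrite mulr0.
  rewrite mulr1 /F IH; last first.
    by have := perm_size Hp; rewrite -su /= => -[].
  by move: Hp; rewrite pi => /permPr <-; rewrite perm_cons.
rewrite big_seq (eq_bigr _ E) -big_seq -big_mkcond big_const_seq count_extract.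
rewrite iter_addr addr0; case: ifP => [/permP/(_ (pred1 i)) <-|_]; last by rewrite mul0rn.
by rewrite -mulrnA mulnC.
Qed.

End Pairing.

(** * Series of ordered monomials *)

Section Series.
Variables (k : fieldType) (k_char0 : [pchar k] =i pred0).
Local Notation K := (hser k).
Variables (U : algType K) (f : 'I_2 -> U) (l : 'I_3 -> U) (e : 'I_2 -> U).
Hypothesis U_complete : hcomplete [set: U].
Hypothesis rel : Uh_relations f l e.
Variables (Delta : {linear U -> ctens U U}) (eps : {lrmorphism U -> K^o}).
Hypothesis bialg : is_Uh_bialgebra f l e Delta eps.
Variable rho : {lrmorphism U -> 'M[K]_3}.
Hypotheses (rho_f : forall i, rho (f i) = vec_f k i).
Hypotheses (rho_e : forall i, rho (e i) = vec_e k i).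

Local Notation kap12 := (kap12 f l e).
Local Notation kap23 := (kap23 f l e).
Local Notation kap13 := (kap13 f l e).
Local Notation k12 := (k12 f l e).
Local Notation k23 := (k23 f l e).
Local Notation k13 := (k13 f l e).
Local Notation SL := (Uh_sl f l e).
Local Notation Lsh := (so3_Lsh f l e Delta eps).
Local Notation G := (so3_alg f l e).
Local Notation Gk := (stokes_alg f l e).
Local Notation conv_word := (conv_word Delta eps rho).
Local Notation kap_word := (kap_word f l e).

Let SL_sub := SL_submod f l e.

(* letters are numbered as in stokes_gen: 12, 23, 13 *)
Definition ordered_word (b : tri) : seq 'I_3 :=
  nseq b.1.1 (@Ordinal 3 0 isT) ++ nseq b.1.2 (@Ordinal 3 2 isT)
  ++ nseq b.2 (@Ordinal 3 1 isT).

Definition letter_counts (w : seq 'I_3) : tri :=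
  (count_mem (@Ordinal 3 0 isT) w, count_mem (@Ordinal 3 2 isT) w,
   count_mem (@Ordinal 3 1 isT) w).

Lemma size_ordered_word b : size (ordered_word b) = deg b.
Proof. by rewrite !size_cat !size_nseq addnA. Qed.

Lemma ordered_wordK : cancel ordered_word letter_counts.
Proof.
by case=> -[a b] c; rewrite /letter_counts !count_cat !count_nseq /= !mul0n !mul1n
  ?addn0 ?add0n.
Qed.

Lemma perm_ordered_word a b : perm_eq (ordered_word a) (ordered_word b) = (a == b).
Proof.
apply/idP/eqP => [/permP E|-> //].
by rewrite -(ordered_wordK a) /letter_counts !E -[RHS]ordered_wordK.
Qed.

Definition kap_mon (b : tri) : U := kap12 ^+ b.1.1 * kap13 ^+ b.1.2 * kap23 ^+ b.2.
Definition stokes_mon (b : tri) : U := k12 ^+ b.1.1 * k13 ^+ b.1.2 * k23 ^+ b.2.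

Lemma kap_word_ordered b : kap_word (ordered_word b) = kap_mon b.
Proof.
have nseqE n i : \prod_(j <- nseq n i) kap_letter f l e j = kap_letter f l e i ^+ n.
  by elim: n => [|n IH]; rewrite ?big_nil // big_cons IH exprS.
rewrite -[LHS]/(\prod_(j <- ordered_word b) kap_letter f l e j).
by rewrite !big_cat /= !nseqE mulrA.
Qed.

Lemma stokes_monE b : stokes_mon b = qq ^+ deg b *: kap_mon b.
Proof.
rewrite /stokes_mon (k12E k_char0) (k13E k_char0) (k23E k_char0) !exprZn.
rewrite -scalerAr -!scalerAl -scalerAr -scalerAl !scalerA -!exprD.
by congr (qq ^+ _ *: _); rewrite /deg; lia.
Qed.

Lemma conv_mon_short a b : (deg b <= deg a)%N ->
  hdvd (deg a - deg b) (conv_word (ordered_word a) (kap_mon b)).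
Proof.
rewrite -kap_word_ordered -!size_ordered_word => ba.
exact: conv_word_short.
Qed.

Lemma conv_mon_leading a b : deg a = deg b ->
  (conv_word (ordered_word a) (kap_mon b) 0%N == 0) = (a != b).
Proof.
rewrite -!size_ordered_word -kap_word_ordered => ab.
rewrite conv_word_leading // perm_ordered_word.
case: (a == b); last exact: eqxx.
by apply/negbTE/natk_neq0 => //; apply: matchings_gt0.
Qed.

(** The coefficients of a combination of ordered monomials are bounded by its
    pairings with words. For each s, one shows by descending induction on the
    degree that the coefficients are divisible by hbar^s or as divisible as
    claimed: monomials of higher degree are already known to be divisible, those
    of lower degree pair to multiples of hbar, and in the same degree the
    pairing is diagonal modulo hbar. *)
Lemma coefficient_bound (wt : nat -> nat) (M : nat) (c : tri -> K) :
  {homo wt : m n / (m <= n)%N} ->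
  (forall m n, (m <= n)%N -> (wt n <= wt m + (n - m))%N) ->
  (forall a, (deg a < M)%N ->
     hdvd (wt (deg a)) (conv_word (ordered_word a)
                          (\sum_(b <- simplex M) c b *: kap_mon b))) ->
  forall b, (deg b < M)%N -> hdvd (wt (deg b)) (c b).
Proof.
move=> wt_mono wt_slope Hc b bM.
suff H s : forall b, (deg b < M)%N -> hdvd (minn s (wt (deg b))) (c b).
  by have := H (wt (deg b)) b bM; rewrite minnn.
elim: s {b bM} => [|s IH] a aM; first by rewrite min0n.
have [d] := ubnP (M - deg a); elim: d a aM => // d IHd a aM.
rewrite ltnS => Md.
have [ws|sw] := leqP (wt (deg a)) s.
  by have := IH a aM; rewrite (minn_idPr ws) (minn_idPr (leqW ws)).
rewrite (minn_idPl sw); have := Hc a aM.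
move/(hdvd_le sw); rewrite (lin_sum (@conv_word_linear _ _ Delta eps rho _)).
rewrite (bigD1_seq a) ?simplex_uniq ?mem_simplex //= => Htot.
have lead : conv_word (ordered_word a) (kap_mon a) 0%N != 0.
  by rewrite conv_mon_leading ?eqxx.
apply: (hdvd_unit lead).
suff Hrest : hdvd s.+1 (\sum_(b <- simplex M | b != a)
    conv_word (ordered_word a) (c b *: kap_mon b)).
  have := hdvdB Htot Hrest; rewrite addrK.
  by rewrite (linZ (@conv_word_linear _ _ Delta eps rho _)) mulrC.
apply: hdvd_sum => b; rewrite mem_simplex => bM ba.
rewrite (linZ (@conv_word_linear _ _ Delta eps rho _)).
have [lt_ab|lt_ba|eq_ab] := ltngtP (deg a) (deg b).
- apply: hdvdMr; have := IHd b bM; rewrite (minn_idPl _); first by apply; lia.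
  by apply: leq_trans sw (wt_mono _ _ (ltnW lt_ab)).
- apply: hdvd_le (hdvdM (IH b bM) (conv_mon_short (ltnW lt_ba))).
  have := wt_slope _ _ (ltnW lt_ba); move: sw lt_ba; lia.
- have lead0 : hdvd 1 (conv_word (ordered_word a) (kap_mon b)).
    by apply/hdvd1/eqP; rewrite conv_mon_leading // eq_sym.
  apply: hdvd_le (hdvdM (IH b bM) lead0); rewrite -eq_ab; move: sw; lia.
Qed.

(** * The divided algebra consists of the series in the k_ij *)

Definition is_series (chi : tri -> K) (y : U) : Prop :=
  forall N, hcong SL N y (\sum_(b <- simplex N) chi b *: stokes_mon b).

Let SL_alg' := SL_alg f l e.

Lemma SL_kap_mon b : SL (kap_mon b).
Proof.
have [_ _ _ SM] := SL_alg'; have SX := subalgX SL_alg'.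
by apply: (SM); first apply: (SM); apply: SX;
  [apply: SL_kap | apply: SL_kap13 | apply: SL_kap].
Qed.

Lemma stokes_mon_cong N a b : hdvd (N - deg b) a ->
  hcong SL N (a *: stokes_mon b) 0.
Proof.
move=> aN; rewrite stokes_monE scalerA; apply: (hcong_hdvd SL_sub); last exact: SL_kap_mon.
have qd : hdvd (deg b) (qq ^+ deg b : K).
  by rewrite qq_hbar exprMn; apply: hdvd_hbarX.
by apply: hdvd_le (hdvdM aN qd); lia.
Qed.

Lemma sum_stokes_cong N M (a : tri -> K) : (N <= M)%N ->
  hcong SL N (\sum_(b <- simplex M) a b *: stokes_mon b)
             (\sum_(b <- simplex N) a b *: stokes_mon b).
Proof.
move=> NM; rewrite (bigID (fun b => deg b < N)%N) sum_simplex_widen //=.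
rewrite -[X in hcong _ _ _ X]addr0; apply: (hcongD SL_sub); first exact: hcong_refl.
rewrite [X in hcong _ _ _ X](_ : 0 = \sum_(b <- simplex M | ~~ (deg b < N)%N) 0);
  last by rewrite big1.
apply: (hcong_sum SL_sub) => b _ bN; apply: stokes_mon_cong.
by rewrite (_ : N - deg b = 0)%N //; lia.
Qed.

Lemma monomial_seriesE chi y :
  monomial_series SL k12 k13 k23 (fun a b c => chi (a, b, c)) y <-> is_series chi y.
Proof.
have E N : \sum_(a < N) \sum_(b < N) \sum_(c < N)
    chi (nat_of_ord a, nat_of_ord b, nat_of_ord c) *: (k12 ^+ a * k13 ^+ b * k23 ^+ c)
    = \sum_(b <- cube N) chi b *: stokes_mon b by rewrite sum_cube.
have C N : hcong SL N (\sum_(b <- cube N) chi b *: stokes_mon b)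
                      (\sum_(b <- simplex N) chi b *: stokes_mon b).
  rewrite (bigID (fun b => deg b < N)%N) /= -big_filter -/(simplex N).
  rewrite -[X in hcong _ _ _ X]addr0; apply: (hcongD SL_sub); first exact: hcong_refl.
  rewrite [X in hcong _ _ _ X](_ : 0 = \sum_(b <- cube N | ~~ (deg b < N)%N) 0);
    last by rewrite big1.
  apply: (hcong_sum SL_sub) => b _ bN; apply: stokes_mon_cong.
  by rewrite (_ : N - deg b = 0)%N //; lia.
split=> H N.
  have [m /(_ _ (leq_maxl m N))] := H N; rewrite E => HN.
  apply: (hcong_trans SL_sub (hcong_sym SL_sub HN)).
  apply: (hcong_trans SL_sub (hcong_le SL_sub (leq_maxr m N) (C _))).
  exact/sum_stokes_cong/leq_maxr.
exists N => i Ni; rewrite E; apply: (hcong_trans SL_sub (hcong_le SL_sub Ni (C i))).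
exact/(hcong_le SL_sub Ni)/(hcong_sym SL_sub).
Qed.

(** Dividing the k_ij by hbar turns a series into a sum of homogeneous
    components in the undivided subalgebra. *)
Definition component (chi : tri -> K) (n : nat) : U :=
  \sum_(b <- simplex n.+1 | deg b == n) (chi b * qqu k ^+ n) *: kap_mon b.

Lemma kap_mon_G b : G (kap_mon b).
Proof.
have [G12 G23 G13] := so3_alg_kap k_char0 f l e; have G_alg := G_alg f l e.
have [_ _ _ SM] := G_alg; have SX := subalgX G_alg.
by apply: (SM); first apply: (SM); apply: SX.
Qed.

Lemma component_G chi n : G (component chi n).
Proof.
apply: (submod_sum (G_submod f l e)) => b _ _.
by have [_ _ GZ] := G_submod f l e; apply: GZ; apply: kap_mon_G.
Qed.

Lemma sum_component chi N :
  \sum_(i < N) hbar ^+ i *: component chi i = \sum_(b <- simplex N) chi b *: stokes_mon b.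
Proof.
elim: N => [|N IH]; first by rewrite big_ord0 big1_seq // => b; rewrite mem_simplex.
rewrite big_ord_recr IH /= -(sum_simplex_widen _ (leqnSn N)) [RHS](bigID (fun b => deg b < N)%N) /=.
congr (_ + _); rewrite scaler_sumr big_seq_cond [RHS]big_seq_cond.
apply: eq_big => [b|b /andP[_ /eqP bN]].
  by rewrite mem_simplex ltnS; case: (ltngtP (deg b) N).
by rewrite stokes_monE qq_hbar [(hbar * _) ^+ _]exprMn bN !scalerA; congr (_ *: _); ring.
Qed.

Lemma series_sums chi y : is_series chi y <-> hsums SL (component chi) y.
Proof. by split=> H N; have := H N; rewrite sum_component. Qed.

Lemma Gk_stokes_mon b : Gk (stokes_mon b).
Proof. by rewrite stokes_monE -kap_word_ordered -size_ordered_word; apply: stokes_word. Qed.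

Lemma Gk_partial N chi : Gk (\sum_(b <- simplex N) chi b *: stokes_mon b).
Proof.
have S := subalg_submod (gen_subalg_subalg [set k12; k13; k23]).
by apply: (submod_sum S) => b _ _; have [_ _ SZ] := S; apply: SZ; apply: Gk_stokes_mon.
Qed.

Lemma series_sums_setT chi y : is_series chi y -> hsums setT (component chi) y.
Proof. by move/series_sums => H N; apply: hcong_setT (H N). Qed.

Lemma series_Lsh chi y : is_series chi y -> Lsh y.
Proof.
move/series_sums_setT => H; apply: (Lsh_approx k_char0 U_complete rel bialg) => N.
have [z Hz ->] := hsums_tail U_complete N H.
exists (\sum_(i < N) hbar ^+ i *: component chi i), (fun i => component chi (N + i)), z.
by split=> //; [rewrite sum_component; apply: Gk_partial | move=> i; apply: component_G].
Qed.

Lemma series_exists chi : exists y, is_series chi y.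
Proof.
have [y Hy] := hsums_exists U_complete (component chi); exists y; apply/series_sums.
have SLc i : SL (component chi i) by apply: so3_alg_SL => //; apply: component_G.
by case: (SL_sums U_complete SLc Hy).
Qed.

Lemma series_lim_uniq chi y y' : is_series chi y -> is_series chi y' -> y = y'.
Proof.
move=> /series_sums_setT H /series_sums_setT.
exact: hsums_uniq (complete_separated U_complete) H.
Qed.

(** The coefficient bound with a constant weight. It yields the uniqueness of the
    coefficients of a series, and their convergence along approximations. *)
Lemma stokes_sum_hdvd N d :
  hcong setT N (\sum_(b <- simplex N) d b *: stokes_mon b) 0 ->
  forall b, (deg b < N)%N -> hdvd (N - deg b) (d b).
Proof.
move=> [z _]; rewrite subr0 => E b bN.
have H := @coefficient_bound (fun=> N) N (fun b => d b * qq ^+ deg b) _ _ _ b bN.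
have {H} : hdvd N (d b * qq ^+ deg b).
  apply: H => // [m n _|a aN]; first exact: leq_addr.
  under eq_bigr do rewrite -scalerA -stokes_monE.
  by rewrite E (linZ (@conv_word_linear _ _ Delta eps rho _)); apply: hdvd_hbarX.
rewrite qq_hbar exprMn mulrCA -{1}(subnKC (ltnW bN)) => /hdvd_cancel.
by rewrite mulrC; apply: hdvd_unit; rewrite hcoef0X expf_neq0 ?qqu0.
Qed.

Lemma series_uniq chi chi' y : is_series chi y -> is_series chi' y -> chi = chi'.
Proof.
move=> H H'; apply/funext => b; apply/eqP; rewrite -subr_eq0; apply/eqP/hdvd_eq0 => N.
apply: (@hdvd_le _ N (N.+1 + deg b - deg b)); first by lia.
apply: (@stokes_sum_hdvd _ (fun b => chi b - chi' b)); last by lia.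
under eq_bigr do rewrite scalerBl.
have C c M : is_series c y -> hcong setT M (\sum_(b <- simplex M) c b *: stokes_mon b) y.
  by move=> Hc; apply: hcong_sym => //; apply: hcong_setT (Hc M).
rewrite big_split sumrN /= -[X in hcong _ _ _ X](subrr y).
exact: (hcongB (@submodT _ U) (C _ (N.+1 + deg b)%N H) (C _ _ H')).
Qed.

(** Straightening with eta = 1 and no relators: the span of the ordered monomials
    is stable under multiplication by the generators. *)
Lemma so3_alg_span v : G v -> exists M (c : tri -> K),
  v = \sum_(b <- simplex M) c b *: kap_mon b.
Proof.
have qqi : qp 1 * qp (-1) = 1 :> K by apply: qpVr.
pose A x := kap12 * x; pose B x := kap13 * x; pose C x := kap23 * x.
have LA : linear A by apply: mull_linear.
have LB : linear B by apply: mull_linear.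
have LC : linear C by apply: mull_linear.
pose P (x : U) := x = 0.
have P0 : P 0 by []; have PD x y : P x -> P y -> P (x + y) by move=> -> ->; rewrite /P addr0.
have PZ a x : P x -> P (a *: x) by move=> ->; rewrite /P scaler0.
have P_A x : P x -> P (A x) by move=> ->; rewrite /P (lin0 LA).
have P_B x : P x -> P (B x) by move=> ->; rewrite /P (lin0 LB).
have P_C x : P x -> P (C x) by move=> ->; rewrite /P (lin0 LC).
have relCA z : P (C (A z) - (qp (-1) *: A (C z) + 1 *: B z)).
  have R : kap23 * kap12 = qp (-1) *: (kap12 * kap23) + kap13.
    by rewrite (kap13E k_char0 U_complete rel) addrC subrK.
  rewrite /P /A /B /C !mulrA R [(_ *: _ + kap13) * z]mulrDl -scalerAl.
  by lmod_goals (hser k); ring.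
have relCB z : P (C (B z) - (qp 1 *: B (C z) - 1 *: A z)).
  rewrite /P /A /B /C !mulrA (kap_rel23_13 k_char0 U_complete rel).
  by rewrite [(_ *: _ - kap12) * z]mulrBl -scalerAl; lmod_goals (hser k); ring.
have relBA z : P (B (A z) - (qp 1 *: A (B z) - 1 *: C z)).
  rewrite /P /A /B /C !mulrA (kap_rel13_12 k_char0 U_complete rel).
  by rewrite [(_ *: _ - kap23) * z]mulrBl -scalerAl; lmod_goals (hser k); ring.
pose W x := exists n, straight 1 A B C P 1 n x.
have le_st n m x : (n <= m)%N -> straight 1 A B C P 1 n x -> straight 1 A B C P 1 m x.
  by move=> nm /(straight_eta PZ nm); rewrite expr1n scale1r.
have W_A x : W x -> W (A x) by case=> n /(straight_A LA PZ P_A); exists n.+1.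
have st_BC n x := @straight_BC _ _ _ _ _ _ _ _ _ 1 LA LB LC PZ P_A P_B P_C relCA relCB relBA n x.
have W_B x : W x -> W (B x) by case=> n /st_BC[]; exists n.+1.
have W_C x : W x -> W (C x) by case=> n /st_BC[]; exists n.+1.
have WD x y : W x -> W y -> W (x + y).
  move=> [n Wx] [m Wy]; exists (maxn n m); apply: straightD.
    exact: le_st (leq_maxl _ _) Wx.
  exact: le_st (leq_maxr _ _) Wy.
have WZ a x : W x -> W (a *: x) by case=> n Wx; exists n; apply: straightZ.
have W1 : W 1.
  by exists 0%N; have := straight_ordered 1 A B C P 1 (leqnn (deg (0, 0, 0)%N)); rewrite scale1r.
have WM x y : W x -> W y -> W (x * y).
  case=> n Wx Wy; elim: Wx => {x} [_ ->|b _|x x' _ IH _ IH'|a x _ IH].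
  - by rewrite mul0r -(scale0r 1); apply: WZ.
  - have itW (X : U -> U) (n' : nat) z : (forall z, X z * y = X (z * y)) ->
        (forall z, W z -> W (X z)) -> W (z * y) -> W (iter n' X z * y).
      by move=> XM XW Wz; elim: n' => //= n' IH; rewrite XM; apply: XW.
    rewrite -scalerAl; apply: WZ; apply: (itW) => [z||]; [by rewrite /A mulrA|exact: W_A|].
    apply: (itW) => [z||]; [by rewrite /B mulrA|exact: W_B|].
    by apply: (itW) => [z||]; [rewrite /C mulrA|exact: W_C|rewrite mul1r].
  - by rewrite mulrDl; apply: WD.
  - by rewrite -scalerAl; apply: WZ.
have W_alg : is_subalg W by split.
have G_W : G `<=` W.
  apply: gen_subalg_min => // x [[->|->]|->]; apply: (WZ).
  - by rewrite -[X in W X]mulr1; apply: (W_A).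
  - by rewrite -[X in W X]mulr1; apply: (W_B).
  - by rewrite -[X in W X]mulr1; apply: (W_C).
move=> /G_W[n /(straight_sum P0 PD PZ)[c Hc]]; exists n.+1, c.
have {Hc} /eqP := Hc; rewrite subr_eq0 => /eqP ->.
have iterM x m z : iter m ( *%R x) z = x ^+ m * z.
  by elim: m => [|m IH] /=; rewrite ?mul1r // IH mulrA -exprS.
apply: eq_bigr => b _; rewrite expr1n mulr1; congr (_ *: _).
by rewrite /ordered !iterM mulr1 !mulrA.
Qed.

(** An element of the divided algebra is approximated by combinations of
    ordered monomials, on which the conditions on its iterated coproducts give
    the divisibility of the coefficients. *)
Lemma Lsh_partial x N : Lsh x -> exists chi : tri -> K,
  hcong SL N x (\sum_(b <- simplex N) chi b *: stokes_mon b).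
Proof.
move=> Lx; have [[_ /(_ N)[y Gy xy]] _] := Lx.
have [M0 [c0 Ey]] := so3_alg_span Gy.
pose M := maxn N M0; pose c b := if (deg b < M0)%N then c0 b else 0.
have {}Ey : y = \sum_(b <- simplex M) c b *: kap_mon b.
  rewrite (bigID (fun b => deg b < M0)%N) /= sum_simplex_widen ?leq_maxr //.
  rewrite [X in _ + X]big1 ?addr0 => [|b /negPf bM]; last by rewrite /c bM scale0r.
  by rewrite Ey big_seq [RHS]big_seq; apply: eq_bigr => b; rewrite mem_simplex /c => ->.
have Hc b : (deg b < M)%N -> hdvd (minn (deg b) N) (c b).
  apply: (@coefficient_bound (minn^~ N) M c) b => [m n mn|m n mn|a aM].
  - by rewrite leq_min geq_minr (leq_trans (geq_minl _ _) mn).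
  - by lia.
  rewrite -Ey; have LC := @conv_word_linear _ _ Delta eps rho (ordered_word a).
  have : hdvd (size (ordered_word a)) (conv_word (ordered_word a) x).
    exact: Lsh_conv_word Lx.
  rewrite size_ordered_word => Ha.
  have [z _ Exy] := xy; have -> : y = x - hbar ^+ N *: z by rewrite -Exy opprB addrC subrK.
  rewrite (linB LC) (linZ LC); apply: hdvdB.
    by apply: hdvd_le Ha; apply: geq_minl.
  by apply: (@hdvd_le _ _ N); [apply: geq_minr | apply: hdvd_hbarX].
have [v vu] := qqu_invertible k_char0.
have /choice[chi Hchi] : forall b, exists d, (deg b < N)%N -> c b = d * qq ^+ deg b.
  move=> b; case: (ltnP (deg b) N) => bN; last by exists 0.
  have := Hc b (leq_trans bN (leq_maxl _ _)); rewrite (minn_idPl (ltnW bN)).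
  move=> /hdvdP[d ->]; exists (d * v ^+ deg b) => _.
  rewrite qq_hbar [(hbar * _) ^+ _]exprMn.
  have -> : d * v ^+ deg b * (hbar ^+ deg b * qqu k ^+ deg b) =
      hbar ^+ deg b * d * (v * qqu k) ^+ deg b by rewrite [(v * _) ^+ _]exprMn; ring.
  by rewrite vu expr1n mulr1.
exists chi; apply: (hcong_trans SL_sub xy); rewrite Ey.
rewrite (bigID (fun b => deg b < N)%N) /= sum_simplex_widen ?leq_maxl //.
rewrite -[X in hcong _ _ _ X]addr0; apply: (hcongD SL_sub).
  rewrite big_seq [X in hcong _ _ _ X]big_seq; apply: (hcong_sum SL_sub) => b _.
  rewrite mem_simplex => bN; rewrite Hchi // -scalerA -stokes_monE.
  exact: hcong_refl.
rewrite big_seq_cond [X in hcong _ _ _ X](_ : 0 =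
  \sum_(b <- simplex M | (b \in simplex M) && ~~ (deg b < N)%N) 0); last by rewrite big1.
apply: (hcong_sum SL_sub) => b _ /andP[]; rewrite mem_simplex -leqNgt => bM Nb.
apply: (hcong_hdvd SL_sub); last exact: SL_kap_mon.
by have := Hc b bM; rewrite (minn_idPr Nb).
Qed.

(** The coefficients of the approximations stabilize modulo each power of hbar. *)
Lemma Lsh_series x : Lsh x -> exists chi, is_series chi x.
Proof.
move=> Lx; have /choice[c Hc] : forall N, exists chi : tri -> K,
    hcong SL N x (\sum_(b <- simplex N) chi b *: stokes_mon b).
  by move=> N; apply: Lsh_partial.
have comp N M : (N <= M)%N -> forall b, (deg b < N)%N -> hdvd (N - deg b) (c M b - c N b).
  move=> NM; apply: (@stokes_sum_hdvd _ (fun b => c M b - c N b)).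
  under eq_bigr do rewrite scalerBl.
  rewrite big_split sumrN /= -[X in hcong _ _ _ X](subrr x).
  apply: (@hcong_setT _ _ SL); apply: (hcongB SL_sub); apply: (hcong_sym SL_sub) => //.
  apply: (hcong_trans SL_sub (hcong_le SL_sub NM (Hc M))).
  exact: sum_stokes_cong.
exists (fun b n => c (n + deg b).+1 b n) => N.
apply: (hcong_trans SL_sub (Hc N)).
rewrite big_seq [X in hcong _ _ _ X]big_seq; apply: (hcong_sum SL_sub) => b _.
rewrite mem_simplex => bN.
rewrite -[X in hcong _ _ X]addr0 -[X in hcong _ _ _ X](addrNK (c N b *: stokes_mon b)).
rewrite [X in hcong _ _ _ X]addrC; apply: (hcongD SL_sub); first exact: hcong_refl.
apply: (hcong_sym SL_sub); rewrite -scalerBl; apply: stokes_mon_cong => i iN.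
rewrite -[LHS]/(c (i + deg b).+1 b i - c N b i).
have iN' : ((i + deg b).+1 <= N)%N by move: iN; lia.
have := comp _ _ iN' b; rewrite ltnS leq_addl => /(_ isT i).
move=> E; rewrite -opprB -[c N b i - _]/((c N b - c (i + deg b).+1 b) i).
by rewrite E ?oppr0 //; lia.
Qed.

End Series.

(** * Noncommutative power series and their values *)

Section Words.
Variable I : finType.

Fixpoint words N : seq (seq I) :=
  if N is N'.+1 then [::] :: allpairs cons (enum I) (words N') else [::].

Lemma mem_words N w : (w \in words N) = (size w < N)%N.
Proof.
elim: N w => // N IH [|i w] //=; rewrite inE /= ltnS -IH.
by apply/allpairsP/idP => [[[j v] /= [_ vN [_ ->]]] //|wN]; exists (i, w); rewrite mem_enum.
Qed.

Lemma words_uniq N : uniq (words N).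
Proof.
elim: N => //= N IH; apply/andP; split.
  by apply/negP => /allpairsP[[? ?] [_ _]].
by rewrite allpairs_uniq ?enum_uniq // => -[? ?] [? ?] _ _ [-> ->].
Qed.

Lemma sum_words (V : nmodType) (F : seq I -> V) N :
  \sum_(w <- words N) F w = \sum_(n < N) \sum_(t : n.-tuple I) F t.
Proof.
have E n : (n < N)%N -> \sum_(t : n.-tuple I) F t = \sum_(w <- words N | size w == n) F w.
  move=> nN; rewrite -[RHS]big_filter -(big_map (@tval n I) predT F); apply: perm_big.
  apply: uniq_perm => [||w]; first by rewrite map_inj_uniq ?index_enum_uniq //; apply: val_inj.
    exact/filter_uniq/words_uniq.
  rewrite mem_filter mem_words; apply/mapP/andP => [[t _ ->]|[/eqP wn _]].
    by rewrite size_tuple eqxx.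
  by exists (tcast wn (in_tuple w)); rewrite ?mem_index_enum ?val_tcast.
rewrite (eq_bigr _ (fun (n : 'I_N) _ => E n (ltn_ord n))) (exchange_big_dep predT) //=.
rewrite big_seq [RHS]big_seq; apply: eq_bigr => w; rewrite mem_words => wN.
by rewrite (big_pred1 (Ordinal wN)) // => i; rewrite -val_eqE eq_sym.
Qed.

Lemma sum_words_widen (V : nmodType) (F : seq I -> V) M N : (M <= N)%N ->
  \sum_(w <- words N | (size w < M)%N) F w = \sum_(w <- words M) F w.
Proof.
move=> MN; rewrite -big_filter; apply: perm_big; apply: uniq_perm => [||w].
- exact/filter_uniq/words_uniq.
- exact: words_uniq.
by rewrite mem_filter !mem_words; case: ltnP => // /leq_trans ->.
Qed.

(** Cutting a word in two is the same as choosing two words. *)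
Lemma sum_words_cut (V : nmodType) (F : seq I -> seq I -> V) N :
  \sum_(w <- words N) \sum_(i < (size w).+1) F (take i w) (drop i w) =
  \sum_(u <- words N) \sum_(v <- words N | (size u + size v < N)%N) F u v.
Proof.
pose L := [seq (take i w, drop i w) | w <- words N, i <- iota 0 (size w).+1].
pose M := [seq (u, v) | u <- words N, v <- [seq v <- words N | (size u + size v < N)%N]].
transitivity (\sum_(p <- L) F p.1 p.2).
  rewrite big_allpairs_dep; apply: eq_bigr => w _.
  by rewrite -(big_mkord predT (fun i => F (take i w) (drop i w))) /index_iota subn0.
transitivity (\sum_(p <- M) F p.1 p.2); last first.
  by rewrite big_allpairs_dep; apply: eq_bigr => u _; rewrite big_filter.
apply: perm_big; apply: uniq_perm => [||[u v]].
- apply: allpairs_uniq_dep => [||[w i] [w' i']]; first exact: words_uniq.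
    by move=> w _; apply: iota_uniq.
  move=> /allpairsPdep[w1 [i1 [_]]]; rewrite mem_iota ltnS => i1_le [-> ->].
  move=> /allpairsPdep[w2 [i2 [_]]]; rewrite mem_iota ltnS => i2_le [-> ->] /= [E1 E2].
  have Ew : w1 = w2 by rewrite -(cat_take_drop i1 w1) E1 E2 cat_take_drop.
  move: E1 => /(congr1 size); rewrite Ew in i1_le *.
  by rewrite !size_take_min !(minn_idPl _) // => ->.
- apply: allpairs_uniq_dep => [||[w i] [w' i'] _ _ [-> ->] //]; first exact: words_uniq.
  by move=> w _; apply/filter_uniq/words_uniq.
apply/allpairsPdep/allpairsPdep => [[w [i [wN]]]|[u' [v' [uN]]]].
  rewrite mem_iota ltnS => i_le [-> ->]; exists (take i w), (drop i w).
  move: wN; rewrite mem_filter !mem_words -size_cat cat_take_drop => wN.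
  by rewrite wN size_take_min size_drop; split=> //; move: i_le wN; lia.
rewrite mem_filter !mem_words => /andP[uvN _] [-> ->]; exists (u' ++ v'), (size u').
by rewrite mem_words size_cat mem_iota take_size_cat // drop_size_cat //; split=> //; lia.
Qed.

End Words.

Section NCValues.
Variables (k : fieldType) (I : finType) (U : algType (hser k)) (S : set U).
Local Notation K := (hser k).
Hypothesis S_alg : is_subalg S.
Variable x : I -> U.
Hypothesis x_small : forall i, exists2 y, S y & x i = hbar *: y.
Implicit Types (a b c : ncser k I).

Let S_sub := subalg_submod S_alg.

Definition word_value (w : seq I) : U := \prod_(i <- w) x i.

Lemma word_value_small w : exists2 y, S y & word_value w = hbar ^+ size w *: y.
Proof.
have [S1 _ _ SM] := S_alg; elim: w => [|i w [y Sy E]].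
  by exists 1; rewrite // /word_value big_nil scale1r.
have [z Sz Ez] := x_small i; exists (z * y); first exact: SM.
rewrite /word_value big_cons -/(word_value w) E Ez -scalerAl -scalerAr scalerA.
by rewrite -exprS.
Qed.

Lemma word_value_cong N d w : hdvd (N - size w) d -> hcong S N (d *: word_value w) 0.
Proof.
have [y Sy ->] := word_value_small w; rewrite scalerA => dN.
apply: (hcong_hdvd S_sub) Sy.
have : hdvd (size w) (hbar ^+ size w : K) by rewrite -[X in hdvd _ X]mulr1; apply: hdvd_hbarX.
by move/(hdvdM dN); apply: hdvd_le; rewrite addnC -leq_subLR.
Qed.

Lemma word_value_S w : S (word_value w).
Proof. by have [y Sy ->] := word_value_small w; case: S_alg => _ _ SZ _; apply: SZ. Qed.

Definition partial_value c N : U := \sum_(w <- words I N) c w *: word_value w.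

Lemma partial_value_S c N : S (partial_value c N).
Proof.
apply: (submod_sum S_sub) => w _ _.
by case: S_alg => _ _ SZ _; apply: SZ; apply: word_value_S.
Qed.

Lemma partial_value_cong c c' N :
  (forall w, (size w < N)%N -> hdvd (N - size w) (c w - c' w)) ->
  hcong S N (partial_value c N) (partial_value c' N).
Proof.
move=> H; rewrite /partial_value big_seq [X in hcong _ _ _ X]big_seq.
apply: (hcong_sum S_sub) => w _; rewrite mem_words => wN.
rewrite -[X in hcong _ _ X](addrNK (c' w *: word_value w)) -[X in hcong _ _ _ X]add0r.
apply: (hcongD S_sub); last exact: hcong_refl.
by rewrite -scalerBl; apply: word_value_cong; apply: H.
Qed.

Lemma partial_value_le c M N : (M <= N)%N ->
  hcong S M (partial_value c N) (partial_value c M).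
Proof.
move=> MN; rewrite /partial_value (bigID (fun w => size w < M)%N) /= sum_words_widen //.
rewrite -[X in hcong _ _ _ X]addr0; apply: (hcongD S_sub); first exact: hcong_refl.
rewrite [X in hcong _ _ _ X](_ : 0 = \sum_(w <- words I N | ~~ (size w < M)%N) 0);
  last by rewrite big1.
apply: (hcong_sum S_sub) => w _ wM; apply: word_value_cong.
by rewrite (_ : M - size w = 0)%N //; apply/eqP; rewrite subn_eq0 leqNgt.
Qed.

Lemma nc_valueE c y : nc_value S x c y <-> forall N, hcong S N y (partial_value c N).
Proof.
rewrite /nc_value; split=> H N.
  have [m /(_ _ (leq_maxl m N))] := H N.
  rewrite -(sum_words (fun w => c w *: word_value w)) => HN.
  apply: (hcong_trans S_sub (hcong_sym S_sub HN)).
  exact/partial_value_le/leq_maxr.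
exists N => i Ni; rewrite -(sum_words (fun w => c w *: word_value w)).
exact/(hcong_le S_sub Ni)/(hcong_sym S_sub).
Qed.

Lemma hcongM N y y' z z' : S y' -> S z -> hcong S N y y' -> hcong S N z z' ->
  hcong S N (y * z) (y' * z').
Proof.
have [_ _ _ SM] := S_alg; move=> Sy' Sz [u Su Eu] [v Sv Ev].
apply: (hcong_trans S_sub (y := y' * z)).
  by exists (u * z); [apply: SM | rewrite -mulrBl Eu scalerAl].
by exists (y' * v); [apply: SM | rewrite -mulrBr Ev scalerAr].
Qed.

(** The two sides differ by products of words of total length at least N, whose
    values are divisible by hbar^N. *)
Lemma partial_valueM a b N :
  hcong S N (partial_value (ncser_mul a b) N) (partial_value a N * partial_value b N).
Proof.
pose F u v := (a u * b v) *: (word_value u * word_value v).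
have -> : partial_value (ncser_mul a b) N =
    \sum_(w <- words I N) \sum_(i < (size w).+1) F (take i w) (drop i w).
  apply: eq_bigr => w _; rewrite scaler_suml; apply: eq_bigr => i _.
  by rewrite /F /word_value -big_cat cat_take_drop.
rewrite sum_words_cut /partial_value mulr_suml; apply: (hcong_sum S_sub) => u _ _.
rewrite mulr_sumr [X in hcong _ _ _ X](bigID (fun v => size u + size v < N)%N) /=.
rewrite -[X in hcong _ _ X]addr0; apply: (hcongD S_sub).
  rewrite (eq_bigr (fun v => a u *: word_value u * (b v *: word_value v))) => [|v _].
    exact: hcong_refl.
  by rewrite /F -scalerAl -scalerAr scalerA.
rewrite [X in hcong _ _ X]
  (_ : 0 = \sum_(v <- words I N | ~~ (size u + size v < N)%N) 0); last by rewrite big1.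
apply: (hcong_sum S_sub) => v _ uvN; apply: (hcong_sym S_sub).
rewrite -scalerAl -scalerAr scalerA /word_value -big_cat; apply: word_value_cong.
by rewrite (_ : N - size (u ++ v) = 0)%N //; apply/eqP; rewrite subn_eq0 leqNgt size_cat.
Qed.

Lemma partial_value_word v N : (size v < N)%N -> partial_value (word k v) N = word_value v.
Proof.
move=> vN; rewrite /partial_value (bigD1_seq v) ?words_uniq ?mem_words //=.
rewrite /word eqxx scale1r big1 ?addr0 // => w /negPf ->.
by rewrite scale0r.
Qed.

Variable R : set (ncser k I).
Hypothesis R_value : forall r, R r -> forall N, hcong S N (partial_value r N) 0.

Lemma ideal_value c : nc_ideal R c -> forall N, hcong S N (partial_value c N) 0.
Proof.
have S0 : S 0 by case: S_sub.
elim=> {c} [N|a b _ IHa _ IHb N|a r b Rr N].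
- rewrite /partial_value big1 => [|w _]; [exact: hcong_refl | by rewrite scale0r].
- rewrite /partial_value -[X in hcong _ _ _ X]addr0; under eq_bigr do rewrite scalerDl.
  by rewrite big_split; apply: (hcongD S_sub).
apply: (hcong_trans S_sub (partial_valueM _ _ _)).
rewrite -[X in hcong _ _ _ X](mul0r (partial_value b N)).
apply: hcongM => //; [exact: partial_value_S| |exact: hcong_refl].
apply: (hcong_trans S_sub (partial_valueM _ _ _)).
rewrite -[X in hcong _ _ _ X](mulr0 (partial_value a N)).
apply: hcongM; [exact: partial_value_S|exact: partial_value_S|exact: hcong_refl|].
exact: R_value.
Qed.

Lemma closure_value c : nc_closure (nc_ideal R) c -> nc_value S x c 0.
Proof.
move=> H; apply/nc_valueE => N; have [a Ia Ha] := H N; apply: (hcong_sym S_sub).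
apply: (hcong_trans S_sub _ (ideal_value Ia N)); apply: partial_value_cong => w wN.
by apply: (hdvd_le (leq_subr (size w) N)); apply/hdvdP; apply: Ha.
Qed.

Lemma nc_valueM a b y z : S y -> S z -> nc_value S x a y -> nc_value S x b z ->
  nc_value S x (ncser_mul a b) (y * z).
Proof.
move=> Sy Sz /nc_valueE Ha /nc_valueE Hb; apply/nc_valueE => N.
apply: (hcong_trans S_sub (y := partial_value a N * partial_value b N)).
  by apply: hcongM => //; apply: partial_value_S.
exact/(hcong_sym S_sub)/partial_valueM.
Qed.

End NCValues.

(** * The presentation *)

Section FreeLetters.
Variables (k : fieldType) (I : finType).
Local Notation K := (hser k).
Local Notation W := (seq I -> K^o).
Implicit Types (a b c : W) (R : set (ncser k I)).

(** Left multiplication by a letter. *)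
Definition prefix_letter (i : I) (c : W) : W :=
  fun w => if w is j :: w' then if j == i then c w' else 0 else 0.

Lemma prefix_letter_linear i : linear (prefix_letter i).
Proof.
move=> d a b; apply/funext => -[|j w].
  by rewrite -[RHS]/(d *: 0 + 0) scaler0 addr0.
rewrite -[RHS]/(d *: prefix_letter i a (j :: w) + prefix_letter i b (j :: w)).
by rewrite /=; case: eqP => // _; rewrite scaler0 addr0.
Qed.

Lemma prefix_letter_mul i a b :
  ncser_mul (prefix_letter i a) b = prefix_letter i (ncser_mul a b).
Proof.
apply/funext => -[|j w]; rewrite /ncser_mul /=; first by rewrite big_ord1 mul0r.
rewrite big_ord_recl /= mul0r add0r; case: eqP => // _.
by rewrite big1 // => n _; rewrite mul0r.
Qed.

Lemma prefix_letter_word i u : prefix_letter i (word k u) = word k (i :: u).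
Proof.
apply/funext => -[|j w] //=; rewrite /word eqseq_cons.
by case: eqP.
Qed.

Lemma ncser_mul_linear b : linear (fun a : W => ncser_mul a b : W).
Proof.
move=> d a c; apply/funext => w.
rewrite -[RHS]/(d * ncser_mul a b w + ncser_mul c b w) /ncser_mul mulr_sumr -big_split.
by apply: eq_bigr => n _; rewrite -[LHS]/((d * a _ + c _) * _) mulrDl mulrA.
Qed.

Lemma ncser_mul_word u b : ncser_mul (word k u) b = foldr prefix_letter b u.
Proof.
elim: u => [|i u IH]; last by rewrite -prefix_letter_word prefix_letter_mul IH.
apply/funext => w; rewrite /ncser_mul big_ord_recl take0 drop0 /word eqxx mul1r.
rewrite big1 ?addr0 // => n _; case: w n => [[]|j w n] //=.
by rewrite mul0r.
Qed.

Section Ideal.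
Variable R : set (ncser k I).

Lemma ideal_scale d c : nc_ideal R c -> nc_ideal R (d *: c : W).
Proof.
elim=> {c} [|a b _ IHa _ IHb|a r b Rr].
- rewrite (_ : d *: _ = (fun=> 0)); first exact: nc_ideal0.
  by apply/funext => w; apply: mulr0.
- rewrite (_ : d *: _ = (fun w => (d *: (a : W)) w + (d *: (b : W)) w)); first exact: nc_idealD.
  by apply/funext => w; apply: mulrDr.
- have L := ncser_mul_linear; rewrite -(linZ (L b)) -(linZ (L r)).
  exact: nc_ideal_gen.
Qed.

Lemma ideal_prefix i c : nc_ideal R c -> nc_ideal R (prefix_letter i c).
Proof.
have L := prefix_letter_linear i; elim=> {c} [|a b _ IHa _ IHb|a r b Rr].
- by rewrite -[fun=> 0]/(0 : W) (lin0 L); apply: nc_ideal0.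
- by rewrite -[fun w => _]/(a + b : W) (linD L); apply: nc_idealD.
- by rewrite -!prefix_letter_mul; apply: nc_ideal_gen.
Qed.

Lemma ideal_relator r c : R r -> nc_ideal R (ncser_mul r c).
Proof.
move=> Rr; have := nc_ideal_gen (word k [::]) c Rr.
by rewrite (ncser_mul_word [::] r).
Qed.

End Ideal.
End FreeLetters.

Section Presentation.
Variables (k : fieldType) (k_char0 : [pchar k] =i pred0).
Local Notation K := (hser k).
Variables (U : algType K) (f : 'I_2 -> U) (l : 'I_3 -> U) (e : 'I_2 -> U).
Hypothesis U_complete : hcomplete [set: U].
Hypothesis rel : Uh_relations f l e.
Variables (Delta : {linear U -> ctens U U}) (eps : {lrmorphism U -> K^o}).
Hypothesis bialg : is_Uh_bialgebra f l e Delta eps.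
Variable rho : {lrmorphism U -> 'M[K]_3}.
Hypotheses (rho_f : forall i, rho (f i) = vec_f k i).
Hypotheses (rho_e : forall i, rho (e i) = vec_e k i).

Local Notation k12 := (k12 f l e).
Local Notation k23 := (k23 f l e).
Local Notation k13 := (k13 f l e).
Local Notation SL := (Uh_sl f l e).
Local Notation Lsh := (so3_Lsh f l e Delta eps).
Local Notation x := (stokes_gen k12 k23 k13).
Local Notation R := (@stokes_relators k).
Local Notation W := (seq 'I_3 -> K^o).
Local Notation stokes_mon := (stokes_mon f l e).
Local Notation is_series := (is_series f l e).
Local Notation o12 := (@Ordinal 3 0 isT).
Local Notation o23 := (@Ordinal 3 1 isT).
Local Notation o13 := (@Ordinal 3 2 isT).

Let SLA := SL_alg f l e.
Let SL_sub := SL_submod f l e.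

Lemma stokes_genE i : x i = qq *: kap_letter f l e i.
Proof.
by case: i => [[|[|[|//]]] ?];
  rewrite /stokes_gen /= ?(k12E k_char0) ?(k23E k_char0) ?(k13E k_char0).
Qed.

Lemma stokes_gen_small i : exists2 y, SL y & x i = hbar *: y.
Proof.
exists (qqu k *: kap_letter f l e i); last by rewrite stokes_genE qq_hbar scalerA.
have [_ _ SZ _] := SLA; apply: SZ.
case: i => [[|[|[|//]]] ?]; rewrite /kap_letter /stokes_gen /=.
- exact: SL_kap.
- exact: SL_kap.
- exact: SL_kap13.
Qed.

Local Notation value := (partial_value x).

Lemma value_linear N : linear (fun c : W => value c N).
Proof.
move=> d a b; rewrite /partial_value scaler_sumr -big_split; apply: eq_bigr => w _ /=.
by rewrite scalerA -scalerDl.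
Qed.

Lemma word_value_ordered b : word_value x (ordered_word b) = stokes_mon b.
Proof.
rewrite stokes_monE // -kap_word_ordered -size_ordered_word /word_value.
elim: (ordered_word b) => [|i w IH].
  by rewrite /kap_word !big_nil scale1r.
rewrite /kap_word !big_cons IH stokes_genE -scalerAl -scalerAr scalerA -exprS.
by [].
Qed.

Let word_relation (u v w : seq 'I_3) (a b : K) : W :=
  (word k u : W) - (a *: (word k v : W) - b *: (word k w : W)).

Let solve_relation (V : lmodType K) (u v w : V) :
  v - (qp (-1) *: u + qq *: w) = - qp (-1) *: (u - (qp 1 *: v - (qp 1 * qq) *: w)).
Proof.
have qqi : qp 1 * qp (-1) = 1 :> K by apply: qpVr.
by lmod_goals (hser k); ring: qqi.
Qed.

Lemma relators_value r : R r -> forall N, hcong SL N (value r N) 0.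
Proof.
move=> Rr N; suff v0 : value r (maxn N 3) = 0.
  rewrite -v0; apply: (hcong_sym SL_sub).
  exact: (partial_value_le SLA stokes_gen_small r (leq_maxl N 3)).
have L := @value_linear (maxn N 3).
have wE u : (size u < 3)%N -> value (word k u) (maxn N 3) = word_value x u.
  by move=> u3; apply: partial_value_word; apply: leq_trans u3 (leq_maxr _ _).
have relE u v w a b : (size u < 3)%N -> (size v < 3)%N -> (size w < 3)%N ->
    word_value x u = a *: word_value x v - b *: word_value x w ->
    value (word_relation u v w a b) (maxn N 3) = 0.
  move=> u3 v3 w3 E; rewrite /word_relation (linB L) (linB L) !(linZ L) !wE // E.
  by rewrite subrr.
have word2 i j : word_value x [:: i; j] = x i * x j by rewrite /word_value !big_cons big_nil mulr1.
have word1 i : word_value x [:: i] = x i by rewrite /word_value big_seq1.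
case: Rr => [[->|->]|->].
- apply: (relE [:: o12; o23] [:: o23; o12] [:: o13] (qp 1) (qp 1 * qq)) => //.
  by rewrite !word2 word1; apply: k_rel12_23.
- apply: (relE [:: o23; o13] [:: o13; o23] [:: o12] (qp 1) qq) => //.
  by rewrite !word2 word1; apply: k_rel23_13.
- apply: (relE [:: o13; o12] [:: o12; o13] [:: o23] (qp 1) qq) => //.
  by rewrite !word2 word1; apply: k_rel13_12.
Qed.

(** Straightening in the free algebra: modulo the relators every word is a
    combination of ordered words, with a factor q - q^-1 for each lost letter. *)
Lemma word_straightening (w : seq 'I_3) : exists c : tri -> K,
  nc_ideal R ((word k w : W) -
    \sum_(b <- simplex (size w).+1)
       (c b * qq ^+ (size w - deg b)) *: (word k (ordered_word b) : W)).
Proof.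
pose A := @prefix_letter k 'I_3 o12; pose B := @prefix_letter k 'I_3 o13.
pose C := @prefix_letter k 'I_3 o23.
have LP := @prefix_letter_linear k 'I_3.
have LM (z : W) := @ncser_mul_linear k 'I_3 z.
pose P (c : W) := nc_ideal R c.
have P0 : P 0 by apply: nc_ideal0.
have PD a b : P a -> P b -> P (a + b) by apply: nc_idealD.
have PZ d a : P a -> P (d *: a) by apply: ideal_scale.
have PP i a : P a -> P (prefix_letter i a) by apply: ideal_prefix.
have relz u v z a b (c : W) : R (word_relation u v z a b) ->
    P (foldr (@prefix_letter k _) c u
       - (a *: foldr (@prefix_letter k _) c v - b *: foldr (@prefix_letter k _) c z)).
  move=> /(@ideal_relator _ _ R _ c); rewrite -!ncser_mul_word.
  by rewrite /word_relation (linB (LM c)) (linB (LM c)) !(linZ (LM c)).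
have r1 : R (word_relation [:: o12; o23] [:: o23; o12] [:: o13] (qp 1) (qp 1 * qq)) by left; left.
have r2 : R (word_relation [:: o23; o13] [:: o13; o23] [:: o12] (qp 1) qq) by left; right.
have r3 : R (word_relation [:: o13; o12] [:: o12; o13] [:: o23] (qp 1) qq) by right.
have relCA z : P (C (A z) - (qp (-1) *: A (C z) + qq *: B z)).
  have H := PZ (- qp (-1)) _ (relz _ _ _ _ _ z r1).
  rewrite (_ : C (A z) - _ = - qp (-1) *:
    (A (C z) - (qp 1 *: C (A z) - (qp 1 * qq) *: B z))) //.
  exact: solve_relation.
have relCB z : P (C (B z) - (qp 1 *: B (C z) - qq *: A z)) by exact: (relz _ _ _ _ _ z r2).
have relBA z : P (B (A z) - (qp 1 *: A (B z) - qq *: C z)) by exact: (relz _ _ _ _ _ z r3).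
have fw u : word k u = foldr (@prefix_letter k _) (word k [::]) u.
  by elim: u => //= i u <-; rewrite prefix_letter_word.
have := @straight_word _ _ _ _ _ _ _ _ P (word k [::]) (LP o12) (LP o13) (LP o23) PZ
  (PP o12) (PP o13) (PP o23) relCA relCB relBA w.
move=> /(straight_sum P0 PD PZ)[c Hc]; exists c.
rewrite (_ : word k w = foldr (act_letter A B C) (word k [::] : W) w); last first.
  rewrite fw; elim: w {Hc} => //= i w ->; rewrite /act_letter.
  by case: i => [[|[|[|//]]] i3] /=; congr prefix_letter; apply: val_inj.
rewrite (eq_bigr (fun b => (c b * qq ^+ (size w - deg b)) *: ordered A B C (word k [::] : W) b)) //.
move=> b _; congr (_ *: _); rewrite fw /ordered_word !foldr_cat.
have it n i (z : W) : foldr (@prefix_letter k _) z (nseq n i) = iter n (prefix_letter i) z.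
  by elim: n => //= n ->.
by rewrite !it.
Qed.

(** The values of words are rewritten accordingly, because relators have
    value 0. *)
Lemma word_value_straight (w : seq 'I_3) (c : tri -> K) :
  nc_ideal R ((word k w : W) -
    \sum_(b <- simplex (size w).+1) c b *: (word k (ordered_word b) : W)) ->
  word_value x w = \sum_(b <- simplex (size w).+1) c b *: stokes_mon b.
Proof.
move=> /(ideal_value SLA stokes_gen_small relators_value) H.
apply: (hseparated_eq (complete_separated U_complete)) => N.
have L M := @value_linear M.
have [z _] := H (maxn N (size w).+1); have wN := leq_maxr N (size w).+1.
rewrite subr0 (linB (L _)) (lin_sum (L _)) partial_value_word //.
rewrite big_seq (eq_bigr (fun b => c b *: stokes_mon b)) -?big_seq => [E|b]; last first.
  rewrite mem_simplex => bw; rewrite (linZ (L _)) partial_value_word ?word_value_ordered //.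
  by rewrite size_ordered_word; apply: leq_trans bw wN.
apply: (hcong_le (@submodT _ U) (leq_maxl N (size w).+1)).
by exists z.
Qed.

(** Values exist: the coefficient of an ordered monomial collects contributions
    of all words, and longer words contribute to higher order in hbar. *)
Lemma nc_value_exists (p : seq 'I_3 -> tri -> K)
    (coef := fun c N b => \sum_(w <- words 'I_3 N | (deg b <= size w)%N)
               c w * (p w b * qq ^+ (size w - deg b)) : K) :
  (forall w, nc_ideal R ((word k w : W) -
    \sum_(b <- simplex (size w).+1)
       (p w b * qq ^+ (size w - deg b)) *: (word k (ordered_word b) : W))) ->
  forall c : ncser k 'I_3, exists chi y, [/\ is_series chi y, nc_value SL x c y &
    forall N b, (deg b < N)%N -> hdvd (N - deg b) (chi b - coef c N b)].
Proof.
move=> Hp c; pose chi b : K := fun n => coef c (n + deg b).+1 b n.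
have qqd n : hdvd n (qq ^+ n : K).
  by rewrite qq_hbar exprMn; apply: hdvd_hbarX.
have Hchi N b : (deg b < N)%N -> hdvd (N - deg b) (chi b - coef c N b).
  move=> bN i iN; rewrite -[LHS]/(coef c (i + deg b).+1 b i - coef c N b i).
  have iN' : ((i + deg b).+1 <= N)%N by move: iN; lia.
  apply/eqP; rewrite subr_eq0 eq_sym; apply/eqP.
  rewrite /coef big_mkcond (bigID (fun w => size w < (i + deg b).+1)%N) /=.
  rewrite sum_words_widen // -big_mkcond -[LHS]/(_ i + _ i).
  rewrite [X in _ + X](_ : _ = 0) ?addr0 //.
  apply: (@hdvd_sum _ _ _ _ _ i.+1) => // w _; rewrite ltnS -ltnNge => iw.
  case: ifP => // _; apply: hdvdMl; apply: hdvdMl; apply: hdvd_le (qqd _).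
  by rewrite ltn_subRL addnC.
have valueE N : value c N = \sum_(b <- simplex N) coef c N b *: stokes_mon b.
  rewrite /partial_value big_seq (eq_bigr (fun w => \sum_(b <- simplex N | (deg b <= size w)%N)
    (c w * (p w b * qq ^+ (size w - deg b))) *: stokes_mon b)) => [|w]; last first.
    rewrite mem_words => wN; rewrite (word_value_straight (Hp w)) scaler_sumr.
    rewrite -(sum_simplex_widen _ wN); apply: eq_bigr => b _.
    by rewrite scalerA.
  rewrite -big_seq (exchange_big_dep predT) //=; apply: eq_bigr => b _.
  by rewrite -scaler_suml.
have [y Hy] := series_exists k_char0 U_complete rel chi.
exists chi, y; split=> //; apply/(nc_valueE SLA stokes_gen_small) => N.
apply: (hcong_trans SL_sub (Hy N)); rewrite valueE big_seq [X in hcong _ _ _ X]big_seq.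
apply: (hcong_sum SL_sub) => b _; rewrite mem_simplex => bN.
rewrite -[X in hcong _ _ X](subrK (coef c N b *: stokes_mon b)) -[X in hcong _ _ _ X]add0r.
apply: (hcongD SL_sub); last exact: hcong_refl.
by rewrite -scalerBl; apply: stokes_mon_cong => //; apply: Hchi.
Qed.

Lemma series_nc_value chi y : is_series chi y -> exists c, nc_value SL x c y.
Proof.
move=> Hy.
exists (fun w => if ordered_word (letter_counts w) == w then chi (letter_counts w) else 0).
apply/(nc_valueE SLA stokes_gen_small) => N; apply: (hcong_trans SL_sub (Hy N)).
set c := (X in partial_value _ X _).
rewrite (_ : \sum_(b <- _) _ = partial_value x c N); first exact: hcong_refl.
rewrite /partial_value /c (bigID (fun w => ordered_word (letter_counts w) == w)) /=.
rewrite [X in _ + X]big1 ?addr0 => [|w /negPf ->]; last by rewrite scale0r.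
transitivity (\sum_(w <- [seq ordered_word b | b <- simplex N])
    chi (letter_counts w) *: word_value x w).
  by rewrite big_map; apply: eq_bigr => b _; rewrite ordered_wordK word_value_ordered.
rewrite -[RHS]big_filter [RHS]big_seq.
rewrite [RHS](eq_bigr (fun w => chi (letter_counts w) *: word_value x w)).
  rewrite -big_seq; apply: perm_big; apply: uniq_perm => [||w].
  - by rewrite map_inj_uniq ?simplex_uniq //; apply: can_inj ordered_wordK.
  - exact/filter_uniq/words_uniq.
  rewrite mem_filter mem_words; apply/mapP/andP => [[b]|[/eqP <- wN]].
    by rewrite mem_simplex => bN ->; rewrite ordered_wordK eqxx size_ordered_word.
  by exists (letter_counts w); rewrite // mem_simplex -size_ordered_word.
by move=> w; rewrite mem_filter => /andP[-> _].
Qed.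

Lemma nc_value_uniq c y z : nc_value SL x c y -> nc_value SL x c z -> y = z.
Proof.
move=> /(nc_valueE SLA stokes_gen_small) Hy /(nc_valueE SLA stokes_gen_small) Hz.
apply: (hseparated_eq (complete_separated U_complete)) => N.
apply: (@hcong_setT _ _ SL); apply: (hcong_trans SL_sub (Hy N)).
exact: (hcong_sym SL_sub).
Qed.

(** Every element of the divided algebra is the value of the series of its ordered
    words. If c has value 0, all coefficients of the corresponding series of
    ordered monomials vanish; rewriting the words of c of length less than 2 N
    into ordered words by relators then leaves, on words of length less than N,
    multiples of hbar^N only. *)
Lemma stokes_presented : presented SL Lsh x R.
Proof.
have /choice[p Hp] := word_straightening.
have exV := nc_value_exists Hp.
have sL chi y : is_series chi y -> Lsh y by apply: series_Lsh.
split.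
- move=> i; apply: (stokes_alg_Lsh k_char0 U_complete rel bialg).
  by rewrite stokes_genE; apply: stokes_letter.
- by move=> c; have [chi [y [/sL Ly cy _]]] := exV c; exists y.
- move=> y /(Lsh_series k_char0 U_complete rel bialg rho_f rho_e)[chi].
  exact: series_nc_value.
move=> c; split; last first.
  exact: (closure_value SLA stokes_gen_small relators_value).
move=> c0 N; have [chi [y [Hy cy Hc]]] := exV c.
have y0 := nc_value_uniq cy c0; rewrite {}y0 in Hy.
have Hchi : chi = fun=> 0.
  apply: (series_uniq k_char0 U_complete rel bialg rho_f rho_e Hy) => M.
  by rewrite big1 => [|b _]; [exact: hcong_refl | rewrite scale0r].
pose L := (N + N)%N.
exists (\sum_(w <- words 'I_3 L) c w *: ((word k w : W) -
    \sum_(b <- simplex (size w).+1)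
       (p w b * qq ^+ (size w - deg b)) *: (word k (ordered_word b) : W))).
  elim/big_ind: _ => [|a b Ia Ib|w _]; first exact: nc_ideal0.
    exact: nc_idealD.
  exact: ideal_scale.
move=> v vN; apply/hdvdP.
have sumW (J : Type) (r : seq J) (F : J -> W) : (\sum_(j <- r) F j) v = \sum_(j <- r) F j v.
  by elim/big_rec2: _ => // j a b _ <-.
rewrite sumW big_seq (eq_bigr (fun w => c w * (v == w)%:R -
  \sum_(b <- simplex L | (deg b <= size w)%N)
  c w * (p w b * qq ^+ (size w - deg b)) * (v == ordered_word b)%:R)); last first.
  move=> w; rewrite mem_words => wL.
  rewrite -[LHS]/(c w * ((v == w)%:R - (\sum_(b <- _) _ : W) v)) mulrBr; congr (_ - _).
  rewrite sumW mulr_sumr -(sum_simplex_widen _ wL); apply: eq_bigr => b _.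
  by rewrite -mulrA.
rewrite -big_seq sumrB /= (exchange_big_dep predT) //=.
rewrite (bigD1_seq v) ?words_uniq ?mem_words //=; last exact: leq_trans vN (leq_addr _ _).
rewrite eqxx mulr1 big1 ?addr0 => [|w wv]; last first.
  by rewrite eq_sym (negPf wv) mulr0.
rewrite opprB addrC subrK; apply: hdvd_sum => b; rewrite mem_simplex => bL _.
rewrite -mulr_suml; have [vb|_] := eqVneq v (ordered_word b); last by rewrite mulr0.
rewrite mulr1; have := Hc L b bL; rewrite Hchi sub0r => /hdvdN; rewrite opprK.
apply: hdvd_le; rewrite /L -addnBA ?leq_addr // -size_ordered_word -vb.
exact: ltnW.
Qed.

(** Closure under products comes from the multiplicativity of evaluation. *)
Lemma Lsh_alg : is_subalg Lsh.
Proof.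
have [_ LD LZ] := Lsh_submod f l e Delta eps; have [gA exA surA _] := stokes_presented.
split=> //.
  apply: (stokes_alg_Lsh k_char0 U_complete rel bialg).
  by case: (gen_subalg_subalg [set k12; k13; k23]).
have Lsh_SL y : Lsh y -> SL y by case=> -[].
move=> y z Ly Lz; have [a ya] := surA _ Ly; have [b zb] := surA _ Lz.
have [y' Ly' ab] := exA (ncser_mul a b).
have := nc_valueM SLA stokes_gen_small (Lsh_SL _ Ly) (Lsh_SL _ Lz) ya zb.
by move/(nc_value_uniq ab) => <-.
Qed.

(** The coefficients identify the divided algebra with a product of copies of
    k[[hbar]], with its hbar-adic topology. *)
Lemma Lsh_complete : hcomplete Lsh.
Proof.
have sL chi y : is_series chi y -> Lsh y by apply: series_Lsh.
have Ls y : Lsh y -> exists chi, is_series chi y by apply: (Lsh_series _ _ _ _ rho_f rho_e).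
have su := @series_uniq _ k_char0 _ _ _ _ U_complete rel _ _ bialg _ rho_f rho_e.
have seriesZ a chi y : is_series chi y -> is_series (fun b => a * chi b) (a *: y).
  move=> H N; under [X in hcong _ _ _ X]eq_bigr do rewrite -scalerA.
  by rewrite -scaler_sumr; apply: (hcongZ SL_sub).
have seriesB chi chi' y y' : is_series chi y -> is_series chi' y' ->
    is_series (fun b => chi b - chi' b) (y - y').
  move=> H H' N; under [X in hcong _ _ _ X]eq_bigr do rewrite scalerBl.
  by rewrite big_split sumrN; apply: (hcongB SL_sub).
split=> [y _ y0|s Ls_s s_cauchy].
  by apply: (complete_separated U_complete) => N; apply: hcong_setT (y0 N).
have /choice[chi Hchi] := fun i => Ls _ (Ls_s i).
have [|c Hc] := @hser_family_limit k tri chi.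
  move=> N; have [m Hm] := s_cauchy N; exists m => i j mi mj b.
  have [z /Ls[zeta Hz] E] := Hm i j mi mj.
  have := seriesB _ _ _ _ (Hchi i) (Hchi j); rewrite E.
  move=> /su /(_ (seriesZ _ _ _ Hz)) /(congr1 (fun F => F b)) ->.
  exact: hdvd_hbarX.
have [y Hy] := series_exists k_char0 U_complete rel c; exists y; first exact: sL Hy.
move=> N; have [m Hm] := Hc N; exists m => i mi.
have /choice[d Hd] b := iffLR (hdvdP _ _) (Hm i mi b).
have [z Hz] := series_exists k_char0 U_complete rel d; exists z; first exact: sL Hz.
apply: (series_lim_uniq k_char0 U_complete (seriesB _ _ _ _ (Hchi i) Hy)).
have -> : (fun b => chi i b - c b) = (fun b => hbar ^+ N * d b) by apply/funext.
exact: seriesZ.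
Qed.

Lemma Lsh_coideal y : Lsh y -> hclosure setT (tens_span Lsh SL) (Delta y).
Proof.
move=> /(Lsh_series k_char0 U_complete rel bialg rho_f rho_e)[chi Hy]; split=> // N.
exists (Delta (\sum_(b <- simplex N) chi b *: stokes_mon b)); last first.
  apply: hcong_linear; first by move=> a u v; rewrite linearP.
  exact: hcong_setT (Hy N).
have [s Hs <-] := stokes_coideal k_char0 U_complete rel bialg (@Gk_partial _ k_char0 _ f l e N chi).
exists s => // p /Hs[Gp [SLp _]]; split=> //.
exact: (stokes_alg_Lsh k_char0 U_complete rel bialg).
Qed.

Lemma stokes_basis : topological_basis SL Lsh k12 k13 k23.
Proof.
split=> [chi|y Ly].
  have [y Hy] := series_exists k_char0 U_complete rel (fun b => chi b.1.1 b.1.2 b.2).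
  exists y; first exact: series_Lsh Hy.
  exact/(monomial_seriesE k_char0 U_complete rel (fun b => chi b.1.1 b.1.2 b.2)).
have [chi Hy] := Lsh_series k_char0 U_complete rel bialg rho_f rho_e Ly.
exists (fun a b c => chi (a, b, c)); split.
  exact/(monomial_seriesE k_char0 U_complete rel).
move=> chi' Hy'; apply/funext => a; apply/funext => b; apply/funext => c.
have H' := iffLR (monomial_seriesE k_char0 U_complete rel (fun b => chi' b.1.1 b.1.2 b.2) y) Hy'.
by rewrite (series_uniq k_char0 U_complete rel bialg rho_f rho_e Hy H').
Qed.

End Presentation.


Theorem theorem6p10 (k : fieldType) (k_char0 : [pchar k] =i pred0)
    (U : algType (hser k))
    (f : 'I_2 -> U) (l : 'I_3 -> U) (e : 'I_2 -> U)
    (U_gl3 : is_Uh_gl f l e)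
    (Delta : {linear U -> ctens U U}) (eps : {lrmorphism U -> (hser k)^o})
    (U_bialg : is_Uh_bialgebra f l e Delta eps) :
  let SL := Uh_sl f l e in
  let A := so3_Lsh f l e Delta eps in
  let k12 := k12 f l e in
  let k23 := k23 f l e in
  let k13 := k13 f l e in
  let t1V := t1V l in
  let t2V := t2V l in
  [/\ [/\ is_subalg A, hcomplete A &
          presented SL A (stokes_gen k12 k23 k13) (@stokes_relators k)],
      [/\ k12 * k23 = qp 1 *: (k23 * k12) - (qp 1 * qq) *: k13,
          k23 * k13 = qp 1 *: (k13 * k23) - qq *: k12 &
          k13 * k12 = qp 1 *: (k12 * k13) - qq *: k23],
      (forall x, A x -> hclosure setT (tens_span A SL) (Delta x)) /\
      [/\ Delta k12 = 1 ⊗ k12 + k12 ⊗ t1V,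
          Delta k23 = 1 ⊗ k23 + k23 ⊗ t2V &
          Delta k13 = 1 ⊗ k13 + k13 ⊗ (t1V * t2V)
            + (qp (-1) * qq) *: (k12 ⊗ (f2 f * t1V))
            - qq *: (k23 ⊗ (t1V * t2V * e1 e))] &
      topological_basis SL A k12 k13 k23].
Proof.
have [U_complete rel univ] := U_gl3.
have [rho [rho_f _ rho_e] _] :=
  univ _ _ _ _ (matrix_complete k 3 3) (vec_relations k).
split.
- split; [exact: Lsh_alg rho_f rho_e|exact: Lsh_complete rho_f rho_e|].
  exact: stokes_presented rho_f rho_e.
- split.
  + exact: (k_rel12_23 k_char0 U_complete rel).
  + exact: (k_rel23_13 k_char0 U_complete rel).
  + exact: (k_rel13_12 k_char0 U_complete rel).
- split; first by move=> x; apply: (Lsh_coideal k_char0 U_complete rel U_bialg rho_f rho_e).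
  split.
  + exact: (Delta_k12 k_char0 U_complete U_bialg).
  + exact: (Delta_k23 k_char0 U_complete U_bialg).
  + exact: (Delta_k13 k_char0 U_complete rel U_bialg).
- exact: stokes_basis rho_f rho_e.
Qed.
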